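(* Let $M\subset\mathbb{C}^2$ be a real-analytic Levi nondegenerate hypersurface and let $p\in M$. For a normalizing map $\varphi$ of $M$ at $p$, with target $N^p$, define \[ \Sigma_p:=\big(\varphi^{(2)}\big)^{-1}(\Sigma_0)\subset J^2_{M,p},\qquad \Sigma_0:=\big\{(x_1,y_1,x_2,y_2)\in J^2_{N^p,0}\colon\ x_2=-2x_1^2y_1-2y_1^3,\ \ y_2=2x_1y_1^2+2x_1^3\big\}. \] Then the surface $\Sigma_p\subset J^2_{M,p}\cong\mathbb{R}^4$ is independent of the normalizing map: if $\varphi$ and $\varphi_\prime$ are any two normalizing maps of $M$ at $p$, they define the same surface $\Sigma_p$.
   Context: Coordinates on $\mathbb{C}^2$ are $(z,w)=(x+iy,u+iv)$, with weights $[z]=[\overline{z}]=1$, $[w]=[\overline{w}]=2$, $[u]=2$. $T^cM=TM\cap J\,TM$ with $J$ the standard complex structure, and $M$ is Levi nondegenerate if $T^cM+[T^cM,T^cM]=TM$. A curve in $M$ through $q$ is CR-transversal at $q$ if its tangent at $q$ is not in $T^c_qM$. $J^2_{M,q}$ denotes the space of $2$-jets at $q$ of unparametrized curves in $M$ through $q$ which are CR-transversal at $q$. A local biholomorphism $\varphi$ sending $(M,q)$ to $(N,q')$ induces a diffeomorphism $\varphi^{(2)}\colon J^2_{M,q}\to J^2_{N,q'}$. A normalizing map of $M$ at $p=(z_p,w_p)$ is a composition $\varphi=\Phi_p\circ\tau_p$, where $\tau_p\colon(z,w)\mapsto(z-z_p,w-w_p)$ and $\Phi_p$ is a local biholomorphism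 fixing $0$ which sends $\tau_p(M)$ to a hypersurface $N^p$ of equation $v=z\overline{z}+\mathrm{O}(6)$, where $\mathrm{O}(6)$ is a convergent power series in $(z,\overline{z},u)$ whose monomials $z^j\overline{z}^ku^l$ all satisfy $j+k+2l\geqslant 6$. (Such maps always exist.) On such $N^p$, the functions $(x,y,u)$ are local coordinates near $0$ and $T^c_0N^p=\{u=0\}$, so CR-transversal curves through $0$ are graphs $u\mapsto(x(u),y(u))$, and $J^2_{N^p,0}\cong\mathbb{R}^4$ has coordinates $(x_1,y_1,x_2,y_2)=(\dot x(0),\dot y(0),\ddot x(0),\ddot y(0))$. *)

(* Defs.v *)
(* Stdlib reals with Coquelicot. *)
From Stdlib Require Export Reals List.
From Coquelicot Require Export Coquelicot.
Export ListNotations.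
Open Scope R_scope.

(** * The ambient space *)

(* C^2 with coordinates (z,w) = (x + i y, u + i v), as a real normed module:
   derivatives of maps R -> C2 are derivatives with respect to a real
   parameter. *)
Definition C2 : NormedModule R_AbsRing :=
  prod_NormedModule R_AbsRing C_R_NormedModule C_R_NormedModule.

(* The complex coordinates (z, w) and the real coordinates (x, y, u, v). *)
Definition complex_coords (q : C2) : list C := [fst q; snd q].
Definition real_coords (q : C2) : list R :=
  [Re (fst q); Im (fst q); Re (snd q); Im (snd q)].

Definition J (q : C2) : C2 := ((Ci * fst q)%C, (Ci * snd q)%C).

(** * Convergent power series in several variables *)

(* A multi-index is a list of exponents, of the same length as the list of
   variables.  This is the partial sum over the exponents between 0 and n. *)
Fixpoint mpsum {K : AbsRing} (n : nat) (c : list nat -> K) (X : list K) : K :=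
  match X with
  | nil => c nil
  | x :: X' =>
      sum_n (fun j => mult (pow_n x j) (mpsum n (fun alpha => c (j :: alpha)) X')) n
  end.

Definition mpseries_abs_converges {K : AbsRing} (c : list nat -> K)
    (X : list K) : Prop :=
  exists B : R, forall n : nat,
    mpsum (K := R_AbsRing) n (fun alpha => abs (c alpha)) (map abs X) <= B.

Definition is_mpseries {K : AbsRing} (c : list nat -> K) (X : list K) (l : K) : Prop :=
  mpseries_abs_converges c X /\
  filterlim (fun n => mpsum n c X) eventually
    (locally (T := AbsRing_UniformSpace K) l).

(* f is the sum of a power series in the (linear) coordinates [coords],
   centred at q and converging in a neighbourhood of q. *)
Definition analytic_at {K : AbsRing} (coords : C2 -> list K) (f : C2 -> K)
    (q : C2) : Prop :=
  exists c : list nat -> K,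
    locally q (fun q' => is_mpseries c (coords (minus q' q)) (f q')).

Definition real_analytic_at (f : C2 -> R) (q : C2) : Prop :=
  analytic_at (K := R_AbsRing) real_coords f q.

Definition holomorphic_at (f : C2 -> C) (q : C2) : Prop :=
  analytic_at (K := C_AbsRing) complex_coords f q.

Definition holomorphic_on (U : C2 -> Prop) (phi : C2 -> C2) : Prop :=
  forall q, U q ->
    holomorphic_at (fun q' => fst (phi q')) q /\
    holomorphic_at (fun q' => snd (phi q')) q.

Definition local_biholomorphism (phi : C2 -> C2) (q : C2) : Prop :=
  exists (U V : C2 -> Prop) (psi : C2 -> C2),
    open U /\ open V /\ U q /\
    (forall a, U a -> V (phi a) /\ psi (phi a) = a) /\
    (forall b, V b -> U (psi b) /\ phi (psi b) = b) /\
    holomorphic_on U phi /\ holomorphic_on V psi.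

(* phi sends the germ (M,q) onto the germ (N,q').  This is meaningful for a
   local biholomorphism phi at q. *)
Definition sends (phi : C2 -> C2) (M : C2 -> Prop) (q : C2)
    (N : C2 -> Prop) (q' : C2) : Prop :=
  phi q = q' /\ locally q (fun a => M a <-> N (phi a)).

(** * Hypersurfaces *)

Definition nonzero_differential (rho : C2 -> R) (q : C2) : Prop :=
  exists (e : C2) (l : R),
    is_derive (fun t : R => rho (plus q (scal t e))) 0 l /\ l <> 0.

Definition real_analytic_hypersurface (M : C2 -> Prop) : Prop :=
  forall q, M q ->
    exists (U : C2 -> Prop) (rho : C2 -> R),
      open U /\ U q /\
      (forall a, U a -> real_analytic_at rho a) /\
      (forall a, U a -> M a -> nonzero_differential rho a) /\
      (forall a, U a -> (M a <-> rho a = 0)).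

(* T_q M is the set of velocities of C^1 curves of M through q. *)
Definition tangent (M : C2 -> Prop) (q v : C2) : Prop :=
  exists g g1 : R -> C2,
    locally 0 (fun t : R => M (g t) /\ is_derive g t (g1 t) /\ continuous g1 t) /\
    g 0 = q /\ g1 0 = v.

Definition complex_tangent (M : C2 -> Prop) (q v : C2) : Prop :=
  tangent M q v /\ exists w : C2, tangent M q w /\ v = J w.

(** * Levi nondegeneracy *)

(* Class C^k on U, through iterated directional derivatives. *)
Fixpoint class_C (k : nat) (U : C2 -> Prop) (X : C2 -> C2) : Prop :=
  match k with
  | O => forall q, U q -> continuous X q
  | S k' => forall e : C2, exists DX : C2 -> C2,
      (forall q, U q -> is_derive (fun t : R => X (plus q (scal t e))) 0 (DX q)) /\
      class_C k' U DX
  end.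

(* Sections of T^c M over M near q are represented by smooth vector fields of
   an open set of C^2 which take values in T^c M along M. *)
Definition complex_tangent_field (M U : C2 -> Prop) (X : C2 -> C2) : Prop :=
  (forall k, class_C k U X) /\
  (forall a, U a -> M a -> complex_tangent M a (X a)).

(* l = [X,Y](q) = D_{X(q)} Y (q) - D_{Y(q)} X (q).  For fields tangent to M this
   only depends on the restrictions of X and Y to M. *)
Definition lie_bracket_at (X Y : C2 -> C2) (q l : C2) : Prop :=
  exists a b : C2,
    is_derive (fun t : R => Y (plus q (scal t (X q)))) 0 a /\
    is_derive (fun t : R => X (plus q (scal t (Y q)))) 0 b /\
    l = minus a b.

Definition complex_tangent_bracket (M : C2 -> Prop) (q l : C2) : Prop :=
  exists (U : C2 -> Prop) (X Y : C2 -> C2),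
    open U /\ U q /\ complex_tangent_field M U X /\ complex_tangent_field M U Y /\
    lie_bracket_at X Y q l.

Inductive real_span (S : C2 -> Prop) : C2 -> Prop :=
| real_span_zero : real_span S zero
| real_span_add : forall (r : R) (a b : C2),
    S a -> real_span S b -> real_span S (plus (scal r a) b).

Definition levi_nondegenerate (M : C2 -> Prop) : Prop :=
  forall q, M q -> forall v : C2,
    real_span (fun a => complex_tangent M q a \/ complex_tangent_bracket M q a) v
    <-> tangent M q v.

(** * 2-jets of unparametrized curves *)

(* g is of class C^2 near 0, with g(0) = a, g'(0) = v1, g''(0) = v2. *)
Definition has_jet2 {V : NormedModule R_AbsRing} (g : R -> V) (a v1 v2 : V) : Prop :=
  exists g1 g2 : R -> V,
    locally 0 (fun t : R =>
      is_derive g t (g1 t) /\ is_derive g1 t (g2 t) /\ continuous g2 t) /\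
    g 0 = a /\ g1 0 = v1 /\ g2 0 = v2.

(* The unparametrized curves g and d have the same 2-jet at g 0 = d 0: they
   have the same derivatives up to order 2 after a change of parameter h. *)
Definition same_jet2 (g d : R -> C2) : Prop :=
  exists (h : R -> R) (h1 h2 : R) (a v1 v2 : C2),
    has_jet2 (V := R_NormedModule) h 0 h1 h2 /\ h1 <> 0 /\
    has_jet2 (fun t => g (h t)) a v1 v2 /\ has_jet2 d a v1 v2.

Definition transversal_curve (M : C2 -> Prop) (q : C2) (g : R -> C2) : Prop :=
  locally 0 (fun t : R => M (g t)) /\
  exists v1 v2 : C2, has_jet2 g q v1 v2 /\ ~ complex_tangent M q v1.

(* An unparametrized 2-jet is an equivalence class of parametrized curves;
   [J2 M q] is the set J^2_{M,q} of these classes. *)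
Definition jet := (R -> C2) -> Prop.

Definition J2 (M : C2 -> Prop) (q : C2) (j : jet) : Prop :=
  exists g, transversal_curve M q g /\
    forall d, j d <-> transversal_curve M q d /\ same_jet2 g d.

(* The induced map phi^(2) : J^2_{M,q} -> J^2_{N,q'}, j |-> the class of
   phi o g for g in j. *)
Definition push_jet (phi : C2 -> C2) (N : C2 -> Prop) (q' : C2) (j : jet) : jet :=
  fun d => transversal_curve N q' d /\
    exists g, j g /\ same_jet2 (fun t => phi (g t)) d.

(** * Normalizing maps and the surface Sigma_p *)

(* Near 0, N is the hypersurface v = z zbar + O(6), where O(6) is a convergent
   power series in (z, zbar, u) in monomials of weight at least 6. *)
Definition normal_form (N : C2 -> Prop) : Prop :=
  exists (c : list nat -> C) (E : C -> R -> R),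
    (forall j k l : nat, (j + k + 2 * l < 6)%nat -> c [j; k; l] = RtoC 0) /\
    locally (zero : C2) (fun q : C2 =>
      let z : C := fst q in
      let u : R := Re (snd q) in
      let v : R := Im (snd q) in
      is_mpseries (K := C_AbsRing) c [z; Cconj z; RtoC u] (RtoC (E z u)) /\
      (N q <-> RtoC v = (z * Cconj z + RtoC (E z u))%C)).

Definition translation (p q : C2) : C2 := minus q p.

Definition image (f : C2 -> C2) (M : C2 -> Prop) : C2 -> Prop :=
  fun q => exists a, M a /\ q = f a.

(* phi is a normalizing map of M at p, with target N. *)
Definition normalizing_map (M : C2 -> Prop) (p : C2) (phi : C2 -> C2)
    (N : C2 -> Prop) : Prop :=
  exists Phi : C2 -> C2,
    local_biholomorphism Phi zero /\
    sends Phi (image (translation p) M) zero N zero /\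
    normal_form N /\
    forall q, phi q = Phi (translation p q).

(* The coordinates (x1,y1,x2,y2) on J^2_{N,0}: the 2-jet at u = 0 of the
   functions u |-> (x(u), y(u)) of which the curve is the graph. *)
Definition jet_coords (j : jet) (x1 y1 x2 y2 : R) : Prop :=
  exists (g : R -> C2) (v1 v2 : C2),
    j g /\ locally 0 (fun t : R => Re (snd (g t)) = t) /\
    has_jet2 g zero v1 v2 /\
    fst v1 = (x1, y1) /\ fst v2 = (x2, y2).

Definition Sigma0 (N : C2 -> Prop) (j : jet) : Prop :=
  J2 N zero j /\
  exists x1 y1 x2 y2 : R,
    jet_coords j x1 y1 x2 y2 /\
    x2 = - 2 * x1 ^ 2 * y1 - 2 * y1 ^ 3 /\
    y2 = 2 * x1 * y1 ^ 2 + 2 * x1 ^ 3.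

(* The preimage in J^2_{M,p} of Sigma_0 under phi^(2). *)
Definition Sigma (M : C2 -> Prop) (p : C2) (phi : C2 -> C2) (N : C2 -> Prop)
    (j : jet) : Prop :=
  J2 M p j /\ Sigma0 N (push_jet phi N zero j).

(* Main.v *)
Require Import Defs.
From Stdlib Require Import Lra Lia ClassicalEpsilon Ranalysis5.

(** The equations of the model surface say that velocity and acceleration of a curve are
    complex collinear. Indeed a curve of [v = z zbar + O(6)] with velocity [(z1, 1)] at the origin
    has acceleration [(z2, 2 i |z1|^2)], and the two equations are the real and imaginary parts of
    [z2 = 2 i z1 |z1|^2] ([Sigma0_iff_Cdet]). They describe the 2-jets of the intersections of the
    quadric [v = z zbar] with complex lines.

    The complex determinant of velocity and acceleration is multiplied by a nonzero factor under a
    change of parameter. Under a holomorphic map [H] fixing the origin it becomes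
    [det H' * det (g', g'') + det (H' g', H'' (g', g'))]. The theorem therefore reduces to a property
    of the transition [H] between two normalizing maps: [H'' (X, X)] and [H' X] are collinear for every
    vector [X], in other words [H] agrees to second order with a projective map
    ([normal_form_map_2jet]).

    To see this, write [H = (f, g)] and follow the points [(e z, e^2 (t + i |z|^2) + O(e^6))] of the
    source as [e] tends to 0. Source and target agree with the quadric up to weight 6, so that
    [Im g - |f|^2 = O(e^6)], and the coefficients of [e], ..., [e^5] give polynomial identities in
    [z], [zbar] and [t]. Comparing coefficients ([weight1_coefs] to [weight5_coefs]) gives enough
    relations between the Taylor coefficients of [f] and [g] to conclude ([projective_2jet]).

    The transition is a composition of a normalizing map with the inverse of another one. Its Taylor
    expansion is obtained by showing that the functions with an expansion modulo degree 6 form an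
    algebra, in which a Taylor polynomial of the outer map can be evaluated ([taylor6_comp]). That
    holomorphic maps act on 2-jets of curves rests on termwise differentiation of power series
    ([holomorphic_derivatives], [jet_holomorphic]). *)

(** * The spaces C and C^2 *)

Lemma locally_C2 (q : C2) (P : C2 -> Prop) :
  locally q P <->
  exists d, 0 < d /\ forall a : C2,
    Cmod (fst a - fst q)%C < d -> Cmod (snd a - snd q)%C < d -> P a.
Proof.
split.
- intros [e He]. exists e. split; [apply cond_pos|].
  intros a H1 H2. apply He. split.
  + apply C_NormedModule_mixin_compat1. exact H1.
  + apply C_NormedModule_mixin_compat1. exact H2.
- intros [d [Hd H]].
  assert (Hs : 0 < d / 2) by lra.
  exists (mkposreal _ Hs). intros a [H1 H2].
  assert (S2 : sqrt 2 * (d / 2) < d).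
  { assert (sqrt 2 < 2).
    { rewrite <- (sqrt_Rsqr 2) at 2 by lra. apply sqrt_lt_1; unfold Rsqr; lra. }
    nra. }
  apply H.
  + apply Rlt_trans with (2 := S2).
    exact (C_NormedModule_mixin_compat2 (fst q) (fst a) (mkposreal _ Hs) H1).
  + apply Rlt_trans with (2 := S2).
    exact (C_NormedModule_mixin_compat2 (snd q) (snd a) (mkposreal _ Hs) H2).
Qed.

Lemma is_derive_pair {U V : NormedModule R_AbsRing} (f : R -> U) (g : R -> V) t l m :
  is_derive (V := prod_NormedModule R_AbsRing U V) (fun t => (f t, g t)) t (l, m) <->
  is_derive f t l /\ is_derive g t m.
Proof.
split.
- intros H; split.
  + apply (filterdiff_comp' (fun t => (f t, g t)) (fst : prod_NormedModule R_AbsRing U V -> U) t _ fst H).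
    apply filterdiff_linear, is_linear_fst.
  + apply (filterdiff_comp' (fun t => (f t, g t)) (snd : prod_NormedModule R_AbsRing U V -> V) t _ snd H).
    apply filterdiff_linear, is_linear_snd.
- intros [Hf Hg].
  apply (filterdiff_comp'_2 (W := prod_NormedModule R_AbsRing U V) f g (fun a b => (a, b)) t _ _ (fun a b => (a, b)) Hf Hg).
  apply filterdiff_ext_lin with (l1 := fun y : prod_NormedModule R_AbsRing U V => y).
  2: intros [y1 y2]; reflexivity.
  apply filterdiff_ext with (f := fun y : prod_NormedModule R_AbsRing U V => y).
  2: apply filterdiff_id.
  intros [y1 y2]; reflexivity.
Qed.

Lemma is_derive_C (u : R -> C) t (l : C) :
  is_derive (V := C_R_NormedModule) u t l <->
  is_derive (fun s => Re (u s)) t (Re l) /\ is_derive (fun s => Im (u s)) t (Im l).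
Proof.
rewrite <- (is_derive_pair (U := R_NormedModule) (V := R_NormedModule)).
destruct l as [l m]. simpl.
split; apply is_derive_ext; intros s; destruct (u s); reflexivity.
Qed.

Lemma is_derive_C2 (u : R -> C2) t (l : C2) :
  is_derive u t l <->
  is_derive (V := C_R_NormedModule) (fun s => fst (u s)) t (fst l) /\
  is_derive (V := C_R_NormedModule) (fun s => snd (u s)) t (snd l).
Proof.
rewrite <- (is_derive_pair (U := C_R_NormedModule) (V := C_R_NormedModule)).
destruct l as [l m]. simpl.
split; apply is_derive_ext; intros s; destruct (u s); reflexivity.
Qed.

Lemma is_derive_Cmult (u v : R -> C) t (u1 v1 : C) :
  is_derive (V := C_R_NormedModule) u t u1 ->
  is_derive (V := C_R_NormedModule) v t v1 ->
  is_derive (V := C_R_NormedModule) (fun s => (u s * v s)%C) t (u1 * v t + u t * v1)%C.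
Proof.
rewrite !is_derive_C. intros [Hu1 Hu2] [Hv1 Hv2]. split; simpl.
- evar_last.
  apply (is_derive_minus (V := R_NormedModule)).
  apply (is_derive_mult (K := R_AbsRing)); [exact Hu1|exact Hv1|exact Rmult_comm].
  apply (is_derive_mult (K := R_AbsRing)); [exact Hu2|exact Hv2|exact Rmult_comm].
  unfold minus, plus, opp, mult, Re, Im; simpl. ring.
- evar_last.
  apply (is_derive_plus (V := R_NormedModule)).
  apply (is_derive_mult (K := R_AbsRing)); [exact Hu1|exact Hv2|exact Rmult_comm].
  apply (is_derive_mult (K := R_AbsRing)); [exact Hu2|exact Hv1|exact Rmult_comm].
  unfold minus, plus, opp, mult, Re, Im; simpl. ring.
Qed.

(** * Absolutely convergent double series *)

Definition csum (u : nat -> C) (n : nat) : C := sum_n (G := C_AbsRing) u n.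

Definition dsum (m n : nat) (u : nat -> nat -> C) : C :=
  csum (fun j => csum (u j) n) m.
Definition rdsum (m n : nat) (v : nat -> nat -> R) : R :=
  sum_n (fun j => sum_n (v j) n) m.

Lemma csum_0 u : csum u 0 = u 0%nat.
Proof. exact (sum_O (G := C_AbsRing) u). Qed.

Lemma csum_S u n : csum u (S n) = (csum u n + u (S n))%C.
Proof. exact (sum_Sn (G := C_AbsRing) u n). Qed.

Lemma rsum_S (u : nat -> R) n : sum_n u (S n) = sum_n u n + u (S n) :> R.
Proof. exact (sum_Sn (G := R_AbelianMonoid) u n). Qed.

Lemma csum_ext u v n : (forall k, (k <= n)%nat -> u k = v k) -> csum u n = csum v n.
Proof. exact (sum_n_ext_loc (G := C_AbsRing) u v n). Qed.

Lemma csum_plus u v n : csum (fun k => u k + v k)%C n = (csum u n + csum v n)%C.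
Proof. exact (sum_n_plus (G := C_AbsRing) u v n). Qed.

Lemma csum_scal a u n : csum (fun k => a * u k)%C n = (a * csum u n)%C.
Proof. exact (sum_n_mult_l (K := C_AbsRing) a u n). Qed.

Lemma csum_shift u n : csum u (S n) = (u 0%nat + csum (fun k => u (S k)) n)%C.
Proof.
induction n as [|n IH].
- rewrite csum_S, !csum_0. reflexivity.
- rewrite csum_S, IH, (csum_S (fun k => u (S k))). ring.
Qed.

Lemma csum_support (u : nat -> C) n m :
  (m <= n)%nat -> (forall k, (m < k)%nat -> u k = 0%C) -> csum u n = csum u m.
Proof.
intros Hmn H. induction Hmn as [|n Hmn IH]; [reflexivity|].
rewrite csum_S, IH, H by lia. ring.
Qed.

Lemma csum_le u v n :
  (forall k, (k <= n)%nat -> Cmod (u k) <= v k) -> Cmod (csum u n) <= sum_n v n.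
Proof.
induction n as [|n IH]; intros H.
- rewrite csum_0, sum_O. apply H. lia.
- rewrite csum_S, rsum_S. eapply Rle_trans; [apply Cmod_triangle|].
  apply Rplus_le_compat; [apply IH; intros; apply H; lia | apply H; lia].
Qed.

Lemma rsum_le (u v : nat -> R) n :
  (forall k, (k <= n)%nat -> u k <= v k) -> sum_n u n <= sum_n v n.
Proof.
induction n as [|n IH]; intros H.
- rewrite !sum_O. apply H. lia.
- rewrite !rsum_S. apply Rplus_le_compat; [apply IH; intros; apply H; lia | apply H; lia].
Qed.

Lemma rsum_nonneg (v : nat -> R) n : (forall k, 0 <= v k) -> 0 <= sum_n v n.
Proof.
intros H; induction n as [|n IH]; [rewrite sum_O; apply H|].
rewrite rsum_S. specialize (H (S n)). lra.
Qed.

Lemma rsum_scal a (u : nat -> R) n : sum_n (fun k => a * u k) n = a * sum_n u n :> R.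
Proof. exact (sum_n_mult_l (K := R_AbsRing) a u n). Qed.

Lemma rsum_shift (u : nat -> R) n : sum_n u (S n) = u 0%nat + sum_n (fun k => u (S k)) n :> R.
Proof.
induction n as [|n IH].
- rewrite rsum_S, !sum_O. reflexivity.
- rewrite rsum_S, IH, (rsum_S (fun k => u (S k))). ring.
Qed.

Lemma dsum_Sl m n u : dsum (S m) n u = (dsum m n u + csum (u (S m)) n)%C.
Proof. unfold dsum. rewrite csum_S. reflexivity. Qed.

Lemma dsum_Sr m n u : dsum m (S n) u = (dsum m n u + csum (fun j => u j (S n)) m)%C.
Proof.
unfold dsum. rewrite <- csum_plus. apply csum_ext. intros; apply csum_S.
Qed.

Lemma rdsum_Sl m n v : rdsum (S m) n v = rdsum m n v + sum_n (v (S m)) n.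
Proof. unfold rdsum. rewrite rsum_S. reflexivity. Qed.

Lemma rdsum_Sr m n v : rdsum m (S n) v = rdsum m n v + sum_n (fun j => v j (S n)) m.
Proof.
unfold rdsum. rewrite <- (sum_n_plus (G := R_AbelianMonoid)).
apply sum_n_ext. intros; apply rsum_S.
Qed.

Lemma dsum_ext m n u v :
  (forall j k, u j k = v j k) -> dsum m n u = dsum m n v.
Proof. intros H; apply csum_ext; intros; apply csum_ext; intros; apply H. Qed.

Lemma dsum_plus m n u v :
  dsum m n (fun j k => u j k + v j k)%C = (dsum m n u + dsum m n v)%C.
Proof.
unfold dsum. rewrite <- csum_plus. apply csum_ext; intros; apply csum_plus.
Qed.

Lemma dsum_scal m n a u : dsum m n (fun j k => a * u j k)%C = (a * dsum m n u)%C.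
Proof.
unfold dsum. rewrite <- csum_scal. apply csum_ext; intros; apply csum_scal.
Qed.

Lemma dsum_le m n u v :
  (forall j k, Cmod (u j k) <= v j k) -> Cmod (dsum m n u) <= rdsum m n v.
Proof. intros H. apply csum_le; intros; apply csum_le; intros; apply H. Qed.

Lemma rdsum_le m n u v :
  (forall j k, u j k <= v j k) -> rdsum m n u <= rdsum m n v.
Proof. intros H. apply rsum_le; intros; apply rsum_le; intros; apply H. Qed.

Lemma rdsum_scal m n a u : rdsum m n (fun j k => a * u j k) = a * rdsum m n u.
Proof.
unfold rdsum. rewrite <- rsum_scal. apply sum_n_ext; intros; apply rsum_scal.
Qed.

(** A larger rectangle is reached by adding one row or column at a time, each of
    which is dominated by that of the majorant. *)
Lemma dsum_increment u v m n m' n' :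
  (forall j k, Cmod (u j k) <= v j k) -> (m <= m')%nat -> (n <= n')%nat ->
  Cmod (dsum m' n' u - dsum m n u) <= rdsum m' n' v - rdsum m n v.
Proof.
intros H Hm Hn.
assert (Hl : Cmod (dsum m' n u - dsum m n u) <= rdsum m' n v - rdsum m n v).
{ clear n' Hn. induction Hm as [|m' Hm IH].
  - replace (_ - _)%C with (RtoC 0) by ring. rewrite Cmod_0. lra.
  - rewrite dsum_Sl, rdsum_Sl.
    replace (_ + _ - _)%C with ((dsum m' n u - dsum m n u) + csum (u (S m')) n)%C by ring.
    eapply Rle_trans; [apply Cmod_triangle|].
    assert (Cmod (csum (u (S m')) n) <= sum_n (v (S m')) n) by (apply csum_le; intros; apply H).
    lra. }
induction Hn as [|n' Hn IH]; [exact Hl|].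
rewrite dsum_Sr, rdsum_Sr.
replace (_ + _ - _)%C with ((dsum m' n' u - dsum m n u) + csum (fun j => u j (S n')) m')%C by ring.
eapply Rle_trans; [apply Cmod_triangle|].
assert (Cmod (csum (fun j => u j (S n')) m') <= sum_n (fun j => v j (S n')) m')
  by (apply csum_le; intros; apply H).
lra.
Qed.

Lemma rdsum_mono v m n m' n' :
  (forall j k, 0 <= v j k) -> (m <= m')%nat -> (n <= n')%nat ->
  rdsum m n v <= rdsum m' n' v.
Proof.
intros H Hm Hn.
assert (H0 : forall j k : nat, Cmod 0%C <= v j k) by (intros; rewrite Cmod_0; apply H).
pose proof (dsum_increment (fun _ _ => RtoC 0) v m n m' n' H0 Hm Hn) as Hi.
pose proof (Cmod_ge_0 (dsum m' n' (fun _ _ => RtoC 0) - dsum m n (fun _ _ => RtoC 0))). lra.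
Qed.

(** Both sides of the rectangle tend to infinity independently, because termwise
    differentiation turns a square of exponents into a rectangle. *)
Definition dconv (u : nat -> nat -> C) (l : C) : Prop :=
  forall e, 0 < e -> exists N, forall m n, (N <= m)%nat -> (N <= n)%nat ->
    Cmod (dsum m n u - l) < e.

Lemma lt_div_succ K x d : 0 <= K -> x < d / (K + 1) -> x * (K + 1) < d.
Proof.
intros HK Hx. apply Rlt_le_trans with (d / (K + 1) * (K + 1)).
- apply Rmult_lt_compat_r; lra.
- right; field; lra.
Qed.

Lemma Cmod_sub_sym a b : Cmod (a - b)%C = Cmod (b - a)%C.
Proof. rewrite <- Cmod_opp. f_equal. ring. Qed.

Lemma Cmod_eq0_lim x : (forall e, 0 < e -> Cmod x < e) -> x = 0%C.
Proof.
intros H. apply Cmod_eq_0. destruct (Req_dec (Cmod x) 0) as [E|E]; [exact E|].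
pose proof (Cmod_ge_0 x). specialize (H (Cmod x)). lra.
Qed.

Lemma Csub_eq0 a b : (a - b)%C = 0%C -> a = b.
Proof. intros H. replace a with ((a - b) + b)%C by ring. rewrite H. ring. Qed.

(** The real partial sums of the majorant converge, hence are Cauchy, and dominate
    the increments of the complex ones. *)
Lemma dconv_ex u v B :
  (forall j k, Cmod (u j k) <= v j k) -> (forall n, rdsum n n v <= B) ->
  exists l, dconv u l.
Proof.
intros H HB.
assert (Hv : forall j k, 0 <= v j k).
{ intros j k. eapply Rle_trans; [apply Cmod_ge_0|apply H]. }
assert (Hg : Un_growing (fun n => rdsum n n v)).
{ intros n. rewrite rdsum_Sl, rdsum_Sr.
  pose proof (rsum_nonneg (fun j => v j (S n)) n (fun j => Hv j (S n))).
  pose proof (rsum_nonneg (v (S n)) (S n) (Hv (S n))). lra. }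
assert (Hb : has_ub (fun n => rdsum n n v)).
{ exists B. intros x [n ->]. apply HB. }
destruct (growing_cv _ Hg Hb) as [S HS].
assert (Hle : forall n, rdsum n n v <= S) by (intros n; apply growing_ineq with (1 := Hg) (2 := HS)).
assert (Hdiff : forall e, 0 < e -> exists N, forall m n, (N <= m)%nat -> (N <= n)%nat ->
  Cmod (dsum m n u - dsum N N u) < e).
{ intros e He. destruct (HS e He) as [N HN]. exists N. intros m n Hm Hn.
  eapply Rle_lt_trans; [apply dsum_increment with (v := v); assumption|].
  specialize (HN N (Nat.le_refl _)). unfold Rdist in HN. apply Rabs_def2 in HN.
  assert (rdsum m n v <= rdsum (m + n) (m + n) v).
  { apply rdsum_mono; [exact Hv|lia|lia]. }
  specialize (Hle (m + n)%nat). lra. }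
assert (HC : forall (p : C -> R), (forall c, Rabs (p c) <= Cmod c) ->
   (forall a b : C, p (a - b)%C = p a - p b) ->
   Cauchy_crit (fun n => p (dsum n n u))).
{ intros p Hp Hp' e He. destruct (Hdiff (e / 2)) as [N HN]; [lra|].
  exists N. intros m n Hm Hn. unfold Rdist. rewrite <- Hp'.
  eapply Rle_lt_trans; [apply Hp|].
  replace (dsum m m u - dsum n n u)%C with
    ((dsum m m u - dsum N N u) + (dsum N N u - dsum n n u))%C by ring.
  eapply Rle_lt_trans; [apply Cmod_triangle|].
  rewrite (Cmod_sub_sym (dsum N N u)).
  pose proof (HN m m Hm Hm). pose proof (HN n n Hn Hn). lra. }
assert (HImle : forall c, Rabs (Im c) <= Cmod c).
{ intros c. eapply Rle_trans; [|apply Rmax_Cmod]. apply Rmax_r. }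
destruct (Rcomplete.R_complete _ (HC Re re_le_Cmod (fun a b => eq_refl))) as [lr Hr].
destruct (Rcomplete.R_complete _ (HC Im HImle (fun a b => eq_refl))) as [li Hi].
exists (lr, li). intros e He.
destruct (Hdiff (e / 4)) as [N HN]; [lra|].
destruct (Hr (e / 4)) as [N1 HN1]; [lra|].
destruct (Hi (e / 4)) as [N2 HN2]; [lra|].
exists N. intros m n Hm Hn.
set (p := (N + N1 + N2)%nat).
specialize (HN1 p ltac:(unfold p; lia)). specialize (HN2 p ltac:(unfold p; lia)).
pose proof (HN p p ltac:(unfold p; lia) ltac:(unfold p; lia)) as Hp.
specialize (HN m n Hm Hn).
replace (dsum m n u - (lr, li))%C with
  ((dsum m n u - dsum N N u) + ((dsum N N u - dsum p p u) + (dsum p p u - (lr, li))))%C by ring.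
eapply Rle_lt_trans; [apply Cmod_triangle|].
eapply Rle_lt_trans; [apply Rplus_le_compat_l, Cmod_triangle|].
rewrite (Cmod_sub_sym (dsum N N u)).
unfold Rdist in *.
assert (Cmod (dsum p p u - (lr, li))%C <= Rabs (Re (dsum p p u) - lr) + Rabs (Im (dsum p p u) - li)).
{ set (a := dsum p p u). clearbody a. destruct a as [a b]. simpl.
  replace ((a, b) - (lr, li))%C with (RtoC (a - lr) + Ci * RtoC (b - li))%C.
  2:{ unfold RtoC, Ci, Cminus, Cplus, Copp, Cmult; simpl. f_equal; ring. }
  eapply Rle_trans; [apply Cmod_triangle|].
  rewrite Cmod_mult, Cmod_Ci, !Cmod_R. lra. }
lra.
Qed.

(** Meaningful when the double series converges, in particular when it has a
    summable majorant. *)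
Definition dtotal (u : nat -> nat -> C) : C := epsilon (inhabits (RtoC 0)) (dconv u).

Lemma dtotal_spec u v B :
  (forall j k, Cmod (u j k) <= v j k) -> (forall n, rdsum n n v <= B) ->
  dconv u (dtotal u).
Proof. intros H HB. unfold dtotal. apply epsilon_spec, (dconv_ex u v B H HB). Qed.

(** * Termwise differentiation of double power series *)

Definition term (a : nat -> nat -> C) (x y : C) (j k : nat) : C :=
  (a j k * (x ^ j * y ^ k))%C.
Definition majorant (a : nat -> nat -> C) (r : R) (j k : nat) : R :=
  Cmod (a j k) * (r ^ j * r ^ k).

Definition pderiv1 (a : nat -> nat -> C) (j k : nat) : C := (INR (S j) * a (S j) k)%C.
Definition pderiv2 (a : nat -> nat -> C) (j k : nat) : C := (INR (S k) * a j (S k))%C.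

Lemma term_le a x y r j k :
  Cmod x <= r -> Cmod y <= r -> Cmod (term a x y j k) <= majorant a r j k.
Proof.
intros Hx Hy. unfold term, majorant. rewrite !Cmod_mult, !Cmod_pow.
apply Rmult_le_compat_l; [apply Cmod_ge_0|].
pose proof (Cmod_ge_0 x). pose proof (Cmod_ge_0 y).
apply Rmult_le_compat; try (apply pow_le; assumption); apply pow_incr; lra.
Qed.

Lemma majorant_nonneg a r j k : 0 <= r -> 0 <= majorant a r j k.
Proof.
intros H. unfold majorant. apply Rmult_le_pos; [apply Cmod_ge_0|].
apply Rmult_le_pos; apply pow_le; exact H.
Qed.

Lemma INR_S_le_pow2 j : INR (S j) <= 2 ^ j.
Proof.
induction j as [|j IH]; [simpl; lra|].
rewrite S_INR. simpl (2 ^ S j). assert (1 <= 2 ^ j) by (apply pow_R1_Rle; lra). lra.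
Qed.

Lemma Cmod_INR n : Cmod (INR n) = INR n.
Proof. rewrite Cmod_R. apply Rabs_pos_eq, pos_INR. Qed.

(** Halving the radius makes up for the factor [j + 1], as [(j + 1) / 2^j <= 1]. *)
Lemma pderiv1_majorant a r j k :
  0 < r -> majorant (pderiv1 a) (r / 2) j k <= / r * majorant a r (S j) k.
Proof.
intros Hr. unfold majorant, pderiv1. rewrite Cmod_mult, Cmod_INR.
replace (/ r * (Cmod (a (S j) k) * (r ^ S j * r ^ k))) with
  (Cmod (a (S j) k) * (2 ^ j * 2 ^ k * ((r / 2) ^ j * (r / 2) ^ k))).
2:{ replace (2 ^ j * 2 ^ k * ((r / 2) ^ j * (r / 2) ^ k)) with
     (((2 ^ j * (r / 2) ^ j)) * (2 ^ k * (r / 2) ^ k)) by ring.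
    rewrite <- !Rpow_mult_distr. replace (2 * (r / 2)) with r by field.
    simpl. field. lra. }
assert (0 <= (r / 2) ^ j * (r / 2) ^ k) by (apply Rmult_le_pos; apply pow_le; lra).
pose proof (Cmod_ge_0 (a (S j) k)).
rewrite (Rmult_comm (INR _)), Rmult_assoc.
apply Rmult_le_compat_l; [assumption|].
apply Rmult_le_compat_r; [assumption|].
pose proof (INR_S_le_pow2 j). assert (1 <= 2 ^ k) by (apply pow_R1_Rle; lra).
pose proof (pos_INR (S j)). nra.
Qed.

Lemma pderiv2_majorant a r j k :
  0 < r -> majorant (pderiv2 a) (r / 2) j k <= / r * majorant a r j (S k).
Proof.
intros Hr. pose proof (pderiv1_majorant (fun k j => a j k) r k j Hr) as H.
unfold majorant, pderiv1, pderiv2 in *.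
rewrite (Rmult_comm (_ ^ j)), (Rmult_comm (r ^ j)). exact H.
Qed.

Lemma pderiv1_summable a r B :
  0 < r -> (forall n, rdsum n n (majorant a r) <= B) ->
  forall n, rdsum n n (majorant (pderiv1 a) (r / 2)) <= / r * B.
Proof.
intros Hr HB n.
eapply Rle_trans; [apply rdsum_le; intros; apply pderiv1_majorant, Hr|].
rewrite rdsum_scal. apply Rmult_le_compat_l; [left; apply Rinv_0_lt_compat, Hr|].
eapply Rle_trans; [|apply (HB (S n))].
assert (Hp : forall j k, 0 <= majorant a r j k) by (intros; apply majorant_nonneg; lra).
eapply Rle_trans with (rdsum (S n) n (majorant a r)).
- unfold rdsum. rewrite (rsum_shift (fun j => sum_n (majorant a r j) n)).
  pose proof (rsum_nonneg (majorant a r 0) n (Hp 0%nat)).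
  change (sum_n (fun j => sum_n (fun k => majorant a r (S j) k) n) n) with (sum_n (fun k => sum_n (majorant a r (S k)) n) n). lra.
- apply rdsum_mono; [exact Hp|lia|lia].
Qed.

Lemma pderiv2_summable a r B :
  0 < r -> (forall n, rdsum n n (majorant a r) <= B) ->
  forall n, rdsum n n (majorant (pderiv2 a) (r / 2)) <= / r * B.
Proof.
intros Hr HB n.
eapply Rle_trans; [apply rdsum_le; intros; apply pderiv2_majorant, Hr|].
rewrite rdsum_scal. apply Rmult_le_compat_l; [left; apply Rinv_0_lt_compat, Hr|].
eapply Rle_trans; [|apply (HB (S n))].
assert (Hp : forall j k, 0 <= majorant a r j k) by (intros; apply majorant_nonneg; lra).
eapply Rle_trans with (rdsum n (S n) (majorant a r)).
- unfold rdsum. apply rsum_le. intros j _. rewrite (rsum_shift (majorant a r j)).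
  pose proof (Hp j 0%nat). lra.
- apply rdsum_mono; [exact Hp|lia|lia].
Qed.

(** The derivative of [x^i] in [x], written by cases so that the exponent 0 needs no
    convention. *)
Definition dpow (x : C) (i : nat) : C :=
  match i with O => 0%C | S j => (INR i * x ^ j)%C end.

Lemma dpow_S x i : dpow x (S i) = (x ^ i + x * dpow x i)%C.
Proof.
destruct i as [|i].
- simpl. unfold RtoC, Cplus, Cmult; simpl; f_equal; ring.
- unfold dpow. rewrite (S_INR (S i)), RtoC_plus. simpl Cpow. ring.
Qed.

Lemma dpow_le x s i : 0 < s -> Cmod x <= s -> s * Cmod (dpow x i) <= INR i * s ^ i.
Proof.
intros Hs Hx. destruct i as [|i].
- simpl. rewrite Cmod_0. lra.
- unfold dpow. rewrite Cmod_mult, Cmod_INR, Cmod_pow.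
  pose proof (Cmod_ge_0 x).
  assert (Cmod x ^ i <= s ^ i) by (apply pow_incr; lra).
  pose proof (pos_INR (S i)). simpl (s ^ S i).
  assert (INR (S i) * Cmod x ^ i <= INR (S i) * s ^ i) by (apply Rmult_le_compat_l; assumption).
  nra.
Qed.

Lemma pow_le_s x s i : Cmod x <= s -> Cmod (x ^ i)%C <= s ^ i.
Proof. intros H. rewrite Cmod_pow. apply pow_incr. pose proof (Cmod_ge_0 x). lra. Qed.

Lemma pow_increment_le x h s i : 0 < s -> Cmod x <= s -> Cmod (x + h)%C <= s ->
  s * Cmod ((x + h) ^ i - x ^ i)%C <= INR i * s ^ i * Cmod h.
Proof.
intros Hs Hx Hh. induction i as [|i IH].
- simpl. replace (1 - 1)%C with (RtoC 0) by ring. rewrite Cmod_0. lra.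
- rewrite !Cpow_S.
  replace ((x + h) * (x + h) ^ i - x * x ^ i)%C with
    ((x + h) * ((x + h) ^ i - x ^ i) + h * x ^ i)%C by ring.
  pose proof (Cmod_triangle ((x + h) * ((x + h) ^ i - x ^ i)) (h * x ^ i))%C as T.
  rewrite !Cmod_mult in T.
  pose proof (pow_le_s x s i Hx). rewrite S_INR. simpl (s ^ S i).
  pose proof (Cmod_ge_0 h). pose proof (Cmod_ge_0 ((x + h) ^ i - x ^ i)%C).
  pose proof (Cmod_ge_0 (x + h)%C).
  set (D := Cmod ((x + h) ^ i - x ^ i)%C) in *.
  assert (Cmod (x + h)%C * D <= s * D) by (apply Rmult_le_compat_r; assumption).
  assert (Cmod h * Cmod (x ^ i)%C <= Cmod h * s ^ i) by (apply Rmult_le_compat_l; assumption).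
  eapply Rle_trans; [apply Rmult_le_compat_l; [lra|exact T]|].
  apply Rle_trans with (s * (INR i * s ^ i * Cmod h + Cmod h * s ^ i)).
  { apply Rmult_le_compat_l; lra. }
  right; ring.
Qed.

(** Induction on the exponent: multiplying by [x + h] creates the only new term
    [i x^(i-1) h^2]. *)
Lemma pow_taylor_le x h s i : 0 < s -> Cmod x <= s -> Cmod (x + h)%C <= s ->
  s ^ 2 * Cmod ((x + h) ^ i - x ^ i - h * dpow x i)%C <= INR i ^ 2 * s ^ i * Cmod h ^ 2.
Proof.
intros Hs Hx Hh. induction i as [|i IH].
- simpl. replace (1 - 1 - h * 0)%C with (RtoC 0) by ring. rewrite Cmod_0. lra.
- rewrite dpow_S, !Cpow_S.
  replace ((x + h) * (x + h) ^ i - x * x ^ i - h * (x ^ i + x * dpow x i))%C with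
    ((x + h) * ((x + h) ^ i - x ^ i - h * dpow x i) + h * h * dpow x i)%C by ring.
  pose proof (Cmod_triangle ((x + h) * ((x + h) ^ i - x ^ i - h * dpow x i)) (h * h * dpow x i))%C as T.
  rewrite !Cmod_mult in T.
  pose proof (dpow_le x s i Hs Hx) as Hd. rewrite S_INR. simpl (s ^ S i).
  pose proof (Cmod_ge_0 h).
  pose proof (Cmod_ge_0 (x + h)%C).
  set (D := Cmod ((x + h) ^ i - x ^ i - h * dpow x i)%C) in *.
  assert (0 <= D) by apply Cmod_ge_0.
  assert (0 <= INR i ^ 2 * s ^ i * Cmod h ^ 2).
  { apply Rmult_le_pos; [apply Rmult_le_pos|]; try apply pow2_ge_0. apply pow_le; lra. }
  assert (s ^ 2 * (Cmod (x + h)%C * D) <= s * (INR i ^ 2 * s ^ i * Cmod h ^ 2)).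
  { apply Rle_trans with (s * (s ^ 2 * D)); [|apply Rmult_le_compat_l; lra].
    replace (s ^ 2 * (Cmod (x + h)%C * D)) with (Cmod (x + h)%C * (s ^ 2 * D)) by ring.
    apply Rmult_le_compat_r; [|exact Hh]. apply Rmult_le_pos; [apply pow2_ge_0|assumption]. }
  assert (0 <= Cmod h * Cmod h) by nra.
  assert (Cmod h * Cmod h * (s * Cmod (dpow x i)) <= Cmod h * Cmod h * (INR i * s ^ i))
    by (apply Rmult_le_compat_l; assumption).
  assert (0 <= s ^ i) by (apply pow_le; lra).
  pose proof (pos_INR i).
  assert (0 <= s * s ^ i * (Cmod h * Cmod h) * (INR i + 1)).
  { repeat apply Rmult_le_pos; lra. }
  apply Rle_trans with (s ^ 2 * (Cmod (x + h)%C * D + Cmod h * Cmod h * Cmod (dpow x i))).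
  { apply Rmult_le_compat_l; [apply pow2_ge_0|exact T]. }
  nra.
Qed.

Lemma INR_sqr_le_pow4 i : INR i ^ 2 <= 4 ^ i.
Proof.
replace 4 with (2 ^ 2) by ring. rewrite <- pow_mult, Nat.mul_comm, pow_mult.
apply pow_incr. split; [apply pos_INR|].
eapply Rle_trans; [|apply (INR_S_le_pow2 i)]. rewrite S_INR. lra.
Qed.

Lemma INR_le_pow4 i : INR i <= 4 ^ i.
Proof.
apply Rle_trans with (2 ^ i).
- eapply Rle_trans; [|apply (INR_S_le_pow2 i)]. rewrite S_INR. lra.
- apply pow_incr. lra.
Qed.

(** Product of the two one-variable expansions; the factors [i^2] and [l^2] are
    absorbed by enlarging the radius four times. *)
Lemma monomial_taylor_le x y h k s i l :
  0 < s -> Cmod x <= s -> Cmod y <= s -> Cmod (x + h)%C <= s -> Cmod (y + k)%C <= s ->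
  s ^ 2 * Cmod ((x + h) ^ i * (y + k) ^ l - x ^ i * y ^ l - h * (dpow x i * y ^ l)
                - k * (x ^ i * dpow y l))%C
  <= (4 * s) ^ i * (4 * s) ^ l * (Cmod h + Cmod k) ^ 2.
Proof.
intros Hs Hx Hy Hxh Hyk.
replace (_ - _)%C with
  (((x + h) ^ i - x ^ i - h * dpow x i) * (y + k) ^ l
   + (x ^ i * ((y + k) ^ l - y ^ l - k * dpow y l)
   + h * dpow x i * ((y + k) ^ l - y ^ l)))%C by ring.
pose proof (pow_taylor_le x h s i Hs Hx Hxh) as T1.
pose proof (pow_taylor_le y k s l Hs Hy Hyk) as T2.
pose proof (pow_increment_le y k s l Hs Hy Hyk) as T3.
pose proof (dpow_le x s i Hs Hx) as T4.
pose proof (pow_le_s (y + k) s l Hyk) as T5.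
pose proof (pow_le_s x s i Hx) as T6.
assert (P1 : 0 <= s ^ i) by (apply pow_le; lra).
assert (P2 : 0 <= s ^ l) by (apply pow_le; lra).
rewrite !Rpow_mult_distr.
assert (Q1 : 1 <= 4 ^ i) by (apply pow_R1_Rle; lra).
assert (Q2 : 1 <= 4 ^ l) by (apply pow_R1_Rle; lra).
pose proof (INR_sqr_le_pow4 i). pose proof (INR_sqr_le_pow4 l).
pose proof (INR_le_pow4 i). pose proof (INR_le_pow4 l).
pose proof (pos_INR i). pose proof (pos_INR l).
pose proof (Cmod_ge_0 h). pose proof (Cmod_ge_0 k).
eapply Rle_trans.
{ apply Rmult_le_compat_l; [apply pow2_ge_0|].
  eapply Rle_trans; [apply Cmod_triangle|]. apply Rplus_le_compat_l, Cmod_triangle. }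
rewrite !Cmod_mult.
set (A1 := Cmod (_ - _ - h * _)%C) in *. set (A2 := Cmod (_ - _ - k * _)%C) in *.
set (A3 := Cmod (_ ^ l - _)%C) in *. set (A4 := Cmod (dpow x i)) in *.
set (A5 := Cmod ((y + k) ^ l)%C) in *. set (A6 := Cmod (x ^ i)%C) in *.
assert (0 <= A1) by apply Cmod_ge_0. assert (0 <= A2) by apply Cmod_ge_0.
assert (0 <= A3) by apply Cmod_ge_0. assert (0 <= A4) by apply Cmod_ge_0.
assert (0 <= A5) by apply Cmod_ge_0. assert (0 <= A6) by apply Cmod_ge_0.
clearbody A1 A2 A3 A4 A5 A6.
set (U := 4 ^ i * s ^ i). set (V := 4 ^ l * s ^ l).
assert (0 <= U) by (apply Rmult_le_pos; lra).
assert (0 <= V) by (apply Rmult_le_pos; lra).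
assert (U1 : INR i ^ 2 * s ^ i <= U) by (apply Rmult_le_compat_r; assumption).
assert (V1 : INR l ^ 2 * s ^ l <= V) by (apply Rmult_le_compat_r; assumption).
assert (U2 : INR i * s ^ i <= U) by (apply Rmult_le_compat_r; assumption).
assert (V2 : INR l * s ^ l <= V) by (apply Rmult_le_compat_r; assumption).
assert (U3 : s ^ i <= U) by (unfold U; nra).
assert (V3 : s ^ l <= V) by (unfold V; nra).
assert (B1 : s ^ 2 * A1 * A5 <= (U * Cmod h ^ 2) * V).
{ apply Rmult_le_compat; try assumption; [|nra|lra].
  apply Rmult_le_pos; [apply pow2_ge_0|assumption]. }
assert (B2 : A6 * (s ^ 2 * A2) <= U * (V * Cmod k ^ 2)).
{ apply Rmult_le_compat; try assumption; [|lra|nra].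
  apply Rmult_le_pos; [apply pow2_ge_0|assumption]. }
assert (B3 : Cmod h * (s * A4) * (s * A3) <= Cmod h * U * (V * Cmod k)).
{ apply Rmult_le_compat; [| |apply Rmult_le_compat_l; lra|nra]; repeat apply Rmult_le_pos; lra. }
assert (0 <= U * V * (Cmod h * Cmod k)) by (repeat apply Rmult_le_pos; lra).
replace (s ^ 2 * (A1 * A5 + (A6 * A2 + Cmod h * A4 * A3))) with
  (s ^ 2 * A1 * A5 + A6 * (s ^ 2 * A2) + Cmod h * (s * A4) * (s * A3)) by ring.
replace (4 ^ i * s ^ i * (4 ^ l * s ^ l)) with (U * V) by (unfold U, V; ring).
nra.
Qed.

(** The partial sum of a derived series is the derivative of a partial sum over a
    rectangle longer by one in the variable of differentiation. *)
Lemma dsum_pderiv1 a x y m n :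
  dsum m n (term (pderiv1 a) x y) =
  dsum (S m) n (fun j k => a j k * (dpow x j * y ^ k))%C.
Proof.
unfold dsum. rewrite (csum_shift (fun j => csum _ n)).
replace (csum (fun k => a 0%nat k * (dpow x 0 * y ^ k))%C n) with (RtoC 0).
- rewrite Cplus_0_l. apply csum_ext; intros j _; apply csum_ext; intros k _.
  unfold term, pderiv1, dpow. ring.
- induction n as [|n IH]; [rewrite csum_0|rewrite csum_S, <- IH]; simpl; ring.
Qed.

Lemma dsum_pderiv2 a x y m n :
  dsum m n (term (pderiv2 a) x y) =
  dsum m (S n) (fun j k => a j k * (x ^ j * dpow y k))%C.
Proof.
unfold dsum. apply csum_ext; intros j _.
rewrite (csum_shift (fun k => (a j k * (x ^ j * dpow y k))%C)).
replace (a j 0%nat * (x ^ j * dpow y 0))%C with (RtoC 0) by (simpl; ring).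
rewrite Cplus_0_l. apply csum_ext; intros k _.
unfold term, pderiv2, dpow. ring.
Qed.

Lemma dsum_taylor_le a x y h k r B m n :
  0 < r -> (forall n, rdsum n n (majorant a r) <= B) ->
  Cmod x <= r / 4 -> Cmod y <= r / 4 -> Cmod (x + h)%C <= r / 4 -> Cmod (y + k)%C <= r / 4 ->
  Cmod (dsum (S m) (S n) (term a (x + h) (y + k)) - dsum (S m) (S n) (term a x y)
        - h * dsum m (S n) (term (pderiv1 a) x y) - k * dsum (S m) n (term (pderiv2 a) x y))%C
  <= 16 / r ^ 2 * B * (Cmod h + Cmod k) ^ 2.
Proof.
intros Hr HB Hx Hy Hxh Hyk.
rewrite dsum_pderiv1, dsum_pderiv2.
assert (Hs : 0 < r / 4) by lra.
set (w := fun j l => (a j l * ((x + h) ^ j * (y + k) ^ l - x ^ j * y ^ l - h * (dpow x j * y ^ l)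
                - k * (x ^ j * dpow y l)))%C).
replace (_ - _)%C with (dsum (S m) (S n) w).
- eapply Rle_trans with (rdsum (S m) (S n) (fun j l =>
    (16 / r ^ 2 * (Cmod h + Cmod k) ^ 2) * majorant a r j l)).
  + apply dsum_le. intros j l. unfold w, majorant. rewrite Cmod_mult.
    pose proof (monomial_taylor_le x y h k (r / 4) j l Hs Hx Hy Hxh Hyk) as H.
    replace (4 * (r / 4)) with r in H by field.
    set (D := Cmod (_ - _)%C) in *.
    rewrite <- Rmult_assoc, (Rmult_comm _ (Cmod (a j l))), Rmult_assoc.
    apply Rmult_le_compat_l; [apply Cmod_ge_0|].
    apply Rmult_le_reg_l with ((r / 4) ^ 2); [apply pow_lt; lra|].
    eapply Rle_trans; [exact H|]. right. field. lra.
  + rewrite rdsum_scal.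
    assert (0 <= 16 / r ^ 2 * (Cmod h + Cmod k) ^ 2).
    { apply Rmult_le_pos; [|apply pow2_ge_0]. left. apply Rdiv_lt_0_compat; [lra|apply pow_lt, Hr]. }
    assert (rdsum (S m) (S n) (majorant a r) <= B).
    { eapply Rle_trans; [|apply (HB (S (m + n)))].
      apply rdsum_mono; [|lia|lia]. intros; apply majorant_nonneg; lra. }
    nra.
- unfold w, term.
  rewrite (dsum_ext _ _ _ (fun j l => a j l * ((x + h) ^ j * (y + k) ^ l) + ((-(1)) * (a j l * (x ^ j * y ^ l))
     + ((- h) * (a j l * (dpow x j * y ^ l)) + (- k) * (a j l * (x ^ j * dpow y l)))))%C).
  2:{ intros; ring. }
  rewrite !dsum_plus, !dsum_scal. ring.
Qed.

(** Limit of the inequality for partial sums. The constant does not depend on the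
    base point, which is what turns this into differentiability of the sum. *)
Lemma dtotal_taylor a r B :
  0 < r -> (forall n, rdsum n n (majorant a r) <= B) ->
  forall x y h k : C,
  Cmod x <= r / 4 -> Cmod y <= r / 4 -> Cmod (x + h)%C <= r / 4 -> Cmod (y + k)%C <= r / 4 ->
  Cmod (dtotal (term a (x + h) (y + k)) - dtotal (term a x y)
        - h * dtotal (term (pderiv1 a) x y) - k * dtotal (term (pderiv2 a) x y))%C
  <= 16 / r ^ 2 * B * (Cmod h + Cmod k) ^ 2.
Proof.
intros Hr HB x y h k Hx Hy Hxh Hyk.
assert (Q : forall x y, Cmod x <= r / 4 -> Cmod y <= r / 4 -> dconv (term a x y) (dtotal (term a x y))).
{ intros x' y' H1 H2. apply dtotal_spec with (majorant a r) B; [|exact HB].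
  intros; apply term_le; lra. }
assert (Q1 : dconv (term (pderiv1 a) x y) (dtotal (term (pderiv1 a) x y))).
{ apply dtotal_spec with (majorant (pderiv1 a) (r / 2)) (/ r * B).
  intros; apply term_le; lra. apply pderiv1_summable; assumption. }
assert (Q2 : dconv (term (pderiv2 a) x y) (dtotal (term (pderiv2 a) x y))).
{ apply dtotal_spec with (majorant (pderiv2 a) (r / 2)) (/ r * B).
  intros; apply term_le; lra. apply pderiv2_summable; assumption. }
pose proof (Q _ _ Hx Hy) as Q0. pose proof (Q _ _ Hxh Hyk) as Qh. clear Q.
apply le_epsilon. intros e He.
pose proof (Cmod_ge_0 h) as Ph. pose proof (Cmod_ge_0 k) as Pk.
set (d := e / (2 + Cmod h + Cmod k)).
assert (Hd : 0 < d) by (apply Rdiv_lt_0_compat; lra).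
assert (Hed : e = d * (2 + Cmod h + Cmod k)) by (unfold d; field; lra).
destruct (Q0 d Hd) as [N0 H0]. destruct (Qh d Hd) as [Nh Hh].
destruct (Q1 d Hd) as [N1 H1]. destruct (Q2 d Hd) as [N2 H2].
set (p := (N0 + Nh + N1 + N2)%nat).
specialize (H0 (S p) (S p) ltac:(unfold p; lia) ltac:(unfold p; lia)).
specialize (Hh (S p) (S p) ltac:(unfold p; lia) ltac:(unfold p; lia)).
specialize (H1 p (S p) ltac:(unfold p; lia) ltac:(unfold p; lia)).
specialize (H2 (S p) p ltac:(unfold p; lia) ltac:(unfold p; lia)).
pose proof (dsum_taylor_le a x y h k r B p p Hr HB Hx Hy Hxh Hyk) as T.
rewrite Cmod_sub_sym in Hh. rewrite Cmod_sub_sym in H1. rewrite Cmod_sub_sym in H2.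
set (l0 := dtotal _) in H0 |- *. set (lh := dtotal _) in Hh |- *.
set (l1 := dtotal _) in H1 |- *. set (l2 := dtotal _) in H2 |- *.
set (s0 := dsum _ _ (term a x y)) in *. set (sh := dsum _ _ (term a (x+h) (y+k))) in *.
set (s1 := dsum _ _ _) in H1, T. set (s2 := dsum _ _ _) in H2, T.
replace (lh - l0 - h * l1 - k * l2)%C with
  ((sh - s0 - h * s1 - k * s2) + ((lh - sh) + ((s0 - l0) + (- h * (l1 - s1) + - k * (l2 - s2)))))%C by ring.
eapply Rle_trans; [apply Cmod_triangle|].
apply Rplus_le_compat; [exact T|].
eapply Rle_trans; [apply Cmod_triangle|].
eapply Rle_trans; [apply Rplus_le_compat_l, Cmod_triangle|].
eapply Rle_trans; [apply Rplus_le_compat_l, Rplus_le_compat_l, Cmod_triangle|].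
rewrite !Cmod_mult, !Cmod_opp.
assert (Cmod h * Cmod (l1 - s1)%C <= Cmod h * d) by (apply Rmult_le_compat_l; lra).
assert (Cmod k * Cmod (l2 - s2)%C <= Cmod k * d) by (apply Rmult_le_compat_l; lra).
lra.
Qed.

(** * Holomorphic functions of two variables *)

Definition coef2 (c : list nat -> C) (j k : nat) : C := c [j; k].
Definition index2 (a : nat -> nat -> C) (alpha : list nat) : C :=
  match alpha with [j; k] => a j k | _ => 0%C end.

Lemma mpsum2 n c x y :
  mpsum (K := C_AbsRing) n c [x; y] = dsum n n (term (coef2 c) x y).
Proof.
unfold dsum. cbn [mpsum]. apply csum_ext. intros j _.
transitivity (x ^ j * csum (fun k => (y ^ k * c [j; k])%C) n)%C.
- reflexivity.
- rewrite <- csum_scal. apply csum_ext. intros k _. unfold term, coef2. ring.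
Qed.

Lemma mpsum2_abs n c (x y : C) :
  mpsum (K := R_AbsRing) n (fun al => abs (c al)) (map (@abs C_AbsRing) [x; y]) =
  rdsum n n (fun j k => Cmod (coef2 c j k) * (Cmod x ^ j * Cmod y ^ k)).
Proof.
unfold rdsum. cbn [mpsum map]. apply sum_n_ext. intros j.
transitivity (Cmod x ^ j * sum_n (fun k => Cmod y ^ k * Cmod (c [j; k])) n).
- reflexivity.
- rewrite <- rsum_scal. apply sum_n_ext. intros k.
  change (Cmod x ^ j * (Cmod y ^ k * Cmod (c [j; k])) = Cmod (c [j; k]) * (Cmod x ^ j * Cmod y ^ k)). ring.
Qed.

(** The explicit radius and bound, hidden in [holomorphic_at], can be followed
    through termwise differentiation. *)
Definition expands (f : C2 -> C) (q : C2) (a : nat -> nat -> C) (r B : R) : Prop :=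
  0 < r /\ (forall n, rdsum n n (majorant a r) <= B) /\
  forall b : C2, Cmod (fst b - fst q)%C <= r -> Cmod (snd b - snd q)%C <= r ->
    f b = dtotal (term a (fst b - fst q)%C (snd b - snd q)%C).

Lemma filterlim_dconv u l :
  dconv u l ->
  filterlim (fun n => dsum n n u) eventually (locally (T := AbsRing_UniformSpace C_AbsRing) l).
Proof.
intros H. apply (filterlim_locally (U := AbsRing_UniformSpace C_AbsRing)). intros e.
destruct (H e (cond_pos e)) as [N HN]. exists N. intros n Hn.
exact (HN n n Hn Hn).
Qed.

Lemma dconv_filterlim u v B l :
  (forall j k, Cmod (u j k) <= v j k) -> (forall n, rdsum n n v <= B) ->
  filterlim (fun n => dsum n n u) eventually (locally (T := AbsRing_UniformSpace C_AbsRing) l) ->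
  l = dtotal u.
Proof.
intros H HB Hl. pose proof (dtotal_spec u v B H HB) as Hd.
apply Csub_eq0, Cmod_eq0_lim. intros e He.
assert (He2 : 0 < e / 2) by lra.
destruct (Hd _ He2) as [N HN].
destruct (proj1 (filterlim_locally (U := AbsRing_UniformSpace C_AbsRing) _ _) Hl (mkposreal _ He2)) as [N' HN'].
specialize (HN (N + N') (N + N') ltac:(lia) ltac:(lia))%nat.
specialize (HN' (N + N') ltac:(lia))%nat.
change (Cmod (dsum (N + N') (N + N') u - l)%C < e / 2) in HN'.
set (s := dsum _ _ u) in *.
replace (l - dtotal u)%C with ((l - s) + (s - dtotal u))%C by ring.
eapply Rle_lt_trans; [apply Cmod_triangle|].
rewrite (Cmod_sub_sym l s). lra.
Qed.

Lemma is_mpseries_of_expansion c a r B x y :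
  (forall j k, coef2 c j k = a j k) ->
  (forall n, rdsum n n (majorant a r) <= B) -> Cmod x <= r -> Cmod y <= r ->
  is_mpseries (K := C_AbsRing) c [x; y] (dtotal (term a x y)).
Proof.
intros Hc HB Hx Hy. split.
- exists B. intros n. rewrite mpsum2_abs. eapply Rle_trans; [|apply (HB n)].
  apply rdsum_le. intros j k. unfold majorant. rewrite Hc.
  pose proof (Cmod_ge_0 x). pose proof (Cmod_ge_0 y).
  apply Rmult_le_compat_l; [apply Cmod_ge_0|].
  apply Rmult_le_compat; try (apply pow_le; assumption); apply pow_incr; lra.
- eapply filterlim_ext.
  2:{ apply filterlim_dconv. apply dtotal_spec with (majorant a r) B; [|exact HB].
      intros; apply term_le; assumption. }
  intros n. rewrite mpsum2. apply dsum_ext. intros. unfold term. rewrite Hc. reflexivity.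
Qed.

Lemma expands_holomorphic f q a r B : expands f q a r B -> holomorphic_at f q.
Proof.
intros [Hr [HB Hf]]. exists (index2 a). apply locally_C2.
exists r. split; [exact Hr|]. intros b H1 H2.
change (is_mpseries (K := C_AbsRing) (index2 a) [(fst b - fst q)%C; (snd b - snd q)%C] (f b)).
rewrite Hf by (left; assumption).
apply is_mpseries_of_expansion with r B; try (left; assumption); [reflexivity|exact HB].
Qed.

Lemma polydisc_radius (d : R) : 0 < d ->
  Cmod (RtoC (d / 2)) < d /\ Cmod (RtoC (d / 2)) = d / 2.
Proof. intros Hd. rewrite Cmod_R, Rabs_pos_eq; lra. Qed.

Lemma holomorphic_expands f q : holomorphic_at f q -> exists a r B, expands f q a r B.
Proof.
intros [c Hc]. apply locally_C2 in Hc. destruct Hc as [d [Hd H]].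
destruct (polydisc_radius d Hd) as [Hr1 Hr2].
set (b0 := ((fst q + RtoC (d / 2))%C, (snd q + RtoC (d / 2))%C) : C2).
assert (HB : exists B, forall n, rdsum n n (majorant (coef2 c) (d / 2)) <= B).
{ destruct (H b0) as [[B HB] _].
  - unfold b0; simpl. replace (_ - _)%C with (RtoC (d / 2)) by ring. exact Hr1.
  - unfold b0; simpl. replace (_ - _)%C with (RtoC (d / 2)) by ring. exact Hr1.
  - exists B. intros n. specialize (HB n).
    change (mpsum (K := R_AbsRing) n (fun al => abs (c al)) (map (@abs C_AbsRing)
       [(fst q + RtoC (d / 2) - fst q)%C; (snd q + RtoC (d / 2) - snd q)%C]) <= B) in HB.
    rewrite mpsum2_abs in HB.
    replace (fst q + RtoC (d / 2) - fst q)%C with (RtoC (d / 2)) in HB by ring.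
    replace (snd q + RtoC (d / 2) - snd q)%C with (RtoC (d / 2)) in HB by ring.
    rewrite Hr2 in HB. exact HB. }
destruct HB as [B HB].
exists (coef2 c), (d / 2), B. split; [lra|]. split; [exact HB|].
intros b H1 H2. destruct (H b) as [_ Hl]; [lra|lra|].
apply dconv_filterlim with (majorant (coef2 c) (d / 2)) B; [|exact HB|].
- intros; apply term_le; assumption.
- eapply filterlim_ext; [|exact Hl]. intros n. exact (mpsum2 n c _ _).
Qed.

(** The derivatives are sums of the derived series, on half the radius; being again
    holomorphic at [q], they can be differentiated in turn. *)
Theorem holomorphic_derivatives f q : holomorphic_at f q ->
  exists D1 D2 : C2 -> C, holomorphic_at D1 q /\ holomorphic_at D2 q /\
  exists K d, 0 < d /\ forall a b : C2,
    Cmod (fst a - fst q)%C < d -> Cmod (snd a - snd q)%C < d ->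
    Cmod (fst b - fst q)%C < d -> Cmod (snd b - snd q)%C < d ->
    Cmod (f b - f a - (fst b - fst a) * D1 a - (snd b - snd a) * D2 a)%C
    <= K * (Cmod (fst b - fst a)%C + Cmod (snd b - snd a)%C) ^ 2.
Proof.
intros Hf. destruct (holomorphic_expands f q Hf) as [a [r [B [Hr [HB Hq]]]]].
set (x := fun b : C2 => (fst b - fst q)%C). set (y := fun b : C2 => (snd b - snd q)%C).
exists (fun b => dtotal (term (pderiv1 a) (x b) (y b))).
exists (fun b => dtotal (term (pderiv2 a) (x b) (y b))).
split; [|split].
- apply expands_holomorphic with (pderiv1 a) (r / 2) (/ r * B).
  split; [lra|]. split; [apply pderiv1_summable; assumption|reflexivity].
- apply expands_holomorphic with (pderiv2 a) (r / 2) (/ r * B).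
  split; [lra|]. split; [apply pderiv2_summable; assumption|reflexivity].
- exists (16 / r ^ 2 * B), (r / 4). split; [lra|].
  intros a' b Ha1 Ha2 Hb1 Hb2.
  rewrite (Hq a'), (Hq b) by lra.
  pose proof (dtotal_taylor a r B Hr HB (x a') (y a') (fst b - fst a')%C (snd b - snd a')%C) as T.
  replace (x a' + (fst b - fst a'))%C with (fst b - fst q)%C in T by (unfold x; ring).
  replace (y a' + (snd b - snd a'))%C with (snd b - snd q)%C in T by (unfold y; ring).
  unfold x, y in *.
  apply T; lra.
Qed.

(** The Taylor polynomial over the box of exponents at most 5: what it leaves out has
    total degree at least 6. *)
Definition box (a : nat -> nat -> C) (x y : C) : C := dsum 5 5 (term a x y).

(** Outside the box a monomial has degree at least 6, so shrinking the variables by a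
    factor [e] shrinks the rest of the series by [e^6]. *)
Theorem holomorphic_box_taylor f q : holomorphic_at f q ->
  exists a K d, 0 < d /\ forall b : C2,
    Cmod (fst b - fst q)%C < d -> Cmod (snd b - snd q)%C < d ->
    Cmod (f b - box a (fst b - fst q) (snd b - snd q))%C
    <= K * (Cmod (fst b - fst q)%C + Cmod (snd b - snd q)%C) ^ 6.
Proof.
intros Hf. destruct (holomorphic_expands f q Hf) as [a [r [B [Hr [HB Hq]]]]].
exists a, (B / r ^ 6), (r / 2). split; [lra|]. intros b H1 H2.
rewrite Hq by lra.
set (x := (fst b - fst q)%C) in *. set (y := (snd b - snd q)%C) in *.
pose proof (Cmod_ge_0 x) as Px. pose proof (Cmod_ge_0 y) as Py.
set (e := (Cmod x + Cmod y) / r).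
assert (He : 0 <= e <= 1).
{ unfold e. split; [apply Rdiv_le_0_compat; lra|].
  apply Rmult_le_reg_r with r; [lra|]. field_simplify; lra. }
assert (Er : e * r = Cmod x + Cmod y) by (unfold e; field; lra).
replace (B / r ^ 6 * (Cmod x + Cmod y) ^ 6) with (e ^ 6 * B)
  by (unfold e; field; lra).
set (u := fun j k => if (Nat.leb j 5 && Nat.leb k 5)%bool then RtoC 0 else term a x y j k).
assert (Hu : forall j k, Cmod (u j k) <= e ^ 6 * majorant a r j k).
{ intros j k. unfold u.
  destruct (Nat.leb j 5 && Nat.leb k 5)%bool eqn:Ejk.
  - rewrite Cmod_0. apply Rmult_le_pos; [apply pow_le; lra|apply majorant_nonneg; lra].
  - assert (Hjk : (6 <= j + k)%nat).
    { apply Bool.andb_false_iff in Ejk. rewrite !Nat.leb_gt in Ejk. lia. }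
    unfold term, majorant. rewrite !Cmod_mult, !Cmod_pow.
    replace (e ^ 6 * (Cmod (a j k) * (r ^ j * r ^ k))) with
      (Cmod (a j k) * (e ^ 6 * (r ^ j * r ^ k))) by ring.
    apply Rmult_le_compat_l; [apply Cmod_ge_0|].
    apply Rle_trans with ((e * r) ^ j * (e * r) ^ k).
    + apply Rmult_le_compat; try (apply pow_le; assumption); apply pow_incr; lra.
    + rewrite !Rpow_mult_distr.
      replace (e ^ j * r ^ j * (e ^ k * r ^ k)) with (e ^ (j + k) * (r ^ j * r ^ k))
        by (rewrite pow_add; ring).
      apply Rmult_le_compat_r; [apply Rmult_le_pos; apply pow_le; lra|].
      replace (j + k)%nat with (6 + (j + k - 6))%nat by lia.
      rewrite pow_add. rewrite <- (Rmult_1_r (e ^ 6)) at 2.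
      apply Rmult_le_compat_l; [apply pow_le; lra|].
      rewrite <- (pow1 (j + k - 6)). apply pow_incr. exact He. }
assert (Hsplit : forall n, (5 <= n)%nat -> dsum n n (term a x y) = (box a x y + dsum n n u)%C).
{ intros n Hn.
  set (v := fun j k => if (Nat.leb j 5 && Nat.leb k 5)%bool then term a x y j k else RtoC 0).
  replace (box a x y) with (dsum n n v).
  - rewrite <- dsum_plus. apply dsum_ext. intros j k. unfold u, v.
    destruct (Nat.leb j 5 && Nat.leb k 5)%bool; ring.
  - unfold box, dsum. rewrite (csum_support (fun j => csum (v j) n) n 5 Hn).
    + apply csum_ext. intros j Hj. rewrite (csum_support (v j) n 5 Hn).
      * apply csum_ext. intros k Hk. unfold v. apply Nat.leb_le in Hj, Hk. rewrite Hj, Hk. reflexivity.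
      * intros k Hk. unfold v. apply Nat.leb_gt in Hk. rewrite Hk, Bool.andb_false_r. reflexivity.
    + intros j Hj. apply Nat.leb_gt in Hj. rewrite (csum_support (v j) n 0); [|lia|].
      * rewrite csum_0. unfold v. rewrite Hj. reflexivity.
      * intros k _. unfold v. rewrite Hj. reflexivity. }
assert (Hd : dconv (term a x y) (dtotal (term a x y))).
{ apply dtotal_spec with (majorant a r) B; [|exact HB]. intros; apply term_le; lra. }
apply le_epsilon. intros eps Heps. destruct (Hd eps Heps) as [N HN].
specialize (HN (N + 5) (N + 5) ltac:(lia) ltac:(lia))%nat.
assert (Hb : Cmod (dsum (N + 5) (N + 5) u) <= e ^ 6 * B).
{ eapply Rle_trans; [apply dsum_le, Hu|]. rewrite rdsum_scal.
  apply Rmult_le_compat_l; [apply pow_le; lra|apply HB]. }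
pose proof (Hsplit (N + 5)%nat ltac:(lia)) as Hs.
rewrite Cmod_sub_sym in HN.
replace (dtotal (term a x y) - box a x y)%C with
  (dsum (N + 5) (N + 5) u + (dtotal (term a x y) - dsum (N + 5) (N + 5) (term a x y)))%C
  by (rewrite Hs; ring).
eapply Rle_trans; [apply Cmod_triangle|]. lra.
Qed.

(** * Derivatives along curves *)

Notation CR := C_R_NormedModule.

Lemma is_derive_epsilon (u : R -> C) t (l : C) :
  is_derive (V := CR) u t l <->
  forall e, 0 < e -> exists d, 0 < d /\ forall s, Rabs (s - t) < d ->
    Cmod (u s - u t - RtoC (s - t) * l)%C <= e * Rabs (s - t).
Proof.
assert (Hn : forall s : R, norm (minus (minus (u s) (u t)) (scal (minus s t) l : CR) : CR)
   = Cmod (u s - u t - RtoC (s - t) * l)%C).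
{ intros s. rewrite <- Cmod_norm. f_equal.
  unfold minus, plus, opp, scal; simpl. unfold prod_plus, prod_opp, prod_scal, Cminus, Cplus, Copp, Cmult, RtoC.
  unfold plus, opp, scal; simpl. unfold mult; simpl. f_equal; ring. }
split.
- intros [_ H] e He.
  specialize (H t (fun P HP => HP) (mkposreal e He)).
  destruct H as [d Hd]. exists d. split; [apply cond_pos|]. intros s Hs.
  rewrite <- Hn. exact (Hd s Hs).
- intros H. split; [apply is_linear_scal_l|].
  intros x Hx. apply (is_filter_lim_locally_unique (V := AbsRing_NormedModule R_AbsRing)) in Hx. subst x.
  intros e. destruct (H e (cond_pos e)) as [d [Hd H']].
  exists (mkposreal d Hd). intros s Hs. simpl pos. eapply Rle_trans; [|exact (H' s Hs)]. right. exact (Hn s).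
Qed.

Lemma is_derive_Cplus (u v : R -> C) t (a b : C) :
  is_derive (V := CR) u t a -> is_derive (V := CR) v t b ->
  is_derive (V := CR) (fun s => u s + v s)%C t (a + b)%C.
Proof. intros Hu Hv. exact (is_derive_plus (V := CR) u v t a b Hu Hv). Qed.

Lemma is_derive_Cconst (a : C) t : is_derive (V := CR) (fun _ => a) t (RtoC 0).
Proof. exact (is_derive_const (V := CR) a t). Qed.

Lemma is_derive_Cconj (u : R -> C) t (a : C) :
  is_derive (V := CR) u t a -> is_derive (V := CR) (fun s => Cconj (u s)) t (Cconj a).
Proof.
rewrite !is_derive_C. intros [H1 H2]. split; [exact H1|].
exact (is_derive_opp (V := R_NormedModule) (fun s => Im (u s)) t (Im a) H2).
Qed.

Lemma continuous_C (u : R -> C) t :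
  continuous (U := CR) u t <->
  continuous (fun s => Re (u s)) t /\ continuous (fun s => Im (u s)) t.
Proof.
split.
- intros H; split.
  + apply (continuous_comp (V := CR) u Re); [exact H|]. destruct (u t) as [a b]. exact (continuous_fst a b).
  + apply (continuous_comp (V := CR) u Im); [exact H|]. destruct (u t) as [a b]. exact (continuous_snd a b).
- intros [H1 H2].
  apply (continuous_ext (U := CR) (fun s => (Re (u s), Im (u s)))).
  { intros s. symmetry. apply surjective_pairing. }
  apply (continuous_comp_2 (V := R_UniformSpace) (W := R_UniformSpace) (X := CR) (fun s => Re (u s)) (fun s => Im (u s)) (fun a b => (a, b)) t H1 H2).
  apply (continuous_ext (U := CR) (fun p : prod_UniformSpace R_UniformSpace R_UniformSpace => p)).
  { intros s. apply surjective_pairing. }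
  apply continuous_id.
Qed.

Lemma continuous_C2 (u : R -> C2) t :
  continuous u t <->
  continuous (U := CR) (fun s => fst (u s)) t /\ continuous (U := CR) (fun s => snd (u s)) t.
Proof.
split.
- intros H; split.
  + apply (continuous_comp (V := C2) u fst); [exact H|]. destruct (u t) as [a b]. exact (continuous_fst a b).
  + apply (continuous_comp (V := C2) u snd); [exact H|]. destruct (u t) as [a b]. exact (continuous_snd a b).
- intros [H1 H2].
  apply (continuous_ext (U := C2) (fun s => (fst (u s), snd (u s)))).
  { intros s. symmetry. apply surjective_pairing. }
  apply (continuous_comp_2 (V := CR) (W := CR) (X := C2) (fun s => fst (u s)) (fun s => snd (u s)) (fun a b => (a, b)) t H1 H2).
  apply (continuous_ext (U := C2) (fun p : prod_UniformSpace CR CR => p)).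
  { intros s. apply surjective_pairing. }
  apply continuous_id.
Qed.

Lemma continuous_Cplus (u v : R -> C) t :
  continuous (U := CR) u t -> continuous (U := CR) v t ->
  continuous (U := CR) (fun s => u s + v s)%C t.
Proof. intros Hu Hv. exact (continuous_plus (V := CR) u v t Hu Hv). Qed.

Lemma continuous_Cmult (u v : R -> C) t :
  continuous (U := CR) u t -> continuous (U := CR) v t ->
  continuous (U := CR) (fun s => u s * v s)%C t.
Proof.
rewrite !continuous_C. intros [U1 U2] [V1 V2]. split; simpl.
- apply (continuous_minus (V := R_NormedModule)); apply (continuous_mult (K := R_AbsRing)); assumption.
- apply (continuous_plus (V := R_NormedModule)); apply (continuous_mult (K := R_AbsRing)); assumption.
Qed.

Lemma continuous_Cconj (u : R -> C) t :
  continuous (U := CR) u t -> continuous (U := CR) (fun s => Cconj (u s)) t.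
Proof.
rewrite !continuous_C. intros [U1 U2]. split; simpl; [exact U1|].
apply (continuous_opp (V := R_NormedModule)), U2.
Qed.

Lemma is_derive_continuous {V : NormedModule R_AbsRing} (u : R -> V) t l :
  is_derive u t l -> continuous u t.
Proof. intros H. apply (ex_derive_continuous u). exists l. exact H. Qed.

Lemma is_derive_compC (u : R -> C) (h : R -> R) t (l : C) k :
  is_derive (V := CR) u (h t) l -> is_derive h t k ->
  is_derive (V := CR) (fun s => u (h s)) t (RtoC k * l)%C.
Proof.
intros Hu Hh. pose proof (is_derive_comp (V := CR) u h t l k Hu Hh) as H.
replace (RtoC k * l)%C with (scal k l : CR); [exact H|].
unfold scal; simpl. unfold prod_scal, Cmult, RtoC, scal; simpl. unfold mult; simpl.
f_equal; ring.
Qed.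

Lemma continuous_near (u : R -> C2) t d : continuous u t -> 0 < d ->
  locally t (fun s => Cmod (fst (u s) - fst (u t))%C < d /\ Cmod (snd (u s) - snd (u t))%C < d).
Proof.
intros H Hd.
apply (H (fun b => Cmod (fst b - fst (u t))%C < d /\ Cmod (snd b - snd (u t))%C < d)).
apply locally_C2. exists d. split; [exact Hd|]. auto.
Qed.

(** The quadratic remainder of [f] is negligible along the curve, whose increments are
    at most proportional to those of the parameter. *)
Lemma is_derive_along (f : C2 -> C) (D1 D2 : C) (a : C2) K d (g : R -> C2) t (l : C2) :
  0 < d ->
  (forall b : C2, Cmod (fst b - fst a)%C < d -> Cmod (snd b - snd a)%C < d ->
    Cmod (f b - f a - (fst b - fst a) * D1 - (snd b - snd a) * D2)%C
    <= K * (Cmod (fst b - fst a)%C + Cmod (snd b - snd a)%C) ^ 2) ->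
  g t = a -> is_derive g t l ->
  is_derive (V := CR) (fun s => f (g s)) t (fst l * D1 + snd l * D2)%C.
Proof.
intros Hd Hf <- Hg.
pose proof (is_derive_continuous g t l Hg) as Hc.
destruct (continuous_near g t d Hc Hd) as [d1 Hd1].
apply is_derive_C2 in Hg. destruct Hg as [G1 G2].
rewrite is_derive_epsilon in G1, G2. apply is_derive_epsilon.
intros e He.
set (N1 := Cmod D1). set (N2 := Cmod D2).
assert (0 <= N1) by apply Cmod_ge_0. assert (0 <= N2) by apply Cmod_ge_0.
set (M := Cmod (fst l) + Cmod (snd l) + 2).
assert (0 <= Cmod (fst l)) by apply Cmod_ge_0.
assert (0 <= Cmod (snd l)) by apply Cmod_ge_0.
set (e1 := Rmin 1 (e / 2 / (N1 + N2 + 1))).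
assert (He1 : 0 < e1).
{ apply Rmin_pos; [lra|]. apply Rdiv_lt_0_compat; lra. }
assert (He1' : e1 * (N1 + N2) <= e / 2).
{ apply Rle_trans with (e / 2 / (N1 + N2 + 1) * (N1 + N2 + 1)).
  - apply Rmult_le_compat; try lra. apply Rmin_r.
  - right; field; lra. }
destruct (G1 e1 He1) as [d2 [Hd2 G1']]. destruct (G2 e1 He1) as [d3 [Hd3 G2']].
set (K' := Rmax K 0 + 1).
assert (K <= K') by (unfold K'; pose proof (Rmax_l K 0); lra).
assert (0 < K') by (unfold K'; pose proof (Rmax_r K 0); lra).
assert (HM : 0 < K' * M ^ 2) by (apply Rmult_lt_0_compat; [lra|apply pow_lt; unfold M; lra]).
set (d4 := e / 2 / (K' * M ^ 2)).
assert (Hd4 : 0 < d4) by (apply Rdiv_lt_0_compat; lra).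
exists (Rmin (Rmin d1 d2) (Rmin d3 d4)).
split; [repeat apply Rmin_pos; try assumption; apply cond_pos|].
intros s Hs.
assert (Hs1 : Rabs (s - t) < d1) by (eapply Rlt_le_trans; [exact Hs|]; eapply Rle_trans; [apply Rmin_l|apply Rmin_l]).
assert (Hs2 : Rabs (s - t) < d2) by (eapply Rlt_le_trans; [exact Hs|]; eapply Rle_trans; [apply Rmin_l|apply Rmin_r]).
assert (Hs3 : Rabs (s - t) < d3) by (eapply Rlt_le_trans; [exact Hs|]; eapply Rle_trans; [apply Rmin_r|apply Rmin_l]).
assert (Hs4 : Rabs (s - t) < d4) by (eapply Rlt_le_trans; [exact Hs|]; eapply Rle_trans; [apply Rmin_r|apply Rmin_r]).
destruct (Hd1 s Hs1) as [B1 B2]. specialize (Hf _ B1 B2).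
specialize (G1' s Hs2). specialize (G2' s Hs3).
set (x := (fst (g s) - fst (g t))%C) in *. set (y := (snd (g s) - snd (g t))%C) in *.
set (r := Rabs (s - t)) in *. assert (Hr : 0 <= r) by apply Rabs_pos.
set (sc := RtoC (s - t)) in *. assert (Hsc : Cmod sc = r) by apply Cmod_R.
assert (Hx : Cmod x <= (Cmod (fst l) + 1) * r).
{ replace x with ((x - sc * fst l) + sc * fst l)%C by ring.
  eapply Rle_trans; [apply Cmod_triangle|]. rewrite Cmod_mult, Hsc.
  assert (e1 * r <= 1 * r) by (apply Rmult_le_compat_r; [exact Hr|apply Rmin_l]). lra. }
assert (Hy : Cmod y <= (Cmod (snd l) + 1) * r).
{ replace y with ((y - sc * snd l) + sc * snd l)%C by ring.
  eapply Rle_trans; [apply Cmod_triangle|]. rewrite Cmod_mult, Hsc.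
  assert (e1 * r <= 1 * r) by (apply Rmult_le_compat_r; [exact Hr|apply Rmin_l]). lra. }
assert (Hq : K * (Cmod x + Cmod y) ^ 2 <= e / 2 * r).
{ pose proof (Cmod_ge_0 x). pose proof (Cmod_ge_0 y).
  apply Rle_trans with (K' * (M * r) ^ 2).
  - apply Rle_trans with (K' * (Cmod x + Cmod y) ^ 2).
    + apply Rmult_le_compat_r; [apply pow2_ge_0|assumption].
    + apply Rmult_le_compat_l; [lra|]. apply pow_incr. unfold M. lra.
  - replace (K' * (M * r) ^ 2) with (K' * M ^ 2 * r * r) by ring.
    apply Rmult_le_compat_r; [exact Hr|].
    replace (e / 2) with (K' * M ^ 2 * d4) by (unfold d4; field; split; unfold M; lra).
    apply Rmult_le_compat_l; lra. }
replace (f (g s) - f (g t) - sc * (fst l * D1 + snd l * D2))%C with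
  ((f (g s) - f (g t) - x * D1 - y * D2) + ((x - sc * fst l) * D1 + (y - sc * snd l) * D2))%C by ring.
eapply Rle_trans; [apply Cmod_triangle|].
eapply Rle_trans; [apply Rplus_le_compat_l, Cmod_triangle|].
rewrite !Cmod_mult. fold N1 N2.
assert (Cmod (x - sc * fst l)%C * N1 <= e1 * r * N1) by (apply Rmult_le_compat_r; assumption).
assert (Cmod (y - sc * snd l)%C * N2 <= e1 * r * N2) by (apply Rmult_le_compat_r; assumption).
assert (e1 * (N1 + N2) * r <= e / 2 * r) by (apply Rmult_le_compat_r; assumption).
lra.
Qed.

Theorem holomorphic_along f q : holomorphic_at f q ->
  exists D1 D2 : C2 -> C, holomorphic_at D1 q /\ holomorphic_at D2 q /\
  locally q (fun a => forall (g : R -> C2) t l, g t = a -> is_derive g t l ->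
    is_derive (V := CR) (fun s => f (g s)) t (fst l * D1 a + snd l * D2 a)%C).
Proof.
intros Hf. destruct (holomorphic_derivatives f q Hf) as [D1 [D2 [H1 [H2 [K [d [Hd HT]]]]]]].
exists D1, D2. split; [exact H1|]. split; [exact H2|].
apply locally_C2. exists (d / 2). split; [lra|].
intros a A1 A2 g t l Hg Hl.
apply is_derive_along with (a := a) (K := K) (d := d / 2) (4 := Hl); [lra| |exact Hg].
intros b B1 B2. apply HT; try lra.
- replace (fst b - fst q)%C with ((fst b - fst a) + (fst a - fst q))%C by ring.
  eapply Rle_lt_trans; [apply Cmod_triangle|]. lra.
- replace (snd b - snd q)%C with ((snd b - snd a) + (snd a - snd q))%C by ring.
  eapply Rle_lt_trans; [apply Cmod_triangle|]. lra.
Qed.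

(** * Jets of curves *)

Definition has_jet1 {V : NormedModule R_AbsRing} (g : R -> V) (a v : V) : Prop :=
  exists g1 : R -> V,
    locally 0 (fun t : R => is_derive g t (g1 t) /\ continuous g1 t) /\ g 0 = a /\ g1 0 = v.

Lemma has_jet2_jet1 {V : NormedModule R_AbsRing} (g : R -> V) a v w :
  has_jet2 g a v w <->
  exists g1, locally 0 (fun t : R => is_derive g t (g1 t)) /\ g 0 = a /\ has_jet1 g1 v w.
Proof.
split.
- intros [g1 [g2 [H [H0 [H1 H2]]]]]. exists g1. split; [|split; [exact H0|]].
  + revert H. apply filter_imp. intros t Ht; apply Ht.
  + exists g2. split; [|split; assumption].
    revert H. apply filter_imp. intros t Ht; split; apply Ht.
- intros [g1 [H [H0 [g2 [H' [H1 H2]]]]]]. exists g1, g2. split; [|auto].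
  apply filter_imp with (2 := filter_and _ _ H H'). tauto.
Qed.

Lemma jet2_is_jet1 {V : NormedModule R_AbsRing} (g : R -> V) a v w :
  has_jet2 g a v w -> has_jet1 g a v.
Proof.
intros [g1 [g2 [H [H0 [H1 H2]]]]]. exists g1. split; [|auto].
revert H. apply filter_imp. intros t [A [B _]]. split; [exact A|].
apply is_derive_continuous with (1 := B).
Qed.
Arguments jet2_is_jet1 {V g a v w}.

Lemma jet1_derive {V : NormedModule R_AbsRing} (g : R -> V) a v :
  has_jet1 g a v -> is_derive g 0 v.
Proof. intros [g1 [H [_ <-]]]. apply locally_singleton in H. apply H. Qed.

Lemma jet1_value {V : NormedModule R_AbsRing} (g : R -> V) a v : has_jet1 g a v -> g 0 = a.
Proof. intros [g1 H]. apply H. Qed.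
Arguments jet1_value {V g a v}.

Lemma jet1_continuous {V : NormedModule R_AbsRing} (g : R -> V) a v :
  has_jet1 g a v -> continuous g 0.
Proof. intros H. apply is_derive_continuous with (1 := jet1_derive g a v H). Qed.

Lemma jet1_near {V : NormedModule R_AbsRing} (g : R -> V) a v (P : V -> Prop) :
  has_jet1 g a v -> locally a P -> locally 0 (fun t => P (g t)).
Proof.
intros Hg HP. rewrite <- (jet1_value Hg) in HP.
exact (jet1_continuous g a v Hg P HP).
Qed.
Arguments jet1_near {V g a v P}.

Lemma jet2_ext {V : NormedModule R_AbsRing} (g d : R -> V) a v w :
  locally 0 (fun t => g t = d t) -> has_jet2 g a v w -> has_jet2 d a v w.
Proof.
rewrite !has_jet2_jet1. intros He [g1 [H [H0 H1]]]. exists g1. split; [|split; [|exact H1]].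
- apply filter_imp with (2 := filter_and _ _ (locally_locally _ _ He) H).
  intros t [He' A]. exact (is_derive_ext_loc g d t (g1 t) He' A).
- rewrite <- H0. symmetry. exact (locally_singleton _ _ He).
Qed.
Arguments jet2_ext {V g d a v w}.

Lemma jet1_C2 (g : R -> C2) a v :
  has_jet1 g a v <->
  has_jet1 (V := CR) (fun t => fst (g t)) (fst a) (fst v) /\
  has_jet1 (V := CR) (fun t => snd (g t)) (snd a) (snd v).
Proof.
split.
- intros [g1 [H [H0 H1]]]. split.
  + exists (fun t => fst (g1 t)). split; [|rewrite H0, H1; auto].
    revert H. apply filter_imp. intros t. rewrite is_derive_C2, continuous_C2. tauto.
  + exists (fun t => snd (g1 t)). split; [|rewrite H0, H1; auto].
    revert H. apply filter_imp. intros t. rewrite is_derive_C2, continuous_C2. tauto.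
- intros [[g1 [H [H0 H1]]] [k1 [K [K0 K1]]]]. exists (fun t => (g1 t, k1 t)).
  split; [|split].
  + apply filter_imp with (2 := filter_and _ _ H K). intros t.
    rewrite is_derive_C2, continuous_C2. simpl. tauto.
  + destruct (g 0), a; simpl in *; congruence.
  + destruct v; simpl in *; congruence.
Qed.

Lemma jet2_C2 (g : R -> C2) a v w :
  has_jet2 g a v w <->
  has_jet2 (V := CR) (fun t => fst (g t)) (fst a) (fst v) (fst w) /\
  has_jet2 (V := CR) (fun t => snd (g t)) (snd a) (snd v) (snd w).
Proof.
rewrite !has_jet2_jet1. split.
- intros [g1 [H [H0 H1]]]. apply jet1_C2 in H1. destruct H1 as [H1 H2]. split.
  + exists (fun t => fst (g1 t)). rewrite H0. split; [|auto].
    revert H. apply filter_imp. intros t. rewrite is_derive_C2. tauto.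
  + exists (fun t => snd (g1 t)). rewrite H0. split; [|auto].
    revert H. apply filter_imp. intros t. rewrite is_derive_C2. tauto.
- intros [[g1 [H [H0 H1]]] [k1 [K [K0 K1]]]]. exists (fun t => (g1 t, k1 t)).
  split; [|split].
  + apply filter_imp with (2 := filter_and _ _ H K). intros t.
    rewrite is_derive_C2. simpl. tauto.
  + destruct (g 0), a; simpl in *; congruence.
  + apply jet1_C2. simpl. auto.
Qed.

Lemma jet1_plus (u v : R -> C) a b a1 b1 :
  has_jet1 (V := CR) u a a1 -> has_jet1 (V := CR) v b b1 ->
  has_jet1 (V := CR) (fun t => u t + v t)%C (a + b)%C (a1 + b1)%C.
Proof.
intros [u1 [H [H0 H1]]] [v1 [K [K0 K1]]]. exists (fun t => (u1 t + v1 t)%C).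
split; [|rewrite H0, H1, K0, K1; auto].
apply filter_imp with (2 := filter_and _ _ H K). intros t [[A B] [A' B']]. split.
- apply is_derive_Cplus; assumption.
- apply continuous_Cplus; assumption.
Qed.
Arguments jet1_plus {u v a b a1 b1}.

Lemma jet1_mult (u v : R -> C) a b a1 b1 :
  has_jet1 (V := CR) u a a1 -> has_jet1 (V := CR) v b b1 ->
  has_jet1 (V := CR) (fun t => u t * v t)%C (a * b)%C (a1 * b + a * b1)%C.
Proof.
intros [u1 [H [H0 H1]]] [v1 [K [K0 K1]]]. exists (fun t => (u1 t * v t + u t * v1 t)%C).
split; [|rewrite H0, H1, K0, K1; auto].
apply filter_imp with (2 := filter_and _ _ H K). intros t [[A B] [A' B']]. split.
- apply is_derive_Cmult; assumption.
- apply continuous_Cplus; apply continuous_Cmult; try assumption;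
  eapply is_derive_continuous; eassumption.
Qed.
Arguments jet1_mult {u v a b a1 b1}.

Lemma jet1_const (a : C) : has_jet1 (V := CR) (fun _ => a) a (RtoC 0).
Proof.
exists (fun _ => RtoC 0). split; [|auto]. apply filter_forall. intros t. split.
- apply is_derive_Cconst.
- exact (continuous_const (V := CR) (RtoC 0) t).
Qed.

Lemma jet1_conj (u : R -> C) a a1 :
  has_jet1 (V := CR) u a a1 -> has_jet1 (V := CR) (fun t => Cconj (u t)) (Cconj a) (Cconj a1).
Proof.
intros [u1 [H [H0 H1]]]. exists (fun t => Cconj (u1 t)).
split; [|rewrite H0, H1; auto].
revert H. apply filter_imp. intros t [A B]. split.
- apply is_derive_Cconj, A.
- apply continuous_Cconj, B.
Qed.

Lemma jet2_plus (u v : R -> C) a b a1 b1 a2 b2 :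
  has_jet2 (V := CR) u a a1 a2 -> has_jet2 (V := CR) v b b1 b2 ->
  has_jet2 (V := CR) (fun t => u t + v t)%C (a + b)%C (a1 + b1)%C (a2 + b2)%C.
Proof.
rewrite !has_jet2_jet1. intros [u1 [H [H0 H1]]] [v1 [K [K0 K1]]].
exists (fun t => (u1 t + v1 t)%C). split; [|split].
- apply filter_imp with (2 := filter_and _ _ H K). intros t [A B].
  apply is_derive_Cplus; assumption.
- rewrite H0, K0; reflexivity.
- apply jet1_plus; assumption.
Qed.
Arguments jet2_plus {u v a b a1 b1 a2 b2}.

Lemma jet2_mult (u v : R -> C) a b a1 b1 a2 b2 :
  has_jet2 (V := CR) u a a1 a2 -> has_jet2 (V := CR) v b b1 b2 ->
  has_jet2 (V := CR) (fun t => u t * v t)%C (a * b)%C (a1 * b + a * b1)%C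
    ((a2 * b + a1 * b1) + (a1 * b1 + a * b2))%C.
Proof.
intros Hu Hv. pose proof (jet2_is_jet1 Hu) as Hu1. pose proof (jet2_is_jet1 Hv) as Hv1.
rewrite has_jet2_jet1 in Hu, Hv |- *. destruct Hu as [u1 [H [H0 H1]]], Hv as [v1 [K [K0 K1]]].
exists (fun t => (u1 t * v t + u t * v1 t)%C). split; [|split].
- apply filter_imp with (2 := filter_and _ _ H K). intros t [A B].
  apply is_derive_Cmult; assumption.
- rewrite H0, K0; reflexivity.
- apply jet1_plus; apply jet1_mult; assumption.
Qed.
Arguments jet2_mult {u v a b a1 b1 a2 b2}.

Lemma jet2_const (a : C) : has_jet2 (V := CR) (fun _ => a) a (RtoC 0) (RtoC 0).
Proof.
apply has_jet2_jet1. exists (fun _ => RtoC 0). split; [|split; [reflexivity|apply jet1_const]].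
apply filter_forall. intros t. apply is_derive_Cconst.
Qed.

Lemma jet2_scal (c : C) (u : R -> C) a a1 a2 :
  has_jet2 (V := CR) u a a1 a2 ->
  has_jet2 (V := CR) (fun t => c * u t)%C (c * a)%C (c * a1)%C (c * a2)%C.
Proof.
intros H. pose proof (jet2_mult (jet2_const c) H) as K.
replace (c * a1)%C with (0 * a + c * a1)%C by ring.
replace (c * a2)%C with ((0 * a + 0 * a1) + (0 * a1 + c * a2))%C by ring. exact K.
Qed.
Arguments jet2_scal c {u a a1 a2} _.

Lemma jet2_conj (u : R -> C) a a1 a2 :
  has_jet2 (V := CR) u a a1 a2 ->
  has_jet2 (V := CR) (fun t => Cconj (u t)) (Cconj a) (Cconj a1) (Cconj a2).
Proof.
rewrite !has_jet2_jet1. intros [u1 [H [H0 H1]]]. exists (fun t => Cconj (u1 t)).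
split; [|split].
- revert H. apply filter_imp. intros t. apply is_derive_Cconj.
- rewrite H0; reflexivity.
- apply jet1_conj, H1.
Qed.
Arguments jet2_conj {u a a1 a2}.

Lemma jet1_comp (u : R -> C) (h : R -> R) a (v : C) (k : R) :
  has_jet1 (V := CR) u a v -> has_jet1 (V := R_NormedModule) h 0 k ->
  has_jet1 (V := CR) (fun t => u (h t)) a (RtoC k * v)%C.
Proof.
intros Hu Hh. pose proof Hu as [u1 [H [H0 H1]]]. pose proof Hh as [h1 [K [K0 K1]]].
exists (fun t => (RtoC (h1 t) * u1 (h t))%C).
split; [|rewrite K0, K1, H0, H1; auto].
pose proof (jet1_near (V := R_NormedModule) Hh H) as H'.
apply filter_imp with (2 := filter_and _ _ H' K). intros t [[A B] [A' B']]. split.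
- apply is_derive_compC; assumption.
- apply continuous_Cmult.
  + apply continuous_C. split; [exact B'|]. simpl. apply continuous_const.
  + apply (continuous_comp (U := R_UniformSpace) (V := R_UniformSpace) (W := CR) h u1 t); [|exact B].
    apply (is_derive_continuous (V := R_NormedModule) h t _ A').
Qed.

Lemma jet1_RtoC (h : R -> R) a k :
  has_jet1 (V := R_NormedModule) h a k -> has_jet1 (V := CR) (fun t => RtoC (h t)) (RtoC a) (RtoC k).
Proof.
intros [h1 [K [K0 K1]]]. exists (fun t => RtoC (h1 t)). split; [|rewrite K0, K1; auto].
revert K. apply filter_imp. intros t [A B]. split.
- apply is_derive_C. split; [exact A|]. simpl. apply (is_derive_const (V := R_NormedModule)).
- apply continuous_C. split; [exact B|]. simpl. apply continuous_const.
Qed.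
Arguments jet1_RtoC {h a k}.

Lemma jet2_comp (u : R -> C) (h : R -> R) a (v w : C) (k1 k2 : R) :
  has_jet2 (V := CR) u a v w -> has_jet2 (V := R_NormedModule) h 0 k1 k2 ->
  has_jet2 (V := CR) (fun t => u (h t)) a (RtoC k1 * v)%C (RtoC k2 * v + RtoC k1 * (RtoC k1 * w))%C.
Proof.
intros Hu Hh. pose proof (jet2_is_jet1 Hh) as Hh1.
apply has_jet2_jet1 in Hu. apply has_jet2_jet1 in Hh. apply has_jet2_jet1.
destruct Hu as [u1 [H [H0 H1]]], Hh as [h1 [K [K0 K1]]].
exists (fun t => (RtoC (h1 t) * u1 (h t))%C). split; [|split].
- pose proof (jet1_near (V := R_NormedModule) Hh1 H) as H'.
  apply filter_imp with (2 := filter_and _ _ H' K). intros t [A B].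
  apply is_derive_compC; assumption.
- rewrite K0; exact H0.
- apply jet1_mult.
  + apply jet1_RtoC, K1.
  + apply jet1_comp; assumption.
Qed.

Definition Cscal2 (c : C) (v : C2) : C2 := ((c * fst v)%C, (c * snd v)%C).

Lemma jet2_reparam (g : R -> C2) (h : R -> R) a v w k1 k2 :
  has_jet2 g a v w -> has_jet2 (V := R_NormedModule) h 0 k1 k2 ->
  has_jet2 (fun t => g (h t)) a (Cscal2 k1 v)
    (plus (Cscal2 k2 v) (Cscal2 k1 (Cscal2 k1 w))).
Proof.
rewrite !jet2_C2. intros [H1 H2] Hh. split.
- exact (jet2_comp _ h _ _ _ _ _ H1 Hh).
- exact (jet2_comp _ h _ _ _ _ _ H2 Hh).
Qed.

Lemma jet1_reparam (g : R -> C2) (h : R -> R) a v k1 :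
  has_jet1 g a v -> has_jet1 (V := R_NormedModule) h 0 k1 ->
  has_jet1 (fun t => g (h t)) a (Cscal2 k1 v).
Proof.
rewrite !jet1_C2. intros [H1 H2] Hh. split.
- exact (jet1_comp _ h _ _ _ H1 Hh).
- exact (jet1_comp _ h _ _ _ H2 Hh).
Qed.

(** The first derivative is obtained by dividing by [t]. For the second one, the mean
    value theorem is applied to [r(t) - w t^2 / 2], whose derivative is o(t). *)
Lemma flat_jet2_R (r : R -> R) a v w K d :
  has_jet2 (V := R_NormedModule) r a v w -> 0 < d ->
  (forall t, 0 <= t < d -> Rabs (r t) <= K * t ^ 3) -> a = 0 /\ v = 0 /\ w = 0.
Proof.
intros [r1 [r2 [H [H0 [H1 H2]]]]] Hd HK.
assert (Hr0 : r 0 = 0).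
{ specialize (HK 0 ltac:(lra)). replace (K * 0 ^ 3) with 0 in HK by ring.
  pose proof (Rabs_pos (r 0)). apply Rabs_eq_0. lra. }
split; [congruence|].
destruct H as [d0 Hd0].
assert (D : forall t, Rabs t < d0 -> is_derive r t (r1 t) /\ is_derive r1 t (r2 t)).
{ intros t Ht. destruct (Hd0 t) as [A [B _]]; [|auto].
  change (Rabs (t - 0) < d0). rewrite Rminus_0_r. exact Ht. }
pose proof (cond_pos d0) as Pd0.
assert (E : forall (f : R -> R) l, is_derive f 0 l -> forall e, 0 < e -> exists d, 0 < d /\
   forall s, 0 < s < d -> Rabs (f s - f 0 - s * l) <= e * s).
{ intros f l Hf e He.
  assert (Hf' : is_derive (V := CR) (fun t => RtoC (f t)) 0 (RtoC l)).
  { apply is_derive_C. split; [exact Hf|]. exact (is_derive_const (V := R_NormedModule) 0 0). }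
  rewrite is_derive_epsilon in Hf'. destruct (Hf' e He) as [dd [P Q]].
  exists dd. split; [exact P|]. intros s Hs. specialize (Q s).
  rewrite Rminus_0_r, (Rabs_pos_eq s), <- RtoC_mult, <- !RtoC_minus, Cmod_R in Q by lra.
  apply Q. lra. }
assert (Z : forall l c m, (forall e, 0 < e -> exists d', 0 < d' /\ forall s, 0 < s < d' -> Rabs l * c <= e + m * s) -> 0 < c -> l = 0).
{ intros l c m Hl Hc. apply Rabs_eq_0. apply Rle_antisym; [|apply Rabs_pos].
  apply le_epsilon. intros e He.
  destruct (Hl (e * c / 2)) as [d' [P Q]]; [nra|].
  set (s := Rmin (d' / 2) (e * c / 2 / (Rabs m + 1))).
  pose proof (Rabs_pos m) as Pm.
  assert (Hs : 0 < s).
  { apply Rmin_pos; [lra|]. apply Rdiv_lt_0_compat; nra. }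
  assert (Hs1 : s < d') by (pose proof (Rmin_l (d' / 2) (e * c / 2 / (Rabs m + 1))) as Hl1; fold s in Hl1; lra).
  assert (Hs2 : s * (Rabs m + 1) <= e * c / 2).
  { apply Rle_trans with (e * c / 2 / (Rabs m + 1) * (Rabs m + 1)).
    - apply Rmult_le_compat_r; [lra|apply Rmin_r].
    - right; field; lra. }
  specialize (Q s ltac:(lra)). pose proof (Rle_abs m).
  assert (m * s <= Rabs m * s) by (apply Rmult_le_compat_r; lra).
  nra. }
assert (Hv : v = 0).
{ destruct (D 0) as [A _]; [rewrite Rabs_R0; exact Pd0|]. rewrite H1 in A.
  apply (Z v 1 (Rabs K * d)); [|lra]. intros e He.
  destruct (E r v A e He) as [d1 [P Q]]. exists (Rmin d d1).
  split; [apply Rmin_pos; assumption|]. intros s Hs.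
  pose proof (Rmin_l d d1). pose proof (Rmin_r d d1).
  specialize (Q s ltac:(lra)). specialize (HK s ltac:(lra)).
  rewrite Hr0 in Q.
  assert (Hm : Rabs (s * v) <= Rabs (r s) + e * s).
  { replace (s * v) with (r s - (r s - 0 - s * v)) by ring.
    eapply Rle_trans; [apply Rabs_triang|]. rewrite Rabs_Ropp. lra. }
  rewrite Rabs_mult, (Rabs_pos_eq s) in Hm by lra.
  apply Rmult_le_reg_l with s; [lra|].
  assert (K * s ^ 3 <= Rabs K * s ^ 3) by (apply Rmult_le_compat_r; [apply pow_le; lra|apply Rle_abs]).
  assert (Rabs K * s * (s * s) <= Rabs K * s * (s * d)).
  { apply Rmult_le_compat_l; [apply Rmult_le_pos; [apply Rabs_pos|lra]|nra]. }
  nra. }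
split; [exact Hv|].
destruct (D 0) as [_ B]; [rewrite Rabs_R0; exact Pd0|]. rewrite H2 in B.
apply (Z w (1 / 2) (Rabs K)); [|lra]. intros e He.
destruct (E r1 w B e He) as [d1 [P Q]]. exists (Rmin (Rmin d d0) d1).
split; [repeat apply Rmin_pos; assumption|]. intros s Hs.
assert (s < d /\ s < d0 /\ s < d1) as [S1 [S2 S3]].
{ pose proof (Rmin_l (Rmin d d0) d1). pose proof (Rmin_r (Rmin d d0) d1).
  pose proof (Rmin_l d d0). pose proof (Rmin_r d d0). lra. }
destruct (MVT_gen (fun t => r t - t ^ 2 / 2 * w) 0 s (fun t => r1 t - t * w)) as [c [Hc Hc']].
{ rewrite Rmin_left, Rmax_right by lra. intros t Ht.
  destruct (D t) as [A _]; [rewrite Rabs_pos_eq; lra|].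
  apply (is_derive_minus (V := R_NormedModule) r (fun t => t ^ 2 / 2 * w) t (r1 t) (t * w) A).
  auto_derive; [exact I|]. field. }
{ rewrite Rmin_left, Rmax_right by lra. intros t Ht.
  destruct (D t) as [A _]; [rewrite Rabs_pos_eq; lra|].
  apply continuity_pt_filterlim.
  apply (continuous_minus (V := R_NormedModule) r (fun t => t ^ 2 / 2 * w)).
  - exact (is_derive_continuous (V := R_NormedModule) r t _ A).
  - apply (ex_derive_continuous (V := R_NormedModule)). auto_derive. exact I. }
rewrite Rmin_left, Rmax_right in Hc by lra.
rewrite Hr0 in Hc'.
assert (Hb : Rabs (r1 c - c * w) <= e * s).
{ destruct (Req_dec c 0) as [->|Hc0].
  - rewrite H1, Hv. replace (0 - 0 * w) with 0 by ring. rewrite Rabs_R0. nra.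
  - specialize (Q c ltac:(lra)). rewrite H1, Hv, Rminus_0_r in Q. nra. }
specialize (HK s ltac:(lra)).
assert (Hm : Rabs (s ^ 2 / 2 * w) <= Rabs (r s) + e * s * s).
{ replace (s ^ 2 / 2 * w) with (r s - (r1 c - c * w) * s) by lra.
  eapply Rle_trans; [apply Rabs_triang|]. rewrite Rabs_Ropp, Rabs_mult, (Rabs_pos_eq s) by lra.
  apply Rplus_le_compat_l. apply Rmult_le_compat_r; lra. }
rewrite Rabs_mult, (Rabs_pos_eq (s ^ 2 / 2)) in Hm by (pose proof (pow2_ge_0 s); lra).
assert (K * s ^ 3 <= Rabs K * s ^ 3) by (apply Rmult_le_compat_r; [apply pow_le; lra|apply Rle_abs]).
apply Rmult_le_reg_l with (s ^ 2); [apply pow_lt; lra|]. nra.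
Qed.

Lemma jet2_Re (u : R -> C) (a v w : C) :
  has_jet2 (V := CR) u a v w -> has_jet2 (V := R_NormedModule) (fun t => Re (u t)) (Re a) (Re v) (Re w).
Proof.
intros [u1 [u2 [H [H0 [H1 H2]]]]]. exists (fun t => Re (u1 t)), (fun t => Re (u2 t)).
rewrite H0, H1, H2. split; [|auto]. revert H. apply filter_imp. intros t.
rewrite !is_derive_C, continuous_C. tauto.
Qed.
Arguments jet2_Re {u a v w}.

Lemma jet2_Im (u : R -> C) (a v w : C) :
  has_jet2 (V := CR) u a v w -> has_jet2 (V := R_NormedModule) (fun t => Im (u t)) (Im a) (Im v) (Im w).
Proof.
intros [u1 [u2 [H [H0 [H1 H2]]]]]. exists (fun t => Im (u1 t)), (fun t => Im (u2 t)).
rewrite H0, H1, H2. split; [|auto]. revert H. apply filter_imp. intros t.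
rewrite !is_derive_C, continuous_C. tauto.
Qed.
Arguments jet2_Im {u a v w}.

Lemma Im_le_Cmod (c : C) : Rabs (Im c) <= Cmod c.
Proof. eapply Rle_trans; [|apply Rmax_Cmod]. apply Rmax_r. Qed.

Lemma flat_jet2 (u : R -> C) (a v w : C) K d :
  has_jet2 (V := CR) u a v w -> 0 < d ->
  (forall t, 0 <= t < d -> Cmod (u t) <= K * t ^ 3) -> a = 0%C /\ v = 0%C /\ w = 0%C.
Proof.
intros H Hd HK.
destruct (flat_jet2_R _ _ _ _ K d (jet2_Re H) Hd) as [A1 [A2 A3]].
{ intros t Ht. eapply Rle_trans; [apply re_le_Cmod|apply HK, Ht]. }
destruct (flat_jet2_R _ _ _ _ K d (jet2_Im H) Hd) as [B1 [B2 B3]].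
{ intros t Ht. eapply Rle_trans; [apply Im_le_Cmod|apply HK, Ht]. }
destruct a, v, w; simpl in *; subst; auto.
Qed.

Lemma jet2_unique_C (u : R -> C) (a v w a' v' w' : C) :
  has_jet2 (V := CR) u a v w -> has_jet2 (V := CR) u a' v' w' -> a = a' /\ v = v' /\ w = w'.
Proof.
intros H H'. pose proof (jet2_plus H (jet2_scal (-(1))%C H')) as D.
apply (flat_jet2 _ _ _ _ 0 1) in D; [|lra|].
- destruct D as [D1 [D2 D3]].
  split; [|split]; apply Csub_eq0; [rewrite <- D1|rewrite <- D2|rewrite <- D3]; ring.
- intros t _. replace (u t + - (1) * u t)%C with (RtoC 0) by ring. rewrite Cmod_0. lra.
Qed.
Arguments jet2_unique_C {u a v w a' v' w'}.

Lemma jet2_unique (g : R -> C2) a v w a' v' w' :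
  has_jet2 g a v w -> has_jet2 g a' v' w' -> a = a' /\ v = v' /\ w = w'.
Proof.
rewrite !jet2_C2. intros [H1 H2] [K1 K2].
destruct (jet2_unique_C H1 K1) as [A1 [A2 A3]].
destruct (jet2_unique_C H2 K2) as [B1 [B2 B3]].
destruct a, v, w, a', v', w'; simpl in *; subst; auto.
Qed.
Arguments jet2_unique {g a v w a' v' w'}.

Definition holomorphic_map_at (phi : C2 -> C2) (q : C2) : Prop :=
  holomorphic_at (fun a => fst (phi a)) q /\ holomorphic_at (fun a => snd (phi a)) q.

Lemma jet1_along f q (D1 D2 : C2 -> C) : holomorphic_at D1 q -> holomorphic_at D2 q ->
  locally q (fun a => forall (g : R -> C2) t l, g t = a -> is_derive g t l ->
    is_derive (V := CR) (fun s => f (g s)) t (fst l * D1 a + snd l * D2 a)%C) ->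
  forall (g : R -> C2) v, has_jet1 g q v ->
  has_jet1 (V := CR) (fun t => f (g t)) (f q) (fst v * D1 q + snd v * D2 q)%C.
Proof.
intros H1 H2 HL g v Hg.
assert (C1 : forall D, holomorphic_at D q -> locally 0 (fun t => continuous (U := CR) (fun s => D (g s)) t)).
{ intros D HD. destruct (holomorphic_along D q HD) as [E1 [E2 [_ [_ HE]]]].
  pose proof Hg as [k1 [G _]].
  apply filter_imp with (2 := filter_and _ _ (jet1_near Hg HE) G).
  intros t [A [B _]].
  exact (is_derive_continuous (V := CR) _ t _ (A g t _ eq_refl B)). }
pose proof Hg as [g1 [G [G0 G1]]].
exists (fun t => (fst (g1 t) * D1 (g t) + snd (g1 t) * D2 (g t))%C).
split; [|rewrite G0, G1; auto].
apply filter_imp with (2 := filter_and _ _ (filter_and _ _ (jet1_near Hg HL) G)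
   (filter_and _ _ (C1 D1 H1) (C1 D2 H2))).
intros t [[A [B B']] [E1 E2]]. split.
- apply A; [reflexivity|exact B].
- apply continuous_C2 in B'. apply continuous_Cplus; apply continuous_Cmult; tauto.
Qed.

(** The derivatives of [f] along the curve are given by [holomorphic_along], applied
    first to [f] and then to its partial derivatives. Since the result only involves the jet
    of the curve, holomorphic maps act on jets. *)
Lemma jet_holomorphic f q : holomorphic_at f q ->
  exists D1 D2 : C, exists Q : C2 -> C,
  (forall (g : R -> C2) v, has_jet1 g q v ->
    has_jet1 (V := CR) (fun t => f (g t)) (f q) (fst v * D1 + snd v * D2)%C) /\
  forall (g : R -> C2) v w, has_jet2 g q v w ->
    has_jet2 (V := CR) (fun t => f (g t)) (f q) (fst v * D1 + snd v * D2)%C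
      (fst w * D1 + snd w * D2 + Q v)%C.
Proof.
intros Hf. destruct (holomorphic_along f q Hf) as [D1 [D2 [H1 [H2 HL]]]].
destruct (holomorphic_along D1 q H1) as [D11 [D12 [H11 [H12 HL1]]]].
destruct (holomorphic_along D2 q H2) as [D21 [D22 [H21 [H22 HL2]]]].
pose proof (jet1_along D1 q D11 D12 H11 H12 HL1) as HE1.
pose proof (jet1_along D2 q D21 D22 H21 H22 HL2) as HE2.
exists (D1 q), (D2 q), (fun v => (fst v * (fst v * D11 q + snd v * D12 q) + snd v * (fst v * D21 q + snd v * D22 q))%C).
split; [exact (jet1_along f q D1 D2 H1 H2 HL)|].
intros g v w Hg. pose proof (jet2_is_jet1 Hg) as Hg1.
apply has_jet2_jet1 in Hg. destruct Hg as [g1 [G [G0 G1]]].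
apply has_jet2_jet1.
exists (fun t => (fst (g1 t) * D1 (g t) + snd (g1 t) * D2 (g t))%C).
split; [|split; [rewrite G0; reflexivity|]].
- apply filter_imp with (2 := filter_and _ _ (jet1_near Hg1 HL) G).
  intros t [A B]. apply A; [reflexivity|exact B].
- apply jet1_C2 in G1. destruct G1 as [G1 G2].
  pose proof (jet1_plus (jet1_mult G1 (HE1 g v Hg1)) (jet1_mult G2 (HE2 g v Hg1))) as R.
  refine (eq_ind _ (fun z : C => has_jet1 (V := CR) _ _ z) R _ _). cbv beta.
  destruct v as [v1 v2], w as [w1 w2]. simpl. ring.
Qed.

(** * The weighted identities and their consequence *)

Lemma re_minus a b : Re (a - b)%C = Re a - Re b. Proof. reflexivity. Qed.
Lemma im_minus a b : Im (a - b)%C = Im a - Im b. Proof. reflexivity. Qed.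
Lemma re_Ci : Re Ci = 0. Proof. reflexivity. Qed.
Lemma im_Ci : Im Ci = 1. Proof. reflexivity. Qed.

(** Goes over to real and imaginary parts. *)
Ltac Ccomp :=
  unfold Re, Im in *; cbn [fst snd Cplus Cmult Cminus Copp Cconj RtoC Ci] in *.

Lemma C_eq (a b : C) : Re a = Re b -> Im a = Im b -> a = b.
Proof. destruct a, b; simpl; intros -> ->; reflexivity. Qed.

Lemma Czero_comp (a : C) : a = 0%C -> Re a = 0 /\ Im a = 0.
Proof. intros ->. split; reflexivity. Qed.

(** In this lemma and the next three, a real polynomial in [z], [zbar], [t], homogeneous
    for the weights 1, 1, 2, is written as a real part. The linear equations given by its values at
    a few points imply the stated vanishings. *)
Lemma form2_zero (A B D : C) :
  (forall (z : C) (t : R), Re (A * (z * z) + B * (z * Cconj z) + RtoC t * D)%C = 0) ->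
  A = 0%C /\ Re B = 0 /\ Re D = 0.
Proof.
intros H.
pose proof (H (1, 0) 0). pose proof (H (0, 1) 0). pose proof (H (1, 1) 0). pose proof (H (0, 0) 1).
clear H. Ccomp.
split; [apply C_eq; Ccomp; lra|split; lra].
Qed.

Lemma form3_zero (A B D : C) :
  (forall (z : C) (t : R), Re (A * (z * z * z) + B * (z * z * Cconj z) + RtoC t * (D * z))%C = 0) ->
  A = 0%C /\ B = 0%C /\ D = 0%C.
Proof.
intros H.
pose proof (H (1, 0) 0). pose proof (H (0, 1) 0). pose proof (H (1, 1) 0). pose proof (H (1, -1) 0).
pose proof (H (1, 0) 1). pose proof (H (0, 1) 1).
clear H. Ccomp.
split; [|split]; apply C_eq; Ccomp; lra.
Qed.

Lemma form4_zero (A B K D E F : C) :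
  (forall (z : C) (t : R), Re (A * (z * z * z * z) + B * (z * z * z * Cconj z)
     + K * (z * z * Cconj z * Cconj z)
     + RtoC t * (D * (z * z) + E * (z * Cconj z)) + RtoC (t * t) * F)%C = 0) ->
  B = 0%C /\ Re K = 0 /\ D = 0%C /\ Re E = 0 /\ Re F = 0.
Proof.
intros H.
pose proof (H (0, 0) 1) as H0.
pose proof (H (1, 0) 0) as H1. pose proof (H (0, 1) 0) as H2.
pose proof (H (1, 1) 0) as H3. pose proof (H (1, -1) 0) as H4.
pose proof (H (2, 1) 0) as H5. pose proof (H (1, 2) 0) as H6.
pose proof (H (1, 0) 1) as H7. pose proof (H (0, 1) 1) as H8.
pose proof (H (1, 1) 1) as H9.
clear H. Ccomp.
split; [apply C_eq; Ccomp; lra|]. split; [lra|].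
split; [apply C_eq; Ccomp; lra|]. split; lra.
Qed.

Lemma form5_zero (A B K D E F : C) :
  (forall (z : C) (t : R), Re (A * (z * z * z * z * z) + B * (z * z * z * z * Cconj z)
     + K * (z * z * z * Cconj z * Cconj z)
     + RtoC t * (D * (z * z * z) + E * (z * z * Cconj z)) + RtoC (t * t) * (F * z))%C = 0) ->
  K = 0%C /\ E = 0%C /\ F = 0%C.
Proof.
intros H.
assert (K = 0%C) as ->.
{ pose proof (H (1, 0) 0) as H1. pose proof (H (0, 1) 0) as H2.
  pose proof (H (1, 1) 0) as H3. pose proof (H (1, -1) 0) as H4.
  pose proof (H (2, 1) 0) as H5. pose proof (H (1, 2) 0) as H6.
  pose proof (H (2, -1) 0) as H7. pose proof (H (1, -2) 0) as H8.
  clear H. Ccomp. apply C_eq; Ccomp; lra. }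
split; [reflexivity|].
destruct (form3_zero D E 0%C) as [_ [-> _]].
{ intros z t. pose proof (H z 1) as H1. pose proof (H z (-1)) as H2.
  clear H. Ccomp. lra. }
split; [reflexivity|].
pose proof (H (1, 0) 1) as H1. pose proof (H (1, 0) (-1)) as H2. pose proof (H (1, 0) 0) as H3.
pose proof (H (0, 1) 1) as H4. pose proof (H (0, 1) (-1)) as H5. pose proof (H (0, 1) 0) as H6.
clear H. Ccomp. apply C_eq; Ccomp; lra.
Qed.

(** The parts of weights 1 to 5 of a holomorphic function of [z], of weight 1, and [w],
    of weight 2, from its Taylor coefficients. *)
Definition part1 (c10 z w : C) := (c10 * z)%C.
Definition part2 (c01 c20 z w : C) := (c01 * w + c20 * (z * z))%C.
Definition part3 (c11 c30 z w : C) := (c11 * (z * w) + c30 * (z * z * z))%C.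
Definition part4 (c02 c21 c40 z w : C) :=
  (c02 * (w * w) + c21 * (z * z * w) + c40 * (z * z * z * z))%C.
Definition part5 (c12 c31 c50 z w : C) :=
  (c12 * (z * w * w) + c31 * (z * z * z * w) + c50 * (z * z * z * z * z))%C.

(** The point of the quadric [Im w = |z|^2] above [z] with [Re w = t]. *)
Definition quadric (z : C) (t : R) : C := (RtoC t + Ci * (z * Cconj z))%C.

Section WeightedIdentities.
Context (l a b f11 f30 f02 f21 f40 : C).
Context (g10 g01 g20 g11 g30 g02 g21 g40 g12 g31 g50 : C).

Context (H1 : forall z t, Im (part1 g10 z (quadric z t)) = 0).
Context (H2 : forall z t, let w := quadric z t in
  Im (part2 g01 g20 z w) = Re (part1 l z w * Cconj (part1 l z w))%C).
Context (H3 : forall z t, let w := quadric z t in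
  Im (part3 g11 g30 z w) = Re (part1 l z w * Cconj (part2 a b z w) + part2 a b z w * Cconj (part1 l z w))%C).
Context (H4 : forall z t, let w := quadric z t in
  Im (part4 g02 g21 g40 z w) = Re (part1 l z w * Cconj (part3 f11 f30 z w)
    + part2 a b z w * Cconj (part2 a b z w) + part3 f11 f30 z w * Cconj (part1 l z w))%C).
Context (H5 : forall z t, let w := quadric z t in
  Im (part5 g12 g31 g50 z w) = Re (part1 l z w * Cconj (part4 f02 f21 f40 z w) + part2 a b z w * Cconj (part3 f11 f30 z w)
    + part3 f11 f30 z w * Cconj (part2 a b z w) + part4 f02 f21 f40 z w * Cconj (part1 l z w))%C).

Lemma weight1_coefs : g10 = 0%C.
Proof.
pose proof (H1 (1, 0) 0) as A. pose proof (H1 (0, 1) 0) as B. clear -A B.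
unfold part1 in *. Ccomp. apply C_eq; Ccomp; lra.
Qed.

(** Here, as in the higher weights, the identity is written as the vanishing of the real
    part of a polynomial in [z], [zbar], [t], and its coefficients are compared. *)
Lemma weight2_coefs : g20 = 0%C /\ g01 = (l * Cconj l)%C.
Proof.
destruct (form2_zero (- Ci * g20)%C (g01 - l * Cconj l)%C (- Ci * g01)%C) as [A [B D]].
{ intros z t. specialize (H2 z t). cbv zeta in H2.
  apply Rminus_diag_eq in H2. rewrite <- H2. clear.
  unfold part2, part1, quadric.
  Ccomp. ring. }
clear -A B D. split.
- replace g20 with (Ci * (- Ci * g20))%C; [rewrite A; ring|].
  apply C_eq; Ccomp; ring.
- apply C_eq; Ccomp; lra.
Qed.

Lemma weight3_coefs : g11 = (2 * Ci * l * Cconj a)%C /\ (Cconj l * b)%C = (2 * Ci * l * Cconj a)%C.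
Proof.
destruct (form3_zero (- Ci * g30)%C (g11 + 2 * Ci * l * Cconj a - 2 * (Cconj l * b))%C
  (- Ci * g11 - 2 * l * Cconj a)%C) as [_ [B D]].
{ intros z t. specialize (H3 z t). cbv zeta in H3.
  apply Rminus_diag_eq in H3. rewrite <- H3. clear.
  unfold part3, part1, part2, quadric.
  Ccomp. ring. }
clear -B D. apply Czero_comp in B. apply Czero_comp in D. Ccomp.
split; apply C_eq; Ccomp; lra.
Qed.

Lemma weight4_coefs :
  Im g02 = Re (a * Cconj a)%C /\ g21 = (2 * Ci * b * Cconj a)%C /\
  Re g02 = Re (Cconj l * f11)%C /\ (Cconj l * f30)%C = (2 * Ci * b * Cconj a)%C /\
  2 * Im (Cconj l * f11)%C = 2 * Re (a * Cconj a)%C + Re (b * Cconj b)%C.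
Proof.
destruct (form4_zero (- Ci * g40)%C (g21 + 2 * Ci * b * Cconj a - 2 * (Cconj l * f30))%C
  (Ci * g02 - a * Cconj a - b * Cconj b - 2 * Ci * (Cconj l * f11))%C
  (- Ci * g21 - 2 * b * Cconj a)%C (2 * g02 - 2 * (Cconj l * f11))%C
  (- Ci * g02 - a * Cconj a)%C) as [B [K [D [E F]]]].
{ intros z t. specialize (H4 z t). cbv zeta in H4.
  apply Rminus_diag_eq in H4. rewrite <- H4. clear.
  unfold part4, part1, part2, part3, quadric.
  Ccomp. ring. }
clear -B K D E F. apply Czero_comp in B. apply Czero_comp in D. Ccomp.
split; [lra|]. split; [apply C_eq; Ccomp; lra|]. split; [lra|].
split; [apply C_eq; Ccomp; lra|lra].
Qed.

(** The coefficients of [t^2 z], [t z^2 zbar] and [z^3 zbar^2] give three equations in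
    [g12], [f21] and [f02]; eliminating the first two leaves [f02]. *)
Lemma weight5_coefs :
  (4 * (l * Cconj f02))%C = (Cconj b * f30 - 2 * Ci * (b * Cconj f11))%C.
Proof.
destruct (form5_zero (- Ci * g50)%C (g31 - 2 * (Cconj l * f40) + 2 * Ci * (Cconj a * f30))%C
  (Ci * g12 - 2 * (Ci * (Cconj l * f21) - l * Cconj f02 + Cconj a * f11 + Cconj b * f30
     - Ci * (b * Cconj f11)))%C
  (- Ci * g31 - 2 * (Cconj a * f30))%C (2 * (g12 - Cconj l * f21 + 2 * Ci * (l * Cconj f02) - b * Cconj f11))%C
  (- Ci * g12 - 2 * (l * Cconj f02) - 2 * (Cconj a * f11))%C) as [K [E F]].
{ intros z t. specialize (H5 z t). cbv zeta in H5.
  apply Rminus_diag_eq in H5. rewrite <- H5. clear.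
  unfold part5, part1, part2, part3, part4, quadric.
  Ccomp. ring. }
clear -K E F. apply Czero_comp in K. apply Czero_comp in E. apply Czero_comp in F. Ccomp.
apply C_eq; Ccomp; lra.
Qed.

End WeightedIdentities.

Lemma Cconj_Ci : Cconj Ci = (- Ci)%C.
Proof. unfold Cconj, Ci, Copp; simpl. f_equal; ring. Qed.

Lemma Cconj_R r : Cconj (RtoC r) = RtoC r.
Proof. unfold Cconj, RtoC; simpl. f_equal; ring. Qed.

Lemma Ci2 : (Ci * Ci)%C = (-(1))%C.
Proof. unfold Ci, Cmult, Copp, RtoC; simpl. f_equal; ring. Qed.

Lemma mult_conj_zero (x : C) : Re (x * Cconj x)%C = 0 -> x = 0%C.
Proof.
intros H.
rewrite re_mult, re_conj, im_conj in H.
apply C_eq; simpl; nra.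
Qed.

(** The expression is the determinant of the linear part of the map [(f, g)] and of its
    quadratic part, at the vector [(x, y)]. It is a cubic form without [x^3] term. The three other
    coefficients vanish by the identities of weights 3 to 5. If [l = 0], the
    identity of weight 4 gives [2 |a|^2 + |b|^2 = 0], so that [a = 0] and nothing is left. *)
Lemma projective_2jet l a b f11 f30 f02 f21 f40 g10 g01 g20 g11 g30 g02 g21 g40 g12 g31 g50 :
  (forall z t, Im (part1 g10 z (quadric z t)) = 0) ->
  (forall z t, let w := quadric z t in
    Im (part2 g01 g20 z w) = Re (part1 l z w * Cconj (part1 l z w))%C) ->
  (forall z t, let w := quadric z t in
    Im (part3 g11 g30 z w) = Re (part1 l z w * Cconj (part2 a b z w) + part2 a b z w * Cconj (part1 l z w))%C) ->
  (forall z t, let w := quadric z t in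
    Im (part4 g02 g21 g40 z w) = Re (part1 l z w * Cconj (part3 f11 f30 z w)
      + part2 a b z w * Cconj (part2 a b z w) + part3 f11 f30 z w * Cconj (part1 l z w))%C) ->
  (forall z t, let w := quadric z t in
    Im (part5 g12 g31 g50 z w) = Re (part1 l z w * Cconj (part4 f02 f21 f40 z w)
      + part2 a b z w * Cconj (part3 f11 f30 z w)
      + part3 f11 f30 z w * Cconj (part2 a b z w) + part4 f02 f21 f40 z w * Cconj (part1 l z w))%C) ->
  forall x y : C,
  ((l * x + a * y) * (g20 * (x * x) + g11 * (x * y) + g02 * (y * y))
   - (g10 * x + g01 * y) * (b * (x * x) + f11 * (x * y) + f02 * (y * y)))%C = 0%C.
Proof.
intros H1 H2 H3 H4 H5 x y.
pose proof (weight1_coefs _ H1) as W1.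
pose proof (weight2_coefs _ _ _ H2) as [W2 W2'].
pose proof (weight3_coefs _ _ _ _ _ H3) as [W3 W3'].
pose proof (weight4_coefs _ _ _ _ _ _ _ _ H4) as [W4a [W4b [W4c [W4d W4e]]]].
pose proof (weight5_coefs _ _ _ _ _ _ _ _ _ _ _ H5) as W5.
clear H1 H2 H3 H4 H5. rewrite W1, W2, W2', W3.
destruct (Ceq_dec l 0) as [Hl|Hl].
- rewrite Hl in *. assert (Ha : a = 0%C).
  { apply mult_conj_zero. rewrite !re_mult, !re_conj, !im_conj in *.
    rewrite im_mult, re_conj, im_conj in W4e. simpl in W4e. nra. }
  rewrite Ha. ring.
(* The modulus of the second identity of weight 3. *)
- assert (Hb : Re (b * Cconj b)%C = 4 * Re (a * Cconj a)%C).
  { assert (E : (l * Cconj l * (b * Cconj b))%C = (l * Cconj l * (4 * (a * Cconj a)))%C).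
    { transitivity ((Cconj l * b) * Cconj (Cconj l * b))%C.
      - rewrite Cmult_conj, Cconj_conj. ring.
      - rewrite W3', !Cmult_conj, Cconj_conj, Cconj_Ci, Cconj_R.
        transitivity (- (Ci * Ci) * (4 * (l * Cconj l * (a * Cconj a))))%C; [ring|].
        rewrite Ci2. ring. }
    assert (Hll : (l * Cconj l)%C <> 0%C).
    { intros H. apply Hl, mult_conj_zero. rewrite H. reflexivity. }
    assert (E' : (b * Cconj b)%C = (4 * (a * Cconj a))%C).
    { transitivity (/ (l * Cconj l) * (l * Cconj l * (b * Cconj b)))%C; [field|rewrite E; field];
      split; intros H; apply Hll; rewrite H; ring. }
    rewrite E'. rewrite !re_mult, !re_conj, !im_conj. simpl. ring. }
  (* Real and imaginary parts are given by weight 4. *)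
  assert (K1 : (Cconj l * f11)%C = (g02 + 2 * Ci * (a * Cconj a))%C).
  { apply C_eq.
    - rewrite <- W4c. rewrite re_plus, !re_mult, !im_mult, !re_conj, !im_conj. simpl. ring.
    - rewrite im_plus, W4a.
      replace (Im (2 * Ci * (a * Cconj a))%C) with (2 * Re (a * Cconj a)%C).
      + lra.
      + rewrite !re_mult, !im_mult, !re_mult, !re_conj, !im_conj. simpl. ring. }
  (* Weight 5, after conjugation and multiplication by [l / 4]. *)
  assert (K2 : (a * g02)%C = (l * Cconj l * f02)%C).
  { assert (E : (Cconj l * f02)%C = ((b * Cconj f30 + 2 * Ci * (Cconj b * f11)) / 4)%C).
    { apply (f_equal Cconj) in W5.
      rewrite Cminus_conj, !Cmult_conj, !Cconj_conj, !Cconj_R, Cconj_Ci in W5.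
      transitivity (4 * (Cconj l * f02) / 4)%C; [field|rewrite W5; field]. }
    apply (f_equal Cconj) in W4d. rewrite !Cmult_conj, !Cconj_conj, Cconj_R, Cconj_Ci in W4d.
    pose proof W3' as W3c.
    apply (f_equal Cconj) in W3c. rewrite !Cmult_conj, !Cconj_conj, Cconj_R, Cconj_Ci in W3c.
    assert (Eb : (b * Cconj b)%C = (4 * (a * Cconj a))%C).
    { apply C_eq; [rewrite Hb|]; rewrite ?re_mult, ?im_mult, ?re_mult, ?re_conj, ?im_conj; simpl; ring. }
    transitivity (l * (Cconj l * f02))%C; [rewrite E|ring].
    transitivity ((b * (l * Cconj f30) + 2 * Ci * ((l * Cconj b) * f11)) / 4)%C; [|field].
    rewrite W4d, W3c.
    transitivity ((2 * - Ci * a * (b * Cconj b) - 4 * (Ci * Ci) * a * (Cconj l * f11)) / 4)%C; [|field].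
    rewrite Eb, K1, Ci2. field. }
  transitivity (y * y * x * (l * (g02 + 2 * Ci * (a * Cconj a) - Cconj l * f11))
     + y * y * y * (a * g02 - l * Cconj l * f02)
     + x * x * y * l * (2 * Ci * l * Cconj a - Cconj l * b))%C; [ring|].
  rewrite K1, K2, W3'. ring.
Qed.

(** * The remainder of a normal form *)

Fixpoint multiweight (ws al : list nat) : nat :=
  match ws, al with
  | w :: ws', j :: al' => (w * j + multiweight ws' al')%nat
  | _, _ => 0%nat
  end.

Inductive scaled (e : R) : list nat -> list R -> list R -> Prop :=
| scaled_nil : scaled e nil nil nil
| scaled_cons : forall w x y ws X Y,
    0 <= y -> 0 <= x <= e ^ w * y -> scaled e ws X Y -> scaled e (w :: ws) (x :: X) (y :: Y).

Lemma mpsum_abs_le {K : AbsRing} n X : forall c : list nat -> K,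
  abs (mpsum n c X) <= mpsum (K := R_AbsRing) n (fun al => abs (c al)) (map abs X).
Proof.
induction X as [|x X IH]; intros c; [apply Rle_refl|].
cbn [mpsum map].
eapply Rle_trans; [apply (norm_sum_n_m (K := K) (V := AbsRing_NormedModule K))|].
apply rsum_le. intros j _.
eapply Rle_trans; [apply abs_mult|].
change (abs (pow_n x j) * abs (mpsum n (fun al => c (j :: al)) X) <=
  pow_n (abs x) j * mpsum (K := R_AbsRing) n (fun al => abs (c (j :: al))) (map abs X)).
rewrite pow_n_pow.
apply Rmult_le_compat; try apply abs_ge_0; [apply abs_pow_n|apply IH].
Qed.

Lemma mpsum_cons_R n (c : list nat -> R) x X :
  mpsum (K := R_AbsRing) n c (x :: X) =
  sum_n (fun j => x ^ j * mpsum (K := R_AbsRing) n (fun al => c (j :: al)) X) n :> R.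
Proof.
cbn [mpsum]. apply sum_n_ext. intros j. rewrite <- pow_n_pow. reflexivity.
Qed.

Lemma mpsum_nonneg n Y : forall c : list nat -> R,
  (forall al, 0 <= c al) -> List.Forall (fun y => 0 <= y) Y -> 0 <= mpsum (K := R_AbsRing) n c Y.
Proof.
induction Y as [|y Y IH]; intros c Hc HY; [apply Hc|].
rewrite mpsum_cons_R. inversion HY; subst. apply rsum_nonneg. intros j.
apply Rmult_le_pos; [apply pow_le; assumption|apply IH; auto].
Qed.

(** Each monomial is multiplied by [e] to a power at least its weight. *)
Lemma mpsum_scaled e n ws X Y : 0 <= e <= 1 -> scaled e ws X Y ->
  forall m (c : list nat -> R), (forall al, 0 <= c al) ->
  (forall al, length al = length ws -> (multiweight ws al < m)%nat -> c al = 0) ->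
  mpsum (K := R_AbsRing) n c X <= e ^ m * mpsum (K := R_AbsRing) n c Y.
Proof.
intros He HS. induction HS as [|w x y ws X Y Hy Hx HS IH]; intros m c Hc Hm.
- simpl. destruct m as [|m].
  + simpl. lra.
  + rewrite (Hm nil); [lra|reflexivity|simpl; lia].
- rewrite !mpsum_cons_R, <- rsum_scal. apply rsum_le. intros j _.
  assert (HY : List.Forall (fun y => 0 <= y) Y).
  { clear -HS. induction HS; constructor; assumption. }
  specialize (IH (m - w * j)%nat (fun al => c (j :: al)) (fun al => Hc _)).
  assert (IH' : mpsum (K := R_AbsRing) n (fun al => c (j :: al)) X <=
    e ^ (m - w * j) * mpsum (K := R_AbsRing) n (fun al => c (j :: al)) Y).
  { apply IH. intros al Hal Hlt. apply Hm; [simpl; congruence|simpl; lia]. }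
  pose proof (mpsum_nonneg n Y (fun al => c (j :: al)) (fun al => Hc _) HY) as HP.
  set (SX := mpsum n _ X) in *. set (SY := mpsum n _ Y) in *.
  assert (Hxj : x ^ j <= e ^ (w * j) * y ^ j).
  { rewrite pow_mult, <- Rpow_mult_distr. apply pow_incr. exact Hx. }
  assert (0 <= y ^ j) by (apply pow_le; exact Hy).
  assert (0 <= e ^ (m - w * j)) by (apply pow_le; lra).
  apply Rle_trans with (x ^ j * (e ^ (m - w * j) * SY)).
  { apply Rmult_le_compat_l; [apply pow_le; lra|exact IH']. }
  apply Rle_trans with (e ^ (w * j) * y ^ j * (e ^ (m - w * j) * SY)).
  { apply Rmult_le_compat_r; [apply Rmult_le_pos; assumption|exact Hxj]. }
  replace (e ^ (w * j) * y ^ j * (e ^ (m - w * j) * SY)) with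
    (e ^ (w * j + (m - w * j)) * (y ^ j * SY)) by (rewrite pow_add; ring).
  apply Rmult_le_compat_r; [apply Rmult_le_pos; assumption|].
  replace (w * j + (m - w * j))%nat with (m + (w * j - m))%nat by lia.
  rewrite pow_add. rewrite <- (Rmult_1_r (e ^ m)) at 2.
  apply Rmult_le_compat_l; [apply pow_le; lra|].
  rewrite <- (pow1 (w * j - m)). apply pow_incr. exact He.
Qed.

Lemma filterlim_Cmod_le (u : nat -> C) (l : C) B :
  (forall n, Cmod (u n) <= B) ->
  filterlim u eventually (locally (T := AbsRing_UniformSpace C_AbsRing) l) -> Cmod l <= B.
Proof.
intros HB Hl. apply le_epsilon. intros e He.
destruct (proj1 (filterlim_locally (U := AbsRing_UniformSpace C_AbsRing) _ _) Hl (mkposreal _ He)) as [N HN].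
specialize (HN N (Nat.le_refl _)). change (Cmod (u N - l)%C < e) in HN.
replace l with (u N + (l - u N))%C by ring.
eapply Rle_trans; [apply Cmod_triangle|]. rewrite (Cmod_sub_sym l). specialize (HB N). lra.
Qed.

(** The size [|z|^2 + |u|] has weight 2, so its cube has weight 6. *)
Definition weight6_remainder (E : C -> R -> R) : Prop :=
  exists K d, 0 < d /\ forall z u, Cmod z < d -> Rabs u < d ->
    Rabs (E z u) <= K * (Cmod z ^ 2 + Rabs u) ^ 3.

(** The series converges absolutely at some [(r, r, r^2)]. A point of weighted size [e]
    times smaller then gives terms at least [e^6] times smaller. *)
Lemma normal_form_remainder c E d :
  (forall j k l : nat, (j + k + 2 * l < 6)%nat -> c [j; k; l] = RtoC 0) -> 0 < d ->
  (forall z u, Cmod z < d -> Rabs u < d ->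
    is_mpseries (K := C_AbsRing) c [z; Cconj z; RtoC u] (RtoC (E z u))) ->
  weight6_remainder E.
Proof.
intros Hc Hd HE.
set (r := Rmin 1 (d / 2)).
assert (Hr : 0 < r) by (apply Rmin_pos; lra).
assert (Hr1 : r <= 1) by apply Rmin_l.
assert (Hrd : r <= d / 2) by apply Rmin_r.
assert (Hr2 : r ^ 2 <= r) by nra.
assert (HB : exists B, forall n,
  mpsum (K := R_AbsRing) n (fun al => abs (c al)) [r; r; r ^ 2] <= B).
{ destruct (HE (RtoC r) (r ^ 2)) as [[B HB] _].
  - rewrite Cmod_R, Rabs_pos_eq; lra.
  - rewrite Rabs_pos_eq; [lra|apply pow2_ge_0].
  - exists B. intros n. specialize (HB n). cbn [map] in HB.
    replace (@abs C_AbsRing (RtoC r)) with r in HB.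
    2:{ change (r = Cmod (RtoC r)). rewrite Cmod_R, Rabs_pos_eq; lra. }
    replace (@abs C_AbsRing (Cconj (RtoC r))) with r in HB.
    2:{ change (r = Cmod (Cconj (RtoC r))). rewrite Cmod_conj, Cmod_R, Rabs_pos_eq; lra. }
    replace (@abs C_AbsRing (RtoC (r ^ 2))) with (r ^ 2) in HB.
    2:{ change (r ^ 2 = Cmod (RtoC (r ^ 2))). rewrite Cmod_R, Rabs_pos_eq; [reflexivity|apply pow2_ge_0]. }
    exact HB. }
destruct HB as [B HB].
exists (B / r ^ 6), (r ^ 2 / 2). assert (0 < r ^ 2) by (apply pow_lt, Hr).
split; [lra|]. intros z u Hz Hu.
set (s := Cmod z ^ 2 + Rabs u). pose proof (Cmod_ge_0 z). pose proof (Rabs_pos u).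
assert (Hs : 0 <= s) by (unfold s; pose proof (pow2_ge_0 (Cmod z)); lra).
set (e := sqrt s / r).
assert (Her : e * r = sqrt s) by (unfold e; field; lra).
assert (He2 : e ^ 2 * r ^ 2 = s).
{ replace (e ^ 2 * r ^ 2) with ((e * r) * (e * r)) by ring. rewrite Her. apply sqrt_sqrt, Hs. }
assert (He0 : 0 <= e) by (apply Rdiv_le_0_compat; [apply sqrt_pos|exact Hr]).
assert (Hsr : s <= r ^ 2) by (unfold s; nra).
assert (He1 : e <= 1).
{ apply Rmult_le_reg_r with r; [exact Hr|]. rewrite Her, Rmult_1_l.
  rewrite <- (sqrt_pow2 r) by lra. apply sqrt_le_1; lra. }
assert (Hez : Cmod z <= e ^ 1 * r).
{ rewrite pow_1, Her. rewrite <- (sqrt_pow2 (Cmod z)) by assumption.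
  apply sqrt_le_1; [apply pow2_ge_0|exact Hs|unfold s; lra]. }
assert (Heu : Rabs u <= e ^ 2 * r ^ 2) by (rewrite He2; unfold s; pose proof (pow2_ge_0 (Cmod z)); lra).
replace (B / r ^ 6 * s ^ 3) with (e ^ 6 * B) by (rewrite <- He2; field; lra).
rewrite <- Cmod_R.
destruct (HE z u) as [_ Hl]; [lra|lra|].
apply filterlim_Cmod_le with (2 := Hl). intros n.
eapply Rle_trans; [apply (mpsum_abs_le (K := C_AbsRing))|].
eapply Rle_trans.
{ apply mpsum_scaled with (e := e) (ws := [1; 1; 2]%nat) (Y := [r; r; r ^ 2]) (m := 6%nat).
  - lra.
  - cbn [map]. apply scaled_cons; [lra|split; [apply abs_ge_0|exact Hez]|].
    apply scaled_cons; [lra|split; [apply abs_ge_0|]|].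
    { change (Cmod (Cconj z) <= e ^ 1 * r). rewrite Cmod_conj. exact Hez. }
    apply scaled_cons; [lra|split; [apply abs_ge_0|]|apply scaled_nil].
    change (Cmod (RtoC u) <= e ^ 2 * r ^ 2). rewrite Cmod_R. exact Heu.
  - intros al. apply abs_ge_0.
  - intros al Hal Hw. destruct al as [|j [|k [|l [|]]]]; try discriminate.
    rewrite Hc; [exact Cmod_0|]. simpl in Hw. lia. }
apply Rmult_le_compat_l; [apply pow_le; exact He0|apply HB].
Qed.

Lemma fst_sub_zero (x : C) : (x - fst (zero : C2))%C = x.
Proof. change (fst (zero : C2)) with (RtoC 0). ring. Qed.

Lemma snd_sub_zero (x : C) : (x - snd (zero : C2))%C = x.
Proof. change (snd (zero : C2)) with (RtoC 0). ring. Qed.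

(** The last clause will provide smooth curves: on [u = 0] the remainder is the restriction
    of a holomorphic function of two variables to the points [(z, zbar)]. *)
Lemma normal_form_equation N : normal_form N ->
  exists (E : C -> R -> R) d, 0 < d /\ weight6_remainder E /\
  (forall q : C2, Cmod (fst q) < d -> Cmod (snd q) < d ->
    (N q <-> Im (snd q) = Re (fst q * Cconj (fst q))%C + E (fst q) (Re (snd q)))) /\
  exists F : C2 -> C, holomorphic_at F zero /\
    forall z, Cmod z < d -> F (z, Cconj z) = RtoC (E z 0).
Proof.
intros [c [E [Hc HL]]]. apply locally_C2 in HL. destruct HL as [d [Hd HL]].
assert (HE : forall z u, Cmod z < d -> Rabs u < d ->
    is_mpseries (K := C_AbsRing) c [z; Cconj z; RtoC u] (RtoC (E z u))).
{ intros z u Hz Hu. destruct (HL ((z, RtoC u) : C2)) as [H _]; [| |exact H].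
  - rewrite fst_sub_zero. exact Hz.
  - rewrite snd_sub_zero. simpl. rewrite Cmod_R. exact Hu. }
assert (HN : forall q : C2, Cmod (fst q) < d -> Cmod (snd q) < d ->
    (N q <-> Im (snd q) = Re (fst q * Cconj (fst q))%C + E (fst q) (Re (snd q)))).
{ intros q H1 H2. destruct (HL q) as [_ H].
  - rewrite fst_sub_zero. exact H1.
  - rewrite snd_sub_zero. exact H2.
  - rewrite H. split.
    + intros Heq. apply (f_equal Re) in Heq. rewrite re_RtoC, re_plus, re_RtoC in Heq. exact Heq.
    + intros Heq. apply C_eq; rewrite ?re_RtoC, ?im_RtoC, ?re_plus, ?im_plus, ?re_RtoC, ?im_RtoC.
      * exact Heq.
      * rewrite im_mult, re_conj, im_conj. ring. }
exists E, (d / 2). split; [lra|]. split; [apply normal_form_remainder with c d; assumption|].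
split; [intros q A1 A2; apply HN; lra|].
set (a := fun j k => c [j; k; 0%nat]).
assert (Hred : forall n z, mpsum (K := C_AbsRing) n c [z; Cconj z; RtoC 0] = dsum n n (term a z (Cconj z))).
{ intros n z. transitivity (mpsum (K := C_AbsRing) n (fun al => match al with [j; k] => a j k | _ => RtoC 0 end) [z; Cconj z]).
  - cbn [mpsum]. apply csum_ext. intros j _. f_equal. apply csum_ext. intros k _. f_equal.
    change (csum (fun l => (RtoC 0 ^ l * c [j; k; l])%C) n = a j k).
    rewrite (csum_support _ n 0); [|lia|].
    + rewrite csum_0. unfold a. simpl. ring.
    + intros l Hl. destruct l as [|l]; [lia|]. simpl. ring.
  - rewrite mpsum2. apply dsum_ext. intros j k. reflexivity. }
assert (HB : exists B, forall n, rdsum n n (majorant a (d / 2)) <= B).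
{ destruct (polydisc_radius d Hd) as [P1 P2].
  destruct (HE (RtoC (d / 2)) 0) as [[B HB] _]; [exact P1|rewrite Rabs_R0; exact Hd|].
  exists B. intros n. specialize (HB n).
  eapply Rle_trans; [|exact HB]. right.
  unfold rdsum. cbn [map]. rewrite mpsum_cons_R. apply sum_n_ext. intros j.
  rewrite mpsum_cons_R, <- rsum_scal. apply sum_n_ext. intros k.
  rewrite mpsum_cons_R. cbn [mpsum].
  replace (@abs C_AbsRing (RtoC (d / 2))) with (d / 2) by (symmetry; exact P2).
  replace (@abs C_AbsRing (Cconj (RtoC (d / 2)))) with (d / 2).
  2:{ symmetry. change (Cmod (Cconj (RtoC (d / 2))) = d / 2). rewrite Cmod_conj. exact P2. }
  replace (@abs C_AbsRing (RtoC 0)) with 0.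
  2:{ symmetry. exact Cmod_0. }
  replace (sum_n (fun l => 0 ^ l * abs (c [j; k; l])) n) with (Cmod (a j k)).
  - unfold majorant. change (Cmod (a j k) * ((d / 2) ^ j * (d / 2) ^ k) = (d / 2) ^ j * ((d / 2) ^ k * Cmod (a j k))). ring.
  - assert (Hz : forall m, sum_n (fun l => 0 ^ l * abs (c [j; k; l])) m = Cmod (a j k) :> R).
    { induction m as [|m IH].
      - rewrite sum_O, pow_O, Rmult_1_l. reflexivity.
      - rewrite rsum_S, IH, pow_ne_zero, Rmult_0_l by lia. apply Rplus_0_r. }
    symmetry. apply Hz. }
destruct HB as [B HB].
exists (fun b => dtotal (term a (fst b) (snd b))). split.
- apply expands_holomorphic with a (d / 2) B. split; [lra|]. split; [exact HB|].
  intros b _ _. rewrite fst_sub_zero, snd_sub_zero. reflexivity.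
- intros z Hz. symmetry.
  destruct (HE z 0) as [_ Hl]; [lra|rewrite Rabs_R0; exact Hd|].
  apply dconv_filterlim with (majorant a (d / 2)) B; [|exact HB|].
  + intros j k. apply term_le; simpl; rewrite ?Cmod_conj; lra.
  + eapply filterlim_ext; [|exact Hl]. intros n. apply Hred.
Qed.

(** * Orders of vanishing *)

(** [ring] after displaying the type of the equation as [C]. *)
Ltac Cring := match goal with |- @eq _ ?a ?b => change (@eq C a b) end; ring.

(** [s] measures the size of the argument: the norm of a point of C^2, or a parameter. *)
Definition bigO {T : Type} (s : T -> R) (k : nat) (F : T -> C) : Prop :=
  exists K d, 0 <= K /\ 0 < d /\ forall x, s x < d -> Cmod (F x) <= K * s x ^ k.

Section BigO.
Context {T : Type} (s : T -> R) (s_nonneg : forall x, 0 <= s x).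

Lemma bigO_ext k (F G : T -> C) : (forall x, F x = G x) -> bigO s k F -> bigO s k G.
Proof. intros E [K [d [HK [Hd H]]]]. exists K, d. split; [|split]; auto. intros x. rewrite <- E. auto. Qed.

Lemma bigO_ext_near k (F G : T -> C) d : 0 < d -> (forall x, s x < d -> F x = G x) -> bigO s k F -> bigO s k G.
Proof.
intros Hd E [K [d' [HK [Hd' H]]]]. exists K, (Rmin d d'). split; [auto|]. split; [apply Rmin_pos; auto|].
intros x Hx. rewrite <- E; [apply H|]; eapply Rlt_le_trans; [exact Hx|apply Rmin_r|exact Hx|apply Rmin_l].
Qed.

Lemma bigO_plus k F G : bigO s k F -> bigO s k G -> bigO s k (fun x => F x + G x)%C.
Proof.
intros [K [d [HK [Hd H]]]] [K' [d' [HK' [Hd' H']]]].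
exists (K + K'), (Rmin d d'). split; [lra|]. split; [apply Rmin_pos; assumption|].
intros x Hx. eapply Rle_trans; [apply Cmod_triangle|]. rewrite Rmult_plus_distr_r.
apply Rplus_le_compat; [apply H|apply H']; eapply Rlt_le_trans; try exact Hx; [apply Rmin_l|apply Rmin_r].
Qed.

Lemma bigO_mult k l F G : bigO s k F -> bigO s l G -> bigO s (k + l) (fun x => F x * G x)%C.
Proof.
intros [K [d [HK [Hd H]]]] [K' [d' [HK' [Hd' H']]]].
exists (K * K'), (Rmin d d'). split; [nra|]. split; [apply Rmin_pos; assumption|].
intros x Hx. rewrite Cmod_mult.
replace (K * K' * s x ^ (k + l)) with ((K * s x ^ k) * (K' * s x ^ l)) by (rewrite pow_add; ring).
apply Rmult_le_compat; try apply Cmod_ge_0;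
[apply H|apply H']; eapply Rlt_le_trans; try exact Hx; [apply Rmin_l|apply Rmin_r].
Qed.

Lemma bigO_weaken k l F : (l <= k)%nat -> bigO s k F -> bigO s l F.
Proof.
intros Hkl [K [d [HK [Hd H]]]]. exists K, (Rmin d 1). split; [auto|].
split; [apply Rmin_pos; lra|]. intros x Hx.
assert (s x < d) by (eapply Rlt_le_trans; [exact Hx|apply Rmin_l]).
assert (s x < 1) by (eapply Rlt_le_trans; [exact Hx|apply Rmin_r]).
eapply Rle_trans; [apply H; assumption|]. apply Rmult_le_compat_l; [exact HK|].
replace k with (l + (k - l))%nat by lia. rewrite pow_add. rewrite <- (Rmult_1_r (s x ^ l)) at 2.
apply Rmult_le_compat_l; [apply pow_le, s_nonneg|].
rewrite <- (pow1 (k - l)). apply pow_incr. split; [apply s_nonneg|lra].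
Qed.

Lemma bigO_const c : bigO s 0 (fun _ => c).
Proof.
exists (Cmod c), 1. split; [apply Cmod_ge_0|]. split; [lra|]. intros x _. simpl. lra.
Qed.

Lemma bigO_zero k : bigO s k (fun _ => RtoC 0).
Proof.
exists 0, 1. split; [lra|]. split; [lra|]. intros x _. rewrite Cmod_0. lra.
Qed.

Lemma bigO_scal k c F : bigO s k F -> bigO s k (fun x => c * F x)%C.
Proof. intros H. exact (bigO_mult 0 k _ _ (bigO_const c) H). Qed.

Lemma bigO_minus k F G : bigO s k F -> bigO s k G -> bigO s k (fun x => F x - G x)%C.
Proof.
intros H H'. apply (bigO_ext k (fun x => F x + (-(1)) * G x)%C); [intros; ring|].
apply bigO_plus; [exact H|apply bigO_scal, H'].
Qed.

Lemma bigO_pow k F j : bigO s k F -> bigO s (j * k) (fun x => F x ^ j)%C.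
Proof.
intros H. induction j as [|j IH]; [exact (bigO_const (RtoC 1))|].
exact (bigO_mult k (j * k) _ _ H IH).
Qed.

Lemma bigO_csum k n (F : nat -> T -> C) :
  (forall j, bigO s k (F j)) -> bigO s k (fun x => csum (fun j => F j x) n).
Proof.
intros H. induction n as [|n IH].
- apply (bigO_ext k (F 0%nat)); [|apply H]. intros x. rewrite csum_0. reflexivity.
- apply (bigO_ext k (fun x => csum (fun j => F j x) n + F (S n) x)%C).
  + intros x. rewrite csum_S. reflexivity.
  + apply bigO_plus; [exact IH|apply H].
Qed.

Lemma bigO_le k F G : (forall x, Cmod (G x) <= Cmod (F x)) -> bigO s k F -> bigO s k G.
Proof.
intros HG [K [d [HK [Hd H]]]]. exists K, d. split; [auto|]. split; [auto|].
intros x Hx. eapply Rle_trans; [apply HG|apply H, Hx].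
Qed.

Lemma bigO_at_zero k F x : s x = 0 -> bigO s (S k) F -> F x = RtoC 0.
Proof.
intros Hs [K [d [HK [Hd H]]]]. apply Cmod_eq_0. apply Rle_antisym; [|apply Cmod_ge_0].
specialize (H x). rewrite Hs in H. replace 0 with (K * 0 ^ S k) at 1 by (simpl; ring). apply H, Hd.
Qed.

Lemma bigO_comp {T'} (s' : T' -> R) (s'_nonneg : forall x, 0 <= s' x) k (F : T' -> C) (g : T -> T') K0 :
  bigO s' k F -> 0 <= K0 -> (exists d, 0 < d /\ forall x, s x < d -> s' (g x) <= K0 * s x) ->
  bigO s k (fun x => F (g x)).
Proof.
intros [K [d [HK [Hd H]]]] HK0 [d' [Hd' Hg]].
exists (K * K0 ^ k), (Rmin d' (d / (K0 + 1))).
split; [apply Rmult_le_pos; [exact HK|apply pow_le, HK0]|].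
assert (0 < d / (K0 + 1)) by (apply Rdiv_lt_0_compat; lra).
split; [apply Rmin_pos; assumption|].
intros x Hx.
assert (H1 : s x < d') by (eapply Rlt_le_trans; [exact Hx|apply Rmin_l]).
assert (H2 : s x < d / (K0 + 1)) by (eapply Rlt_le_trans; [exact Hx|apply Rmin_r]).
specialize (Hg x H1).
assert (s x * (K0 + 1) < d) by (apply lt_div_succ; lra).
pose proof (s_nonneg x).
eapply Rle_trans; [apply H; lra|].
rewrite Rmult_assoc, <- Rpow_mult_distr. apply Rmult_le_compat_l; [exact HK|].
apply pow_incr. split; [apply s'_nonneg|exact Hg].
Qed.
End BigO.

(** * Taylor polynomials of composed maps *)

Definition size2 (b : C2) : R := Cmod (fst b) + Cmod (snd b).

Lemma size2_nonneg b : 0 <= size2 b.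
Proof. pose proof (Cmod_ge_0 (fst b)). pose proof (Cmod_ge_0 (snd b)). unfold size2. lra. Qed.

Lemma bigO_fst : bigO size2 1 (fun b => fst b).
Proof.
exists 1, 1. split; [lra|]. split; [lra|]. intros [x y] _. unfold size2. simpl. pose proof (Cmod_ge_0 y). lra.
Qed.

Lemma bigO_snd : bigO size2 1 (fun b => snd b).
Proof.
exists 1, 1. split; [lra|]. split; [lra|]. intros [x y] _. unfold size2. simpl. pose proof (Cmod_ge_0 x). lra.
Qed.

(** Taylor expansion at the origin modulo total degree 6. *)
Definition taylor6 (a : nat -> nat -> C) (f : C2 -> C) : Prop :=
  bigO size2 6 (fun b => f b - box a (fst b) (snd b))%C.

Definition has_taylor6 (f : C2 -> C) : Prop := exists a, taylor6 a f.

Lemma taylor6_near f g : bigO size2 6 (fun b => g b - f b)%C -> has_taylor6 f -> has_taylor6 g.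
Proof.
intros H [a Ha]. exists a. unfold taylor6 in *.
apply (bigO_ext size2 6 (fun b => (g b - f b) + (f b - box a (fst b) (snd b)))%C); [intros; ring|].
apply bigO_plus; assumption.
Qed.

Lemma taylor6_plus f g : has_taylor6 f -> has_taylor6 g -> has_taylor6 (fun b => f b + g b)%C.
Proof.
intros [a Ha] [a' Ha']. exists (fun j k => a j k + a' j k)%C. unfold taylor6 in *.
apply (bigO_ext size2 6 (fun b => (f b - box a (fst b) (snd b)) + (g b - box a' (fst b) (snd b)))%C).
- intros [x y]. cbn [fst snd]. unfold box.
  rewrite (dsum_ext 5 5 (term (fun j k => a j k + a' j k)%C x y) (fun j k => term a x y j k + term a' x y j k)%C).
  + rewrite dsum_plus. ring.
  + intros. unfold term. ring.
- apply bigO_plus; assumption.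
Qed.

Lemma taylor6_scal c f : has_taylor6 f -> has_taylor6 (fun b => c * f b)%C.
Proof.
intros [a Ha]. exists (fun j k => c * a j k)%C. unfold taylor6 in *.
apply (bigO_ext size2 6 (fun b => c * (f b - box a (fst b) (snd b)))%C).
- intros [x y]. cbn [fst snd]. unfold box.
  rewrite (dsum_ext 5 5 (term (fun j k => c * a j k)%C x y) (fun j k => c * term a x y j k)%C).
  + rewrite dsum_scal. ring.
  + intros. unfold term. ring.
- apply bigO_scal; assumption.
Qed.

Lemma taylor6_const c : has_taylor6 (fun _ => c).
Proof.
exists (fun j k => match j, k with O, O => c | _, _ => RtoC 0 end).
apply (bigO_ext size2 6 (fun _ => RtoC 0)); [|apply bigO_zero].
intros [x y]. cbn [fst snd]. unfold box, dsum.
rewrite (csum_support _ 5 0); [|lia|].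
- rewrite csum_0, (csum_support _ 5 0); [|lia|].
  + rewrite csum_0. unfold term. simpl. ring.
  + intros [|k] Hk; [lia|]. unfold term. ring.
- intros [|j] Hj; [lia|]. rewrite (csum_support _ 5 0); [|lia|].
  + rewrite csum_0. unfold term. ring.
  + intros k _. unfold term. ring.
Qed.

(** The coefficients are shifted; the column of degree 6 that leaves the box is part of
    the remainder. *)
Lemma taylor6_fst f : has_taylor6 f -> has_taylor6 (fun b => fst b * f b)%C.
Proof.
intros [a Ha]. exists (fun j k => match j with O => RtoC 0 | S j' => a j' k end).
unfold taylor6 in *.
apply (bigO_ext size2 6 (fun b => fst b * (f b - box a (fst b) (snd b))
   + fst b ^ 6 * csum (fun k => a 5%nat k * snd b ^ k) 5)%C).
- intros [x y]. cbn [fst snd]. unfold box, dsum.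
  pose proof (csum_shift (fun j => csum (term (fun j k => match j with O => RtoC 0 | S j' => a j' k end) x y j) 5) 5) as E.
  rewrite csum_S in E.
  replace (csum (term _ x y 0%nat) 5) with (RtoC 0) in E.
  2:{ rewrite (csum_support _ 5 0); [|lia|]; [rewrite csum_0|intros k _]; unfold term; ring. }
  replace (csum (term _ x y 6%nat) 5) with (x ^ 6 * csum (fun k => a 5%nat k * y ^ k) 5)%C in E.
  2:{ rewrite <- csum_scal. apply csum_ext. intros k _. unfold term. ring. }
  replace (csum (fun k => csum (term _ x y (S k)) 5) 5) with (x * csum (fun j => csum (term a x y j) 5) 5)%C in E.
  2:{ rewrite <- csum_scal. apply csum_ext. intros j _. rewrite <- csum_scal. apply csum_ext. intros k _.
      unfold term. rewrite Cpow_S. ring. }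
  set (L := csum _ _) in E |- *. set (A := csum (fun j => csum (term a x y j) 5) 5) in *.
  set (Bx := (x ^ 6 * _)%C) in *.
  transitivity (x * f (x, y) - x * A + Bx)%C; [ring|].
  replace (x * A)%C with (L + Bx)%C by (rewrite E; ring). ring.
- apply bigO_plus.
  + apply (bigO_weaken _ size2_nonneg 7); [lia|]. exact (bigO_mult _ 1 6 _ _ bigO_fst Ha).
  + apply (bigO_mult _ 6 0 (fun b : C2 => fst b ^ 6)%C).
    * exact (bigO_pow _ 1 _ 6 bigO_fst).
    * apply (bigO_csum _ 0 5 (fun k (b : C2) => a 5%nat k * snd b ^ k)%C). intros k. apply bigO_scal.
      apply (bigO_weaken _ size2_nonneg (k * 1)); [lia|]. exact (bigO_pow _ 1 _ k bigO_snd).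
Qed.

Definition swap (b : C2) : C2 := (snd b, fst b).

(** Exchanging the coordinates deduces the multiplication by [snd b] from that by [fst b]. *)
Lemma taylor6_swap f : has_taylor6 f -> has_taylor6 (fun b => f (swap b)).
Proof.
intros [a Ha]. exists (fun j k => a k j). unfold taylor6 in *.
assert (Hs : forall b, size2 (swap b) = size2 b) by (intros; unfold size2, swap; simpl; ring).
destruct Ha as [K [d [HK [Hd H]]]]. exists K, d. split; [exact HK|]. split; [exact Hd|].
intros b Hb. rewrite <- Hs in Hb |- *. specialize (H _ Hb).
replace (box (fun j k => a k j) (fst b) (snd b)) with (box a (fst (swap b)) (snd (swap b))); [exact H|].
unfold box, dsum, swap; simpl.
assert (E : forall (u : nat -> nat -> C) m n, csum (fun j => csum (u j) n) m = csum (fun k => csum (fun j => u j k) m) n).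
{ intros u m n. induction m as [|m IH].
  - rewrite csum_0. apply csum_ext. intros k _. rewrite csum_0. reflexivity.
  - rewrite csum_S, IH, <- csum_plus. apply csum_ext. intros k _. rewrite csum_S. reflexivity. }
rewrite E. apply csum_ext; intros j _; apply csum_ext; intros k _. unfold term. ring.
Qed.

Lemma taylor6_snd f : has_taylor6 f -> has_taylor6 (fun b => snd b * f b)%C.
Proof.
intros H. apply taylor6_swap, taylor6_fst, taylor6_swap in H.
revert H. apply taylor6_near. apply (bigO_ext size2 6 (fun _ => RtoC 0)); [|apply bigO_zero].
intros [x y]. unfold swap. simpl. ring.
Qed.

Lemma taylor6_csum n (F : nat -> C2 -> C) :
  (forall j, has_taylor6 (F j)) -> has_taylor6 (fun b => csum (fun j => F j b) n).
Proof.
intros H. induction n as [|n IH].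
- generalize (H 0%nat). apply taylor6_near. apply (bigO_ext size2 6 (fun _ => RtoC 0)); [|apply bigO_zero].
  intros b. rewrite csum_0. ring.
- generalize (taylor6_plus _ _ IH (H (S n))). apply taylor6_near.
  apply (bigO_ext size2 6 (fun _ => RtoC 0)); [|apply bigO_zero].
  intros b. rewrite csum_S. ring.
Qed.

Lemma taylor6_ext f g : (forall b, f b = g b) -> has_taylor6 f -> has_taylor6 g.
Proof.
intros E. apply taylor6_near. apply (bigO_ext size2 6 (fun _ => RtoC 0)); [|apply bigO_zero].
intros b. rewrite E. ring.
Qed.

Lemma taylor6_box_mult a g : has_taylor6 g -> has_taylor6 (fun b => box a (fst b) (snd b) * g b)%C.
Proof.
intros Hg.
assert (P1 : forall k h, has_taylor6 h -> has_taylor6 (fun b => snd b ^ k * h b)%C).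
{ intros k h Hh. induction k as [|k IH].
  - apply (taylor6_ext h); [intros [x y]; simpl; ring|exact Hh].
  - apply (taylor6_ext (fun b => snd b * (snd b ^ k * h b))%C); [intros [x y]; simpl; ring|apply taylor6_snd, IH]. }
assert (P2 : forall j h, has_taylor6 h -> has_taylor6 (fun b => fst b ^ j * h b)%C).
{ intros j h Hh. induction j as [|j IH].
  - apply (taylor6_ext h); [intros [x y]; simpl; ring|exact Hh].
  - apply (taylor6_ext (fun b => fst b * (fst b ^ j * h b))%C); [intros [x y]; simpl; ring|apply taylor6_fst, IH]. }
apply (taylor6_ext (fun b => csum (fun j => csum (fun k => a j k * (fst b ^ j * (snd b ^ k * g b))) 5) 5)%C).
- intros [x y]. cbn [fst snd]. unfold box, dsum. rewrite Cmult_comm, <- csum_scal. apply csum_ext; intros j _.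
  rewrite <- csum_scal. apply csum_ext; intros k _. unfold term. ring.
- apply taylor6_csum; intros j. apply taylor6_csum; intros k. apply taylor6_scal, P2, P1, Hg.
Qed.

Lemma box_bounded a : bigO size2 0 (fun b => box a (fst b) (snd b)).
Proof.
apply (bigO_csum _ 0 5 (fun j (b : C2) => csum (term a (fst b) (snd b) j) 5)). intros j.
apply (bigO_csum _ 0 5 (fun k (b : C2) => term a (fst b) (snd b) j k)). intros k.
unfold term. apply bigO_scal.
apply (bigO_weaken _ size2_nonneg (j * 1 + k * 1)); [lia|].
apply (bigO_mult _ (j * 1) (k * 1)); [exact (bigO_pow _ 1 _ j bigO_fst)|exact (bigO_pow _ 1 _ k bigO_snd)].
Qed.

Lemma taylor6_bounded f : has_taylor6 f -> bigO size2 0 f.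
Proof.
intros [a Ha].
apply (bigO_ext size2 0 (fun b => (f b - box a (fst b) (snd b)) + box a (fst b) (snd b))%C); [intros; ring|].
apply bigO_plus; [|apply box_bounded].
apply (bigO_weaken _ size2_nonneg 6); [lia|exact Ha].
Qed.

(** Thanks to this, functions with a Taylor expansion form an algebra, and a polynomial
    may be evaluated in it. *)
Lemma taylor6_mult f g : has_taylor6 f -> has_taylor6 g -> has_taylor6 (fun b => f b * g b)%C.
Proof.
intros [a Ha] Hg. generalize (taylor6_box_mult a g Hg). apply taylor6_near.
apply (bigO_ext size2 6 (fun b => (f b - box a (fst b) (snd b)) * g b)%C); [intros; ring|].
exact (bigO_mult _ 6 0 _ _ Ha (taylor6_bounded g Hg)).
Qed.

Lemma taylor6_pow f j : has_taylor6 f -> has_taylor6 (fun b => f b ^ j)%C.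
Proof.
intros H. induction j as [|j IH]; [exact (taylor6_const (RtoC 1))|].
exact (taylor6_mult _ _ H IH).
Qed.

Lemma taylor6_vanishing f : has_taylor6 f -> f (RtoC 0, RtoC 0) = RtoC 0 -> bigO size2 1 f.
Proof.
intros [a Ha] H0.
assert (Hs0 : size2 (RtoC 0, RtoC 0) = 0) by (unfold size2; simpl; rewrite Cmod_0; ring).
pose proof (bigO_at_zero size2 5 _ _ Hs0 Ha) as E. cbv beta in E. rewrite H0 in E. simpl fst in E. simpl snd in E.
apply (bigO_ext size2 1 (fun b => (f b - box a (fst b) (snd b)) + (box a (fst b) (snd b) - box a 0 0))%C).
{ intros [x y]. cbn [fst snd]. transitivity (f (x, y) + (0 - box a 0 0))%C; [ring|rewrite E; ring]. }
apply bigO_plus; [apply (bigO_weaken _ size2_nonneg 6); [lia|exact Ha]|].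
apply (bigO_ext size2 1 (fun b => csum (fun j => csum (fun k => term a (fst b) (snd b) j k - term a 0 0 j k) 5) 5)%C).
{ intros [x y]. cbn [fst snd]. unfold box, dsum.
  transitivity (csum (fun j => csum (term a x y j) 5 + (-(1)) * csum (term a 0 0 j) 5)%C 5).
  - apply csum_ext; intros j _. rewrite <- csum_scal, <- csum_plus. apply csum_ext; intros; ring.
  - rewrite csum_plus, csum_scal. ring. }
apply (bigO_csum _ 1 5 (fun j (b : C2) => csum (fun k => term a (fst b) (snd b) j k - term a 0 0 j k)%C 5)). intros j.
apply (bigO_csum _ 1 5 (fun k (b : C2) => term a (fst b) (snd b) j k - term a 0 0 j k)%C). intros k.
unfold term. destruct (Nat.eq_dec (j + k) 0) as [Ejk|Ejk].
- apply (bigO_ext size2 1 (fun _ => RtoC 0)); [|apply bigO_zero].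
  intros [x y]. cbn [fst snd]. replace j with 0%nat by lia. replace k with 0%nat by lia. simpl. ring.
- apply (bigO_ext size2 1 (fun b : C2 => a j k * (fst b ^ j * snd b ^ k))%C).
  + intros [x y]. cbn [fst snd]. destruct j as [|j]; [destruct k as [|k]; [lia|]|]; rewrite !Cpow_S; ring.
  + apply bigO_scal. apply (bigO_weaken _ size2_nonneg (j * 1 + k * 1)); [lia|].
    apply (bigO_mult _ (j * 1) (k * 1)); [exact (bigO_pow _ 1 _ j bigO_fst)|exact (bigO_pow _ 1 _ k bigO_snd)].
Qed.

Lemma holomorphic_taylor6 f : holomorphic_at f zero -> has_taylor6 f.
Proof.
intros Hf. destruct (holomorphic_box_taylor f zero Hf) as [a [K [d [Hd H]]]].
exists a, (Rmax K 0), d. split; [apply Rmax_r|]. split; [exact Hd|]. intros b Hb.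
specialize (H b). rewrite !fst_sub_zero, ?snd_sub_zero in H.
unfold size2 in *. pose proof (Cmod_ge_0 (fst b)). pose proof (Cmod_ge_0 (snd b)).
eapply Rle_trans; [apply H; lra|]. apply Rmult_le_compat_r; [apply pow_le; lra|apply Rmax_l].
Qed.

(** The components of [psi] have Taylor expansions, hence so has a polynomial in them;
    the remainder of [f] is taken at a point of size O(size of [b]). *)
Lemma taylor6_comp f (psi : C2 -> C2) q :
  holomorphic_at f q -> psi zero = q -> holomorphic_map_at psi zero ->
  has_taylor6 (fun b => f (psi b)).
Proof.
intros Hf Hq [H1 H2].
set (p1 := fun b => (fst (psi b) - fst q)%C). set (p2 := fun b => (snd (psi b) - snd q)%C).
assert (T1 : has_taylor6 p1).
{ apply (taylor6_ext (fun b => fst (psi b) + - fst q)%C); [intros; unfold p1; ring|].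
  apply taylor6_plus; [apply holomorphic_taylor6, H1|apply taylor6_const]. }
assert (T2 : has_taylor6 p2).
{ apply (taylor6_ext (fun b => snd (psi b) + - snd q)%C); [intros; unfold p2; ring|].
  apply taylor6_plus; [apply holomorphic_taylor6, H2|apply taylor6_const]. }
change (zero : C2) with ((RtoC 0, RtoC 0) : C2) in Hq.
assert (O1 : bigO size2 1 p1) by (apply taylor6_vanishing; [exact T1|unfold p1; rewrite Hq; ring]).
assert (O2 : bigO size2 1 p2) by (apply taylor6_vanishing; [exact T2|unfold p2; rewrite Hq; ring]).
destruct (holomorphic_box_taylor f q Hf) as [a [K [d [Hd H]]]].
apply (taylor6_near (fun b => box a (p1 b) (p2 b))).
- destruct O1 as [K1 [d1 [HK1 [Hd1 O1]]]], O2 as [K2 [d2 [HK2 [Hd2 O2]]]].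
  set (F := fun b : C2 => (f (((fst b + fst q)%C, (snd b + snd q)%C) : C2) - box a (fst b) (snd b))%C).
  apply (bigO_ext size2 6 (fun b => F (p1 b, p2 b))).
  { intros b. unfold F. simpl. f_equal. f_equal. unfold p1, p2.
    destruct (psi b) as [u v]. simpl. f_equal; ring. }
  apply (bigO_comp size2 size2_nonneg size2 size2_nonneg 6 F (fun b => (p1 b, p2 b)) (K1 + K2)).
  + exists (Rmax K 0), d. split; [apply Rmax_r|]. split; [exact Hd|]. intros [x y] Hb. unfold F, size2 in *. cbn [fst snd] in *.
    pose proof (Cmod_ge_0 x). pose proof (Cmod_ge_0 y).
    specialize (H (((x + fst q)%C, (y + snd q)%C) : C2)). cbn [fst snd] in H.
    assert (E : forall u v : C, (u + v - v)%C = u) by (intros; ring).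
    rewrite !E in H.
    eapply Rle_trans; [apply H; lra|]. apply Rmult_le_compat_r; [apply pow_le; lra|apply Rmax_l].
  + lra.
  + exists (Rmin d1 d2). split; [apply Rmin_pos; assumption|]. intros b Hb.
    assert (size2 b < d1) by (eapply Rlt_le_trans; [exact Hb|apply Rmin_l]).
    assert (size2 b < d2) by (eapply Rlt_le_trans; [exact Hb|apply Rmin_r]).
    unfold size2 at 1. simpl.
    specialize (O1 b ltac:(assumption)). specialize (O2 b ltac:(assumption)). simpl in O1, O2. lra.
- unfold box, dsum. apply (taylor6_csum 5 (fun j b => csum (term a (p1 b) (p2 b) j) 5)). intros j.
  apply (taylor6_csum 5 (fun k b => term a (p1 b) (p2 b) j k)). intros k. unfold term.
  apply taylor6_scal, taylor6_mult; apply taylor6_pow; assumption.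
Qed.

(** * The 2-jet of a map between normal forms *)

(** Orders of vanishing as a positive parameter tends to 0. *)
Notation epsO := (bigO pos).

Lemma pos_nonneg (e : posreal) : 0 <= pos e.
Proof. left; apply cond_pos. Qed.

Lemma epsO_id : epsO 1 (fun e => RtoC e).
Proof.
exists 1, 1. split; [lra|]. split; [lra|]. intros e _.
rewrite Cmod_R, Rabs_pos_eq by apply pos_nonneg. simpl. lra.
Qed.

(** A constant that is O(e) vanishes; then the remaining factor [e], which is positive,
    can be divided out. *)
Lemma epsO_coef k c F : epsO (S k) (fun e => c + RtoC e * F e)%C -> epsO 0 F ->
  c = RtoC 0 /\ epsO k F.
Proof.
intros H HF.
assert (Hc : epsO 1 (fun _ => c)).
{ apply (bigO_ext pos 1 (fun e => (c + RtoC e * F e) - RtoC e * F e)%C); [intros; ring|].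
  apply bigO_minus; [apply (bigO_weaken pos pos_nonneg (S k)); [lia|exact H]|].
  exact (bigO_mult pos 1 0 _ _ epsO_id HF). }
assert (c = RtoC 0) as ->.
{ destruct Hc as [K [d [HK [Hd Hc]]]]. apply Cmod_eq0_lim. intros e He.
  assert (Hx : 0 < Rmin (d / 2) (e / (K + 1) / 2)).
  { apply Rmin_pos; [lra|]. assert (0 < e / (K + 1)) by (apply Rdiv_lt_0_compat; lra). lra. }
  specialize (Hc (mkposreal _ Hx)). simpl in Hc.
  pose proof (Rmin_l (d / 2) (e / (K + 1) / 2)). pose proof (Rmin_r (d / 2) (e / (K + 1) / 2)).
  set (x := Rmin _ _) in *.
  assert (x * (K + 1) <= e / 2).
  { apply Rle_trans with (e / (K + 1) / 2 * (K + 1)); [apply Rmult_le_compat_r; lra|right; field; lra]. }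
  specialize (Hc ltac:(lra)). nra. }
split; [reflexivity|].
destruct H as [K [d [HK [Hd H]]]]. exists K, d. split; [exact HK|]. split; [exact Hd|].
intros e He. specialize (H e He).
replace (0 + RtoC e * F e)%C with (RtoC e * F e)%C in H by ring.
rewrite Cmod_mult, Cmod_R, Rabs_pos_eq in H by apply pos_nonneg.
apply Rmult_le_reg_l with (pos e); [apply cond_pos|]. simpl in H. lra.
Qed.

Lemma epsO_poly5 c0 c1 c2 c3 c4 c5 :
  epsO 6 (fun e => c0 + RtoC e * (c1 + RtoC e * (c2 + RtoC e * (c3 + RtoC e * (c4 + RtoC e * c5)))))%C ->
  c1 = RtoC 0 /\ c2 = RtoC 0 /\ c3 = RtoC 0 /\ c4 = RtoC 0 /\ c5 = RtoC 0.
Proof.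
intros H0.
assert (B : forall c F, epsO 0 F -> epsO 0 (fun e => c + RtoC e * F e)%C).
{ intros c F HF. apply bigO_plus; [apply bigO_const|].
  apply (bigO_weaken pos pos_nonneg 1); [lia|]. exact (bigO_mult pos 1 0 _ _ epsO_id HF). }
pose proof (bigO_const pos c5) as B5. pose proof (B c4 _ B5) as B4. pose proof (B c3 _ B4) as B3.
pose proof (B c2 _ B3) as B2. pose proof (B c1 _ B2) as B1.
destruct (epsO_coef _ _ _ H0 B1) as [_ H1]. destruct (epsO_coef _ _ _ H1 B2) as [E1 H2].
destruct (epsO_coef _ _ _ H2 B3) as [E2 H3]. destruct (epsO_coef _ _ _ H3 B4) as [E3 H4].
destruct (epsO_coef _ _ _ H4 B5) as [E4 H5].
assert (E5 : epsO 1 (fun e => c5 + RtoC e * 0)%C).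
{ apply (bigO_ext pos 1 (fun _ => c5)); [intros; ring|exact H5]. }
destruct (epsO_coef _ _ _ E5 (bigO_const pos (RtoC 0))) as [E5' _]. auto.
Qed.

Lemma epsO_Im k F : epsO k F -> epsO k (fun e => RtoC (Im (F e))).
Proof. apply bigO_le. intros e. rewrite Cmod_R. apply Im_le_Cmod. Qed.

Lemma epsO_Re k F : epsO k F -> epsO k (fun e => RtoC (Re (F e))).
Proof. apply bigO_le. intros e. rewrite Cmod_R. apply re_le_Cmod. Qed.

Lemma epsO_conj k F : epsO k F -> epsO k (fun e => Cconj (F e)).
Proof. apply bigO_le. intros e. rewrite Cmod_conj. lra. Qed.

Lemma epsO_remainder E (Z : posreal -> C) (U : posreal -> R) m :
  weight6_remainder E -> (1 <= m)%nat ->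
  epsO 1 Z -> epsO m (fun e => Z e ^ 2)%C -> epsO m (fun e => RtoC (U e)) ->
  epsO (m * 3) (fun e => RtoC (E (Z e) (U e))).
Proof.
intros [K [d [Hd HE]]] Hm [K1 [d1 [HK1 [Hd1 H1]]]] [K2 [d2 [HK2 [Hd2 H2]]]] HU.
pose proof (bigO_weaken pos pos_nonneg m 1 _ Hm HU) as HU1.
destruct HU as [K3 [d3 [HK3 [Hd3 H3]]]], HU1 as [K4 [d4 [HK4 [Hd4 H4]]]].
exists (Rmax K 0 * (K2 + K3) ^ 3).
exists (Rmin (Rmin (Rmin d1 d2) (Rmin d3 d4)) (Rmin (d / (K1 + 1)) (d / (K4 + 1)))).
split; [apply Rmult_le_pos; [apply Rmax_r|apply pow_le; lra]|].
assert (P1 : 0 < d / (K1 + 1)) by (apply Rdiv_lt_0_compat; lra).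
assert (P4 : 0 < d / (K4 + 1)) by (apply Rdiv_lt_0_compat; lra).
split; [repeat apply Rmin_pos; assumption|].
intros e He.
apply Rmin_Rgt_l in He. destruct He as [He1 He2].
apply Rmin_Rgt_l in He1. destruct He1 as [He3 He4].
apply Rmin_Rgt_l in He3, He4, He2. destruct He2 as [L1 L2], He3 as [L3 L4], He4 as [L5 L6].
specialize (H1 e L3). specialize (H2 e L4). specialize (H3 e L5). specialize (H4 e L6).
rewrite Cmod_R in H3, H4. rewrite Cmod_pow in H2.
pose proof (cond_pos e) as Pe.
assert (e * (K1 + 1) < d) by (apply lt_div_succ; lra).
assert (e * (K4 + 1) < d) by (apply lt_div_succ; lra).
rewrite Cmod_R. simpl in H1, H4.
eapply Rle_trans; [apply HE; lra|].
pose proof (pow2_ge_0 (Cmod (Z e))). pose proof (Rabs_pos (U e)).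
apply Rle_trans with (Rmax K 0 * (Cmod (Z e) ^ 2 + Rabs (U e)) ^ 3).
{ apply Rmult_le_compat_r; [apply pow_le; lra|apply Rmax_l]. }
rewrite Rmult_assoc. apply Rmult_le_compat_l; [apply Rmax_r|].
rewrite pow_mult, <- Rpow_mult_distr. apply pow_incr. lra.
Qed.

(** The parts of weight 2 to 5 at [(e z, e^2 w)], divided by [e^2]. *)
Definition tail2 (a : nat -> nat -> C) (z w : C) (e : C) : C :=
  (part2 (a 0%nat 1%nat) (a 2%nat 0%nat) z w
  + e * (part3 (a 1%nat 1%nat) (a 3%nat 0%nat) z w
  + e * (part4 (a 0%nat 2%nat) (a 2%nat 1%nat) (a 4%nat 0%nat) z w
  + e * part5 (a 1%nat 2%nat) (a 3%nat 1%nat) (a 5%nat 0%nat) z w)))%C.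

(** The part of weight at most 5 of a Taylor polynomial at [(e z, e^2 w)], by powers
    of [e]. *)
Definition regrouped (a : nat -> nat -> C) (z w : C) (e : C) : C :=
  (a 0%nat 0%nat + e * (part1 (a 1%nat 0%nat) z w + e * tail2 a z w e))%C.

Lemma epsO_horner c F : epsO 0 F -> epsO 0 (fun e => c + RtoC e * F e)%C.
Proof.
intros HF. apply bigO_plus; [apply bigO_const|].
apply (bigO_weaken pos pos_nonneg 1); [lia|]. exact (bigO_mult pos 1 0 _ _ epsO_id HF).
Qed.

Lemma tail2_bounded a z w : epsO 0 (fun e => tail2 a z w (RtoC e)).
Proof. unfold tail2. do 3 apply epsO_horner. apply bigO_const. Qed.

Lemma regrouped_bounded a z w : epsO 0 (fun e => regrouped a z w (RtoC e)).
Proof. unfold regrouped. do 2 apply epsO_horner. apply tail2_bounded. Qed.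

Lemma epsO_sq_tail2 a z w : epsO 2 (fun e => RtoC e ^ 2 * tail2 a z w (RtoC e))%C.
Proof. exact (bigO_mult pos 2 0 _ _ (bigO_pow pos 1 _ 2 epsO_id) (tail2_bounded a z w)). Qed.

(** A monomial [z^j w^k] contributes [e^(j + 2 k)], which is negligible when the weight
    [j + 2 k] exceeds 5. *)
Lemma taylor6_regrouped a f z w (we : posreal -> C) :
  taylor6 a f -> epsO 6 (fun e => we e - RtoC e ^ 2 * w)%C ->
  epsO 6 (fun e => f (RtoC e * z, we e) - regrouped a z w (RtoC e))%C.
Proof.
intros Ha Hw.
set (ze := fun e : posreal => (RtoC e * z)%C).
assert (Oz : epsO 1 ze).
{ apply (bigO_ext pos 1 (fun e => z * RtoC e)%C); [intros; unfold ze; ring|apply bigO_scal, epsO_id]. }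
assert (Oe2 : epsO 2 (fun e => RtoC e ^ 2 * w)%C).
{ apply (bigO_ext pos 2 (fun e => w * RtoC e ^ 2)%C); [intros; ring|].
  apply bigO_scal. exact (bigO_pow pos 1 _ 2 epsO_id). }
assert (Ow : epsO 2 we).
{ apply (bigO_ext pos 2 (fun e => (we e - RtoC e ^ 2 * w) + RtoC e ^ 2 * w)%C); [intros; ring|].
  apply bigO_plus; [|exact Oe2]. apply (bigO_weaken pos pos_nonneg 6); [lia|exact Hw]. }
assert (Owk : forall k, epsO 6 (fun e => we e ^ k - (RtoC e ^ 2 * w) ^ k)%C).
{ induction k as [|k IH].
  - apply (bigO_ext pos 6 (fun _ => RtoC 0)); [intros; simpl; ring|apply bigO_zero].
  - apply (bigO_ext pos 6 (fun e => we e * (we e ^ k - (RtoC e ^ 2 * w) ^ k)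
      + (we e - RtoC e ^ 2 * w) * (RtoC e ^ 2 * w) ^ k)%C); [intros; rewrite !Cpow_S; ring|].
    apply bigO_plus.
    + apply (bigO_weaken pos pos_nonneg (2 + 6)); [lia|]. exact (bigO_mult pos 2 6 _ _ Ow IH).
    + apply (bigO_weaken pos pos_nonneg (6 + k * 2)); [lia|].
      exact (bigO_mult pos 6 (k * 2) _ _ Hw (bigO_pow pos 2 _ k Oe2)). }
assert (A1 : epsO 6 (fun e => f (ze e, we e) - box a (ze e) (we e))%C).
{ pose proof Oz as [K1 [d1 [HK1 [Hd1 O1]]]].
  pose proof (bigO_weaken pos pos_nonneg 2 1 _ ltac:(lia) Ow) as [K2 [d2 [HK2 [Hd2 O2]]]].
  apply (bigO_comp pos pos_nonneg size2 size2_nonneg 6 (fun b => f b - box a (fst b) (snd b))%C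
    (fun e => (ze e, we e) : C2) (K1 + K2) Ha); [lra|].
  exists (Rmin d1 d2). split; [apply Rmin_pos; assumption|]. intros e He.
  apply Rmin_Rgt_l in He. destruct He as [L1 L2].
  specialize (O1 e L1). specialize (O2 e L2). unfold size2. simpl in *. lra. }
set (low := fun (e : posreal) j k => if Nat.leb (j + 2 * k) 5 then term a (ze e) (RtoC e ^ 2 * w)%C j k else RtoC 0).
assert (A2 : epsO 6 (fun e => box a (ze e) (we e) - dsum 5 5 (low e))%C).
{ apply (bigO_ext pos 6 (fun e => csum (fun j => csum (fun k => term a (ze e) (we e) j k - low e j k) 5) 5)%C).
  { intros e. transitivity (dsum 5 5 (fun j k => term a (ze e) (we e) j k + (-(1)) * low e j k)%C).
    - apply dsum_ext. intros; ring.
    - rewrite dsum_plus, dsum_scal. unfold box. ring. }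
  apply (bigO_csum pos 6 5 (fun j e => csum (fun k => term a (ze e) (we e) j k - low e j k)%C 5)). intros j.
  apply (bigO_csum pos 6 5 (fun k e => term a (ze e) (we e) j k - low e j k)%C). intros k.
  apply (bigO_ext pos 6 (fun e => a j k * (ze e ^ j * (we e ^ k - (RtoC e ^ 2 * w) ^ k))
     + (term a (ze e) (RtoC e ^ 2 * w) j k - low e j k))%C); [intros; unfold term; ring|].
  apply bigO_plus.
  - apply bigO_scal. apply (bigO_weaken pos pos_nonneg (j * 1 + 6)); [lia|].
    exact (bigO_mult pos (j * 1) 6 _ _ (bigO_pow pos 1 _ j Oz) (Owk k)).
  - unfold low. destruct (Nat.leb (j + 2 * k) 5) eqn:Ejk.
    + apply (bigO_ext pos 6 (fun _ => RtoC 0)); [intros; ring|apply bigO_zero].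
    + apply Nat.leb_gt in Ejk.
      apply (bigO_ext pos 6 (fun e => a j k * (ze e ^ j * (RtoC e ^ 2 * w) ^ k))%C); [intros; unfold term; ring|].
      apply bigO_scal. apply (bigO_weaken pos pos_nonneg (j * 1 + k * 2)); [lia|].
      exact (bigO_mult pos (j * 1) (k * 2) _ _ (bigO_pow pos 1 _ j Oz) (bigO_pow pos 2 _ k Oe2)). }
apply (bigO_ext pos 6 (fun e => (f (ze e, we e) - box a (ze e) (we e)) + (box a (ze e) (we e) - dsum 5 5 (low e)))%C).
2: apply bigO_plus; assumption.
intros e.
replace (dsum 5 5 (low e)) with (regrouped a z w (RtoC e)); [unfold ze; ring|].
unfold dsum. repeat rewrite ?csum_S, ?csum_0. unfold low, term, ze, regrouped, tail2, part1, part2, part3, part4, part5.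
cbn [Nat.leb Nat.add Nat.mul]. ring.
Qed.

Lemma re_cart (x y : R) : Re (RtoC x + Ci * RtoC y)%C = x.
Proof. rewrite re_plus, re_mult, !re_RtoC, im_RtoC, re_Ci. ring. Qed.

Lemma im_cart (x y : R) : Im (RtoC x + Ci * RtoC y)%C = y.
Proof. rewrite im_plus, im_mult, !im_RtoC, re_RtoC, re_Ci, im_Ci. ring. Qed.

(** A point of a normal form above [(e z, e^2 t)] lies on the quadric up to the
    remainder. *)
Lemma quadric_point z t (e : R) (E : R) :
  (RtoC (e ^ 2 * t) + Ci * RtoC (Re ((RtoC e * z) * Cconj (RtoC e * z))%C + E) - RtoC e ^ 2 * quadric z t)%C
  = (Ci * RtoC E)%C.
Proof.
unfold quadric. rewrite <- RtoC_pow. apply C_eq;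
repeat rewrite ?re_minus, ?im_minus, ?re_plus, ?im_plus, ?re_mult, ?im_mult, ?re_conj, ?im_conj,
  ?re_RtoC, ?im_RtoC, ?re_Ci, ?im_Ci; ring.
Qed.

(** The points [(e z, e^2 t + i (|e z|^2 + E))] of [N] are mapped into [N']. Comparing the
    powers of [e] in the equation [Im g = |f|^2 + E'] gives the weighted identities of
    [projective_2jet]. For [E'] to be O(e^6) the function [g] must be O(e^2), that is, its term of
    weight 1 must vanish; this is obtained beforehand from the cruder bound [E' = O(e^3)]. *)
Theorem normal_form_map_2jet N N' (H : C2 -> C2) a b :
  normal_form N -> normal_form N' ->
  taylor6 a (fun q => fst (H q)) -> taylor6 b (fun q => snd (H q)) ->
  H zero = zero -> locally (zero : C2) (fun q => N q -> N' (H q)) ->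
  forall x y : C,
  ((a 1%nat 0%nat * x + a 0%nat 1%nat * y)
     * (b 2%nat 0%nat * (x * x) + b 1%nat 1%nat * (x * y) + b 0%nat 2%nat * (y * y))
   - (b 1%nat 0%nat * x + b 0%nat 1%nat * y)
     * (a 2%nat 0%nat * (x * x) + a 1%nat 1%nat * (x * y) + a 0%nat 2%nat * (y * y)))%C = 0%C.
Proof.
intros HN HN' Ta Tb H0 HNN.
destruct (normal_form_equation N HN) as [E [d [Hd [RE [EqN _]]]]].
destruct (normal_form_equation N' HN') as [E' [d' [Hd' [RE' [EqN' _]]]]].
assert (Hz0 : size2 zero = 0) by (unfold size2; change (Cmod (RtoC 0) + Cmod (RtoC 0) = 0); rewrite Cmod_0; ring).
assert (Box0 : forall c, box c (fst (zero : C2)) (snd (zero : C2)) = c 0%nat 0%nat).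
{ intros c. change (box c (RtoC 0) (RtoC 0) = c 0%nat 0%nat).
  unfold box, dsum. rewrite (csum_support _ 5 0); [|lia|].
  - rewrite csum_0, (csum_support _ 5 0); [|lia|]; [rewrite csum_0; unfold term; simpl; ring|].
    intros [|k] Hk; [lia|]. unfold term. rewrite Cpow_S. ring.
  - intros [|j] Hj; [lia|]. rewrite (csum_support _ 5 0); [|lia|]; [rewrite csum_0; unfold term; rewrite Cpow_S; ring|].
    intros k _. unfold term. rewrite Cpow_S. ring. }
assert (a00 : a 0%nat 0%nat = RtoC 0).
{ pose proof (bigO_at_zero size2 5 _ _ Hz0 Ta) as Z. cbv beta in Z. rewrite H0, Box0 in Z.
  change (RtoC 0 - a 0%nat 0%nat = RtoC 0)%C in Z.
  replace (a 0%nat 0%nat) with (- (0 - a 0%nat 0%nat))%C by ring. rewrite Z. ring. }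
assert (b00 : b 0%nat 0%nat = RtoC 0).
{ pose proof (bigO_at_zero size2 5 _ _ Hz0 Tb) as Z. cbv beta in Z. rewrite H0, Box0 in Z.
  change (RtoC 0 - b 0%nat 0%nat = RtoC 0)%C in Z.
  replace (b 0%nat 0%nat) with (- (0 - b 0%nat 0%nat))%C by ring. rewrite Z. ring. }
set (we := fun z t (e : posreal) => (RtoC (e ^ 2 * t) + Ci * RtoC (Re ((RtoC e * z) * Cconj (RtoC e * z))%C + E (RtoC e * z)%C (e ^ 2 * t)%R))%C).
set (fe := fun z t (e : posreal) => fst (H ((RtoC e * z)%C, we z t e))).
set (ge := fun z t (e : posreal) => snd (H ((RtoC e * z)%C, we z t e))).
assert (Oz : forall z, epsO 1 (fun e => RtoC e * z)%C).
{ intros z. apply (bigO_ext pos 1 (fun e => z * RtoC e)%C); [intros; ring|apply bigO_scal, epsO_id]. }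
assert (Ot : forall t, epsO 2 (fun e : posreal => RtoC (e ^ 2 * t))).
{ intros t. apply (bigO_ext pos 2 (fun e => RtoC t * RtoC e ^ 2)%C).
  - intros e. rewrite RtoC_mult, RtoC_pow. ring.
  - apply bigO_scal. exact (bigO_pow pos 1 _ 2 epsO_id). }
assert (Ow : forall z t, epsO 6 (fun e => we z t e - RtoC e ^ 2 * quadric z t)%C).
{ intros z t. apply (bigO_ext pos 6 (fun e : posreal => Ci * RtoC (E (RtoC e * z)%C (e ^ 2 * t)%R))%C).
  - intros e. symmetry. apply quadric_point.
  - apply bigO_scal. apply (epsO_remainder E (fun e : posreal => RtoC e * z)%C (fun e : posreal => e ^ 2 * t) 2 RE); [lia|apply Oz| |apply Ot].
    exact (bigO_pow pos 1 _ 2 (Oz z)). }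
assert (Ow1 : forall z t, epsO 1 (we z t)).
{ intros z t. apply (bigO_ext pos 1 (fun e => (we z t e - RtoC e ^ 2 * quadric z t) + quadric z t * RtoC e ^ 2)%C); [intros; ring|].
  apply bigO_plus; [apply (bigO_weaken pos pos_nonneg 6); [lia|apply Ow]|].
  apply bigO_scal. apply (bigO_weaken pos pos_nonneg 2); [lia|]. exact (bigO_pow pos 1 _ 2 epsO_id). }
assert (Of : forall z t, epsO 6 (fun e => fe z t e - regrouped a z (quadric z t) (RtoC e))%C).
{ intros z t. apply (taylor6_regrouped a (fun q => fst (H q)) z _ _ Ta (Ow z t)). }
assert (Og : forall z t, epsO 6 (fun e => ge z t e - regrouped b z (quadric z t) (RtoC e))%C).
{ intros z t. apply (taylor6_regrouped b (fun q => snd (H q)) z _ _ Tb (Ow z t)). }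
assert (O1 : forall c h z w, c 0%nat 0%nat = RtoC 0 -> epsO 6 (fun e => h e - regrouped c z w (RtoC e))%C -> epsO 1 h).
{ intros c h z w Hc Hh.
  apply (bigO_ext pos 1 (fun e => (h e - regrouped c z w (RtoC e)) + regrouped c z w (RtoC e))%C); [intros; ring|].
  apply bigO_plus; [apply (bigO_weaken pos pos_nonneg 6); [lia|exact Hh]|].
  apply (bigO_ext pos 1 (fun e => part1 (c 1%nat 0%nat) z w * RtoC e + RtoC e ^ 2 * tail2 c z w (RtoC e))%C).
  { intros e. unfold regrouped. rewrite Hc. ring. }
  apply bigO_plus; [apply bigO_scal, epsO_id|].
  apply (bigO_weaken pos pos_nonneg 2); [lia|apply epsO_sq_tail2]. }
assert (Of1 : forall z t, epsO 1 (fe z t)) by (intros z t; apply (O1 a _ z _ a00 (Of z t))).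
assert (Og1 : forall z t, epsO 1 (ge z t)) by (intros z t; apply (O1 b _ z _ b00 (Og z t))).
assert (Small : forall h r, epsO 1 h -> 0 < r -> exists r', 0 < r' /\ forall e : posreal, e < r' -> Cmod (h e) < r).
{ intros h r [K [dd [HK [Hdd Hh]]]] Hr. exists (Rmin dd (r / (K + 1))).
  assert (0 < r / (K + 1)) by (apply Rdiv_lt_0_compat; lra).
  split; [apply Rmin_pos; assumption|]. intros e He. apply Rmin_Rgt_l in He. destruct He as [L1 L2].
  specialize (Hh e L1). simpl in Hh. pose proof (cond_pos e).
  assert (e * (K + 1) < r) by (apply lt_div_succ; lra).
  lra. }
apply locally_C2 in HNN. destruct HNN as [d0 [Hd0 HNN]].
(* The equation of N' along the image of the points of N. *)
assert (Equation : forall z t, exists r, 0 < r /\ forall e : posreal, e < r ->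
  (RtoC (Im (ge z t e)) - fe z t e * Cconj (fe z t e) = RtoC (E' (fe z t e) (Re (ge z t e))))%C).
{ intros z t.
  set (m := Rmin d0 d). assert (Hm : 0 < m) by (apply Rmin_pos; assumption).
  destruct (Small _ m (Oz z) Hm) as [r1 [Hr1 S1]].
  destruct (Small _ m (Ow1 z t) Hm) as [r2 [Hr2 S2]].
  destruct (Small _ d' (Of1 z t) Hd') as [r3 [Hr3 S3]].
  destruct (Small _ d' (Og1 z t) Hd') as [r4 [Hr4 S4]].
  exists (Rmin (Rmin r1 r2) (Rmin r3 r4)). split; [repeat apply Rmin_pos; assumption|].
  intros e He. apply Rmin_Rgt_l in He. destruct He as [He1 He2].
  apply Rmin_Rgt_l in He1, He2. destruct He1 as [L1 L2], He2 as [L3 L4].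
  specialize (S1 e L1). specialize (S2 e L2). specialize (S3 e L3). specialize (S4 e L4).
  apply Rmin_Rgt_l in S1, S2. destruct S1 as [S1 S1'], S2 as [S2 S2'].
  set (q := ((RtoC e * z)%C, we z t e) : C2).
  assert (HNq : N q).
  { apply EqN; [exact S1'|exact S2'|]. unfold q. simpl fst. simpl snd. unfold we.
    rewrite im_cart, re_cart. reflexivity. }
  assert (HN'q : N' (H q)).
  { apply HNN; [| |exact HNq].
    - rewrite fst_sub_zero. exact S1.
    - rewrite snd_sub_zero. exact S2. }
  apply EqN' in HN'q; [|exact S3|exact S4].
  fold q in HN'q. change (Im (ge z t e) = Re (fe z t e * Cconj (fe z t e))%C + E' (fe z t e) (Re (ge z t e))) in HN'q.
  rewrite HN'q. apply C_eq; rewrite ?re_minus, ?im_minus, ?re_RtoC, ?im_RtoC; [ring|].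
  rewrite im_mult, re_conj, im_conj. ring. }
(* First pass: [g = O(e)], so the remainder of N' is only O(e^3). *)
assert (b10 : b 1%nat 0%nat = RtoC 0).
{ apply (weight1_coefs (b 1%nat 0%nat)). intros z t.
  destruct (Equation z t) as [r [Hr Eq]].
  assert (OE : epsO 3 (fun e => RtoC (E' (fe z t e) (Re (ge z t e))))).
  { apply (epsO_remainder E' (fe z t) (fun e => Re (ge z t e)) 1 RE'); [lia|apply Of1| |apply epsO_Re, Og1].
    apply (bigO_weaken pos pos_nonneg (2 * 1)); [lia|]. exact (bigO_pow pos 1 _ 2 (Of1 z t)). }
  assert (OI : epsO 2 (fun e => RtoC (Im (ge z t e)))).
  { apply (bigO_ext_near pos 2 (fun e => RtoC (E' (fe z t e) (Re (ge z t e))) + fe z t e * Cconj (fe z t e))%C _ r Hr).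
    - intros e He. rewrite <- (Eq e He). ring.
    - apply bigO_plus; [apply (bigO_weaken pos pos_nonneg 3); [lia|exact OE]|].
      exact (bigO_mult pos 1 1 _ _ (Of1 z t) (epsO_conj _ _ (Of1 z t))). }
  set (p := part1 (b 1%nat 0%nat) z (quadric z t)).
  assert (Og2 : epsO 2 (fun e => ge z t e - RtoC e * p)%C).
  { apply (bigO_ext pos 2 (fun e => (ge z t e - regrouped b z (quadric z t) (RtoC e)) + (regrouped b z (quadric z t) (RtoC e) - RtoC e * p))%C); [intros; ring|].
    apply bigO_plus; [apply (bigO_weaken pos pos_nonneg 6); [lia|apply Og]|].
    apply (bigO_ext pos 2 (fun e => RtoC e ^ 2 * tail2 b z (quadric z t) (RtoC e))%C); [|apply epsO_sq_tail2].
    intros e. unfold regrouped. rewrite b00. fold p. ring. }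
  assert (OP : epsO 2 (fun e => 0 + RtoC e * RtoC (Im p))%C).
  { apply (bigO_ext pos 2 (fun e => RtoC (Im (ge z t e)) - RtoC (Im (ge z t e - RtoC e * p)%C))%C).
    - intros e. apply C_eq; rewrite ?re_minus, ?im_minus, ?re_plus, ?im_plus, ?re_mult, ?im_mult, ?re_RtoC, ?im_RtoC;
      rewrite ?im_minus, ?im_mult, ?re_RtoC, ?im_RtoC; simpl; ring.
    - apply bigO_minus; [exact OI|apply epsO_Im, Og2]. }
  destruct (epsO_coef 1 _ _ OP (bigO_const pos _)) as [_ OP'].
  assert (OP2 : epsO 1 (fun e => RtoC (Im p) + RtoC e * 0)%C)
    by (apply (bigO_ext pos 1 _ _ (fun e => eq_sym (eq_trans (f_equal _ (Cmult_0_r _)) (Cplus_0_r _))) OP')).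
  destruct (epsO_coef 0 _ _ OP2 (bigO_const pos _)) as [Ep _].
  apply (f_equal Re) in Ep. exact Ep. }
(* Second pass: now [g = O(e^2)], and the remainder of N' is O(e^6). *)
assert (Og2 : forall z t, epsO 2 (ge z t)).
{ intros z t. apply (bigO_ext pos 2 (fun e => (ge z t e - regrouped b z (quadric z t) (RtoC e)) + regrouped b z (quadric z t) (RtoC e))%C); [intros; ring|].
  apply bigO_plus; [apply (bigO_weaken pos pos_nonneg 6); [lia|apply Og]|].
  apply (bigO_ext pos 2 (fun e => RtoC e ^ 2 * tail2 b z (quadric z t) (RtoC e))%C); [|apply epsO_sq_tail2].
  intros e. unfold regrouped, part1. rewrite b00, b10. ring. }
set (P1 := part1 (a 1%nat 0%nat)). set (P2 := part2 (a 0%nat 1%nat) (a 2%nat 0%nat)).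
set (P3 := part3 (a 1%nat 1%nat) (a 3%nat 0%nat)).
set (P4 := part4 (a 0%nat 2%nat) (a 2%nat 1%nat) (a 4%nat 0%nat)).
set (P5 := part5 (a 1%nat 2%nat) (a 3%nat 1%nat) (a 5%nat 0%nat)).
set (Q1 := part1 (b 1%nat 0%nat)). set (Q2 := part2 (b 0%nat 1%nat) (b 2%nat 0%nat)).
set (Q3 := part3 (b 1%nat 1%nat) (b 3%nat 0%nat)).
set (Q4 := part4 (b 0%nat 2%nat) (b 2%nat 1%nat) (b 4%nat 0%nat)).
set (Q5 := part5 (b 1%nat 2%nat) (b 3%nat 1%nat) (b 5%nat 0%nat)).
assert (Weights : forall z t, let w := quadric z t in
   (RtoC (Im (Q1 z w)) - 0)%C = RtoC 0 /\
   (RtoC (Im (Q2 z w)) - P1 z w * Cconj (P1 z w))%C = RtoC 0 /\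
   (RtoC (Im (Q3 z w)) - (P1 z w * Cconj (P2 z w) + P2 z w * Cconj (P1 z w)))%C = RtoC 0 /\
   (RtoC (Im (Q4 z w)) - (P1 z w * Cconj (P3 z w) + P2 z w * Cconj (P2 z w) + P3 z w * Cconj (P1 z w)))%C = RtoC 0 /\
   (RtoC (Im (Q5 z w)) - (P1 z w * Cconj (P4 z w) + P2 z w * Cconj (P3 z w)
      + P3 z w * Cconj (P2 z w) + P4 z w * Cconj (P1 z w)))%C = RtoC 0).
{ intros z t w.
  destruct (Equation z t) as [r [Hr Eq]].
  assert (OE : epsO 6 (fun e => RtoC (E' (fe z t e) (Re (ge z t e))))).
  { apply (epsO_remainder E' (fe z t) (fun e => Re (ge z t e)) 2 RE'); [lia|apply Of1| |apply epsO_Re, Og2].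
    exact (bigO_pow pos 1 _ 2 (Of1 z t)). }
  pose proof (Of z t) as Of6. pose proof (Og z t) as Og6. fold w in Of6, Og6.
  pose proof (bigO_weaken pos pos_nonneg 1 0 _ ltac:(lia) (Of1 z t)) as Of0.
  pose proof (regrouped_bounded a z w) as Ba.
  assert (OX : epsO 6 (fun e => RtoC (Im (regrouped b z w (RtoC e)))
     - regrouped a z w (RtoC e) * Cconj (regrouped a z w (RtoC e)))%C).
  { apply (bigO_ext_near pos 6 (fun e => RtoC (E' (fe z t e) (Re (ge z t e)))
       - RtoC (Im (ge z t e - regrouped b z w (RtoC e))%C)
       + (fe z t e * Cconj (fe z t e - regrouped a z w (RtoC e))
          + (fe z t e - regrouped a z w (RtoC e)) * Cconj (regrouped a z w (RtoC e))))%C _ r Hr).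
    - intros e He. rewrite <- (Eq e He), im_minus, RtoC_minus, Cminus_conj. ring.
    - apply bigO_plus; [apply bigO_minus; [exact OE|apply epsO_Im, Og6]|].
      apply bigO_plus.
      + exact (bigO_mult pos 0 6 _ _ Of0 (epsO_conj _ _ Of6)).
      + exact (bigO_mult pos 6 0 _ _ Of6 (epsO_conj _ _ Ba)). }
  apply (epsO_poly5 0).
  unfold regrouped, tail2 in OX. rewrite a00, b00 in OX. fold P1 P2 P3 P4 P5 Q1 Q2 Q3 Q4 Q5 in OX.
  set (p1 := P1 z w) in *. set (p2 := P2 z w) in *. set (p3 := P3 z w) in *. set (p4 := P4 z w) in *. set (p5 := P5 z w) in *.
  set (q1 := Q1 z w) in *. set (q2 := Q2 z w) in *. set (q3 := Q3 z w) in *. set (q4 := Q4 z w) in *. set (q5 := Q5 z w) in *.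
  assert (ImE : forall (x : R) c d, RtoC (Im (c + RtoC x * d)%C) = (RtoC (Im c) + RtoC x * RtoC (Im d))%C).
  { intros x c c'. apply C_eq; rewrite ?re_plus, ?im_plus, ?re_mult, ?im_mult, ?re_RtoC, ?im_RtoC; [|ring].
    ring. }
  apply (bigO_ext pos 6 (fun e : posreal => (RtoC (Im (0 + RtoC e * (q1 + RtoC e * (q2 + RtoC e * (q3 + RtoC e * (q4 + RtoC e * q5)))))%C)
     - (0 + RtoC e * (p1 + RtoC e * (p2 + RtoC e * (p3 + RtoC e * (p4 + RtoC e * p5)))))
       * Cconj (0 + RtoC e * (p1 + RtoC e * (p2 + RtoC e * (p3 + RtoC e * (p4 + RtoC e * p5))))))
     + RtoC e ^ 6 * ((p1 * Cconj p5 + p2 * Cconj p4 + p3 * Cconj p3 + p4 * Cconj p2 + p5 * Cconj p1)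
        + RtoC e * ((p2 * Cconj p5 + p3 * Cconj p4 + p4 * Cconj p3 + p5 * Cconj p2)
        + RtoC e * ((p3 * Cconj p5 + p4 * Cconj p4 + p5 * Cconj p3)
        + RtoC e * ((p4 * Cconj p5 + p5 * Cconj p4) + RtoC e * (p5 * Cconj p5))))))%C).
  - intros e. rewrite !ImE, !Cplus_conj, !Cmult_conj, !Cplus_conj, !Cmult_conj, !Cplus_conj, !Cmult_conj,
      !Cplus_conj, !Cmult_conj, !Cplus_conj, !Cmult_conj, !Cconj_R. simpl (Im 0). ring.
  - apply bigO_plus; [exact OX|].
    apply (bigO_mult pos 6 0); [exact (bigO_pow pos 1 _ 6 epsO_id)|].
    do 4 apply epsO_horner. apply bigO_const. }
assert (Take : forall (i : R) (c : C), (RtoC i - c)%C = RtoC 0 -> i = Re c).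
{ intros i c Hic. apply (f_equal Re) in Hic. rewrite re_minus, !re_RtoC in Hic. lra. }
apply (projective_2jet (a 1 0) (a 0 1) (a 2 0) (a 1 1) (a 3 0) (a 0 2) (a 2 1) (a 4 0)
   (b 1 0) (b 0 1) (b 2 0) (b 1 1) (b 3 0) (b 0 2) (b 2 1) (b 4 0) (b 1 2) (b 3 1) (b 5 0))%nat;
intros z t; try intros w; destruct (Weights z t) as [Z1 [Z2 [Z3 [Z4 Z5]]]].
- exact (Take _ _ Z1).
- exact (Take _ _ Z2).
- exact (Take _ _ Z3).
- exact (Take _ _ Z4).
- exact (Take _ _ Z5).
Qed.

(** * Local inverses of class C^2 *)

Lemma is_derive_epsilon_R (u : R -> R) t l :
  is_derive u t l <->
  forall e, 0 < e -> exists d, 0 < d /\ forall s, Rabs (s - t) < d ->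
    Rabs (u s - u t - (s - t) * l) <= e * Rabs (s - t).
Proof.
assert (Hc : is_derive u t l <-> is_derive (V := CR) (fun s => RtoC (u s)) t (RtoC l)).
{ rewrite is_derive_C. split; [|intros [H _]; exact H].
  intros H. split; [exact H|]. exact (is_derive_const (V := R_NormedModule) 0 t). }
rewrite Hc, is_derive_epsilon.
split; intros H e He; destruct (H e He) as [d [Hd H']]; exists d; (split; [exact Hd|]); intros s Hs;
specialize (H' s Hs).
- rewrite <- RtoC_mult, <- !RtoC_minus, Cmod_R in H'. exact H'.
- rewrite <- RtoC_mult, <- !RtoC_minus, Cmod_R. exact H'.
Qed.

(** Near 0 the derivative is at least [m > 0], so [U] expands distances by [m]. The
    inverse, given by the intermediate value theorem, is then Lipschitz, hence differentiable
    with derivative [1 / U'], which is differentiable in turn. *)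
Lemma inverse_jet2_pos (U : R -> R) u1 u2 :
  has_jet2 (V := R_NormedModule) U 0 u1 u2 -> 0 < u1 ->
  exists (h : R -> R) h1 h2, has_jet2 (V := R_NormedModule) h 0 h1 h2 /\ h1 <> 0 /\
    locally 0 (fun t => U (h t) = t).
Proof.
intros HU Hu1. pose proof HU as [U1 [U2 [H [H0 [HU1 HU2]]]]].
assert (Hpos : locally 0 (fun t => u1 / 2 < U1 t)).
{ destruct H as [d Hd]. destruct (Hd 0 (ball_center _ _)) as [_ [HD _]].
  apply (is_derive_continuous (V := R_NormedModule)) in HD.
  apply HD. rewrite HU1. assert (0 < u1 / 2) as Hm by lra.
  exists (mkposreal _ Hm). intros y Hy. change (Rabs (y - u1) < u1 / 2) in Hy.
  apply Rabs_def2 in Hy. lra. }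
destruct (filter_and _ _ H Hpos) as [r0 Hr0].
assert (HD : forall t, Rabs t < r0 -> is_derive U t (U1 t) /\ is_derive U1 t (U2 t) /\ continuous U2 t /\ u1 / 2 < U1 t).
{ intros t Ht. destruct (Hr0 t) as [[A [B C]] D]; [|auto].
  change (Rabs (t - 0) < r0). rewrite Rminus_0_r. exact Ht. }
clear H Hpos Hr0. pose proof (cond_pos r0) as Pr0. set (r := r0 / 2).
assert (Hr : 0 < r < r0) by (unfold r; lra).
set (m := u1 / 2) in *. assert (Hm : 0 < m) by (unfold m; lra).
assert (Hexp : forall a b, Rabs a < r0 -> Rabs b < r0 -> a <= b -> m * (b - a) <= U b - U a).
{ intros a b Ha Hb Hab. apply Rabs_def2 in Ha, Hb.
  destruct (MVT_gen U a b U1) as [c [Hc Hc']].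
  - rewrite Rmin_left, Rmax_right by lra. intros x Hx. apply HD. apply Rabs_def1; lra.
  - rewrite Rmin_left, Rmax_right by lra. intros x Hx. apply continuity_pt_filterlim.
    apply (is_derive_continuous (V := R_NormedModule) U x (U1 x)). apply HD. apply Rabs_def1; lra.
  - rewrite Rmin_left, Rmax_right in Hc by lra. rewrite Hc'.
    apply Rmult_le_compat_r; [lra|]. left. apply HD. apply Rabs_def1; lra. }
assert (Habs : forall a b, Rabs a < r0 -> Rabs b < r0 -> m * Rabs (a - b) <= Rabs (U a - U b)).
{ intros a b Ha Hb. destruct (Rle_dec a b) as [L|L].
  - specialize (Hexp a b Ha Hb L). rewrite (Rabs_minus_sym a b), (Rabs_minus_sym (U a)).
    rewrite (Rabs_pos_eq (b - a)) by lra. eapply Rle_trans; [exact Hexp|apply Rle_abs].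
  - specialize (Hexp b a Hb Ha ltac:(lra)).
    rewrite (Rabs_pos_eq (a - b)) by lra. eapply Rle_trans; [exact Hexp|apply Rle_abs]. }
assert (Hex : forall s, Rabs s < m * r -> exists t, Rabs t < r /\ U t = s).
{ intros s Hs. apply Rabs_def2 in Hs.
  assert (Rabs r < r0) by (rewrite Rabs_pos_eq; lra).
  assert (Rabs (- r) < r0) by (rewrite Rabs_Ropp; assumption).
  assert (Rabs 0 < r0) by (rewrite Rabs_R0; assumption).
  assert (E1 : m * (r - 0) <= U r - U 0) by (apply Hexp; try assumption; lra).
  assert (E2 : m * (0 - - r) <= U 0 - U (- r)) by (apply Hexp; try assumption; lra).
  destruct (IVT_interv (fun t => U t - s) (- r) r) as [t [Ht1 Ht2]].
  - intros a Ha. apply continuity_pt_minus; [|apply continuity_pt_const; intros x y; reflexivity].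
    apply continuity_pt_filterlim. apply (is_derive_continuous (V := R_NormedModule) U a (U1 a)).
    apply HD. apply Rabs_def1; lra.
  - lra.
  - rewrite H0 in E2. lra.
  - rewrite H0 in E1. lra.
  - exists t. split; [|lra].
    assert (Habs0 := Habs t 0). rewrite H0, !Rminus_0_r in Habs0.
    assert (Hts : U t = s) by lra. rewrite Hts in Habs0.
    assert (Ht : Rabs t < r0) by (apply Rabs_def1; lra).
    specialize (Habs0 Ht ltac:(rewrite Rabs_R0; lra)).
    assert (Rabs s < m * r) by (apply Rabs_def1; lra).
    apply Rmult_lt_reg_l with m; lra. }
set (h := fun s => epsilon (inhabits 0) (fun t => Rabs t < r /\ U t = s)).
assert (Hh : forall s, Rabs s < m * r -> Rabs (h s) < r /\ U (h s) = s).
{ intros s Hs. unfold h. apply epsilon_spec, Hex, Hs. }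
assert (Hmr : 0 < m * r) by (apply Rmult_lt_0_compat; lra).
assert (Hh0 : h 0 = 0).
{ destruct (Hh 0) as [A B]; [rewrite Rabs_R0; exact Hmr|].
  assert (E := Habs (h 0) 0). rewrite B, H0, Rminus_0_r, Rminus_0_r, Rabs_R0 in E.
  specialize (E ltac:(lra) ltac:(lra)).
  apply Rabs_eq_0. apply Rle_antisym; [|apply Rabs_pos].
  apply Rmult_le_reg_l with m; lra. }
assert (Dh : forall s, Rabs s < m * r -> is_derive h s (/ U1 (h s))).
{ intros s Hs. destruct (Hh s Hs) as [A B].
  destruct (HD (h s)) as [D1 [_ [_ D4]]]; [lra|].
  set (l := U1 (h s)) in *. assert (Hl : 0 < l) by lra.
  rewrite is_derive_epsilon_R in D1. apply is_derive_epsilon_R.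
  intros e He.
  assert (He' : 0 < e * l * m) by (apply Rmult_lt_0_compat; [apply Rmult_lt_0_compat|]; assumption).
  destruct (D1 _ He') as [d [Hd D1']].
  exists (Rmin (m * d) (m * r - Rabs s)). split; [apply Rmin_pos; [apply Rmult_lt_0_compat; assumption|lra]|].
  intros s' Hs'.
  assert (L1 : Rabs (s' - s) < m * d) by (eapply Rlt_le_trans; [exact Hs'|apply Rmin_l]).
  assert (L2 : Rabs (s' - s) < m * r - Rabs s) by (eapply Rlt_le_trans; [exact Hs'|apply Rmin_r]).
  assert (L3 : Rabs s' < m * r).
  { replace s' with ((s' - s) + s) by ring. eapply Rle_lt_trans; [apply Rabs_triang|]. lra. }
  destruct (Hh s' L3) as [A' B'].
  pose proof (Habs (h s') (h s) ltac:(lra) ltac:(lra)) as G. rewrite B, B' in G.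
  assert (G' : Rabs (h s' - h s) < d) by (apply Rmult_lt_reg_l with m; lra).
  specialize (D1' _ G'). rewrite B, B' in D1'.
  replace (h s' - h s - (s' - s) * / l) with (- / l * (s' - s - (h s' - h s) * l)) by (field; lra).
  rewrite Rabs_mult, Rabs_Ropp, Rabs_inv, (Rabs_pos_eq l) by lra.
  apply Rmult_le_reg_l with l; [exact Hl|].
  replace (l * (/ l * Rabs (s' - s - (h s' - h s) * l))) with (Rabs (s' - s - (h s' - h s) * l)) by (field; lra).
  eapply Rle_trans; [exact D1'|].
  replace (e * l * m * Rabs (h s' - h s)) with (e * l * (m * Rabs (h s' - h s))) by ring.
  replace (l * (e * Rabs (s' - s))) with (e * l * Rabs (s' - s)) by ring.
  apply Rmult_le_compat_l; [apply Rmult_le_pos; lra|exact G]. }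
assert (D2h : forall s, Rabs s < m * r ->
  is_derive (fun s => / U1 (h s)) s (- (/ U1 (h s) * U2 (h s)) / (U1 (h s)) ^ 2)).
{ intros s Hs. destruct (Hh s Hs) as [A B]. destruct (HD (h s)) as [D1 [D2 [_ D4]]]; [lra|].
  apply (is_derive_inv (fun s => U1 (h s)) s (/ U1 (h s) * U2 (h s))); [|lra].
  exact (is_derive_comp (V := R_NormedModule) U1 h s (U2 (h s)) (/ U1 (h s)) D2 (Dh s Hs)). }
assert (Hloc : locally 0 (fun s => Rabs s < m * r)).
{ exists (mkposreal _ Hmr). intros s Hs. change (Rabs (s - 0) < m * r) in Hs. rewrite Rminus_0_r in Hs. exact Hs. }
exists h, (/ U1 (h 0)), (- (/ U1 (h 0) * U2 (h 0)) / (U1 (h 0)) ^ 2).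
split; [|split].
- exists (fun s => / U1 (h s)), (fun s => - (/ U1 (h s) * U2 (h s)) / (U1 (h s)) ^ 2).
  split; [|auto]. revert Hloc. apply filter_imp. intros s Hs.
  split; [apply Dh, Hs|]. split; [apply D2h, Hs|].
  destruct (Hh s Hs) as [A B]. destruct (HD (h s)) as [D1 [D2 [D3 D4]]]; [lra|].
  pose proof (is_derive_continuous (V := R_NormedModule) _ _ _ (D2h s Hs)) as C1.
  pose proof (is_derive_continuous (V := R_NormedModule) _ _ _ (Dh s Hs)) as Ch.
  assert (C2 : continuous (fun s => U2 (h s)) s) by (apply (continuous_comp h U2); assumption).
  apply (continuous_ext (fun s => - ((/ U1 (h s) * U2 (h s)) * (/ U1 (h s) * / U1 (h s))))).
  { intros x. match goal with |- @eq _ ?a ?b => change (@eq R a b) end. unfold Rdiv. rewrite <- pow_inv. ring. }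
  apply (continuous_opp (V := R_NormedModule)).
  apply (continuous_mult (K := R_AbsRing)); apply (continuous_mult (K := R_AbsRing)); assumption.
- rewrite Hh0, HU1. apply Rinv_neq_0_compat. lra.
- revert Hloc. apply filter_imp. intros s Hs. apply Hh, Hs.
Qed.

(** A decreasing [U] is replaced by [- U], and its inverse composed with [t -> - t]. *)
Lemma inverse_jet2 (U : R -> R) u1 u2 :
  has_jet2 (V := R_NormedModule) U 0 u1 u2 -> u1 <> 0 ->
  exists (h : R -> R) h1 h2, has_jet2 (V := R_NormedModule) h 0 h1 h2 /\ h1 <> 0 /\
    locally 0 (fun t => U (h t) = t).
Proof.
assert (Opp : forall f a b c, has_jet2 (V := R_NormedModule) f a b c ->
   has_jet2 (V := R_NormedModule) (fun t => - f t) (- a) (- b) (- c)).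
{ intros f a b c [f1 [f2 [H [H0 [H1 H2]]]]]. exists (fun t => - f1 t), (fun t => - f2 t).
  rewrite H0, H1, H2. split; [|auto]. revert H. apply filter_imp. intros t [A [B C]].
  split; [|split].
  - apply (is_derive_opp (V := R_NormedModule)), A.
  - apply (is_derive_opp (V := R_NormedModule)), B.
  - apply (continuous_opp (V := R_NormedModule)), C. }
intros HU Hu1. destruct (Rlt_dec 0 u1) as [L|L].
- apply inverse_jet2_pos with u1 u2; assumption.
- apply Opp in HU. rewrite Ropp_0 in HU.
  destruct (inverse_jet2_pos _ _ _ HU) as [h [h1 [h2 [Hh [Hh1 Hl]]]]]; [lra|].
  assert (Neg : forall P : R -> Prop, locally 0 P -> locally 0 (fun t => P (- t))).
  { intros P [d Hd]. exists d. intros t Ht. apply Hd.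
    change (Rabs (t - 0) < d) in Ht. change (Rabs (- t - 0) < d).
    rewrite Rminus_0_r in *. rewrite Rabs_Ropp. exact Ht. }
  exists (fun t => h (- t)), (- h1), h2. split; [|split; [lra|]].
  + destruct Hh as [k1 [k2 [H [H0 [H1 H2]]]]].
    exists (fun t => - k1 (- t)), (fun t => k2 (- t)). rewrite Ropp_0, H0, H1, H2. split; [|auto].
    generalize (Neg _ H). apply filter_imp. intros t [A [B C]].
    assert (N : is_derive (fun t => - t) t (-1)).
    { apply (is_derive_opp (V := R_NormedModule) (fun t => t) t 1). apply (is_derive_id (K := R_AbsRing)). }
    split; [|split].
    * replace (- k1 (- t)) with (scal (-1) (k1 (- t)) : R) by (unfold scal; simpl; unfold mult; simpl; ring).
      exact (is_derive_comp (V := R_NormedModule) h (fun t => - t) t _ _ A N).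
    * replace (k2 (- t)) with (- (scal (-1) (k2 (- t)) : R)) by (unfold scal; simpl; unfold mult; simpl; ring).
      apply (is_derive_opp (V := R_NormedModule)).
      exact (is_derive_comp (V := R_NormedModule) k1 (fun t => - t) t _ _ B N).
    * apply (continuous_comp (fun t : R => - t) k2); [|exact C].
      apply (is_derive_continuous (V := R_NormedModule) _ t _ N).
  + generalize (Neg _ Hl). apply filter_imp. intros t E. lra.
Qed.

(** * Jets of curves under holomorphic maps *)

(** The differential [L] is complex linear, hence commutes with [J]. The term [Q v] is the
    second derivative of [F] in the direction [v]. *)
Lemma jet_map (F : C2 -> C2) q : holomorphic_map_at F q ->
  exists L Q : C2 -> C2, (forall v, L (J v) = J (L v)) /\
  (forall g v, has_jet1 g q v -> has_jet1 (fun t => F (g t)) (F q) (L v)) /\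
  (forall g v w, has_jet2 g q v w ->
    has_jet2 (fun t => F (g t)) (F q) (L v) (plus (L w) (Q v))).
Proof.
intros [H1 H2].
destruct (jet_holomorphic _ q H1) as [A1 [A2 [QA [A3 A4]]]].
destruct (jet_holomorphic _ q H2) as [B1 [B2 [QB [B3 B4]]]].
exists (fun v => ((fst v * A1 + snd v * A2)%C, (fst v * B1 + snd v * B2)%C)).
exists (fun v => (QA v, QB v)).
split; [|split].
- intros [x y]. unfold J. cbn [fst snd]. f_equal; Cring.
- intros g v Hg. apply jet1_C2. split; [exact (A3 g v Hg)|exact (B3 g v Hg)].
- intros g v w Hg. apply jet2_C2. split; [exact (A4 g v w Hg)|exact (B4 g v w Hg)].
Qed.

Lemma jet2_translate {V : NormedModule R_AbsRing} (g : R -> V) a v w c :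
  has_jet2 g a v w -> has_jet2 (fun t => plus (g t) c) (plus a c) v w.
Proof.
intros [g1 [g2 [H [H0 [H1 H2]]]]]. exists g1, g2. split; [|rewrite H0; auto].
revert H. apply filter_imp. intros t [A B]. split; [|exact B].
rewrite <- (plus_zero_r (g1 t)).
apply (is_derive_plus g (fun _ => c)); [exact A|apply is_derive_const].
Qed.

Lemma jet1_translate {V : NormedModule R_AbsRing} (g : R -> V) a v c :
  has_jet1 g a v -> has_jet1 (fun t => plus (g t) c) (plus a c) v.
Proof.
intros [g1 [H [H0 H1]]]. exists g1. split; [|rewrite H0; auto].
revert H. apply filter_imp. intros t [A B]. split; [|exact B].
rewrite <- (plus_zero_r (g1 t)).
apply (is_derive_plus g (fun _ => c)); [exact A|apply is_derive_const].
Qed.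

Lemma jet2_RtoC (h : R -> R) a b c :
  has_jet2 (V := R_NormedModule) h a b c -> has_jet2 (V := CR) (fun t => RtoC (h t)) (RtoC a) (RtoC b) (RtoC c).
Proof.
rewrite !has_jet2_jet1. intros [h1 [H [H0 H1]]]. exists (fun t => RtoC (h1 t)).
split; [|split; [rewrite H0; reflexivity|apply jet1_RtoC, H1]].
revert H. apply filter_imp. intros t A. apply is_derive_C. split; [exact A|].
exact (is_derive_const (V := R_NormedModule) 0 t).
Qed.
Arguments jet2_RtoC {h a b c}.

Lemma jet2_unique_R (h : R -> R) (a b c a' b' c' : R) :
  has_jet2 (V := R_NormedModule) h a b c -> has_jet2 (V := R_NormedModule) h a' b' c' ->
  a = a' /\ b = b' /\ c = c'.
Proof.
intros H H'. apply jet2_RtoC in H. apply jet2_RtoC in H'.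
destruct (jet2_unique_C H H') as [E1 [E2 E3]].
apply RtoC_inj in E1, E2, E3. auto.
Qed.
Arguments jet2_unique_R {h a b c a' b' c'}.

Lemma jet2_comp_R (h k : R -> R) (h1 h2 k1 k2 : R) :
  has_jet2 (V := R_NormedModule) h 0 h1 h2 -> has_jet2 (V := R_NormedModule) k 0 k1 k2 ->
  exists c, has_jet2 (V := R_NormedModule) (fun t => h (k t)) 0 (k1 * h1) c.
Proof.
intros Hh Hk. pose proof (jet2_Re (jet2_comp _ _ _ _ _ _ _ (jet2_RtoC Hh) Hk)) as H.
rewrite re_mult, !re_RtoC, !im_RtoC, Rmult_0_l, Rminus_0_r in H.
eexists. exact H.
Qed.

Lemma jet2_id : has_jet2 (V := R_NormedModule) (fun t => t) 0 1 0.
Proof.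
exists (fun _ => 1), (fun _ => 0). split; [|auto]. apply filter_forall. intros t.
split; [|split].
- apply (is_derive_id (K := R_AbsRing)).
- exact (is_derive_const (V := R_NormedModule) 1 t).
- apply continuous_const.
Qed.

Lemma jet1_dilation (r : R) : has_jet1 (V := R_NormedModule) (fun t => r * t) 0 r.
Proof.
exists (fun _ => r). split; [|split; [exact (Rmult_0_r r)|reflexivity]]. apply filter_forall. intros t.
split; [|apply continuous_const].
auto_derive; [exact I|ring].
Qed.

(** * Tangent vectors *)

Lemma tangent_jet1 (M : C2 -> Prop) q v :
  tangent M q v <-> exists g, locally 0 (fun t => M (g t)) /\ has_jet1 g q v.
Proof.
split.
- intros [g [g1 [H [H0 H1]]]]. exists g. split.
  + revert H. apply filter_imp. intros t Ht; apply Ht.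
  + exists g1. split; [|auto]. revert H. apply filter_imp. intros t Ht; apply Ht.
- intros [g [HM [g1 [H [H0 H1]]]]]. exists g, g1. split; [|auto].
  exact (filter_and _ _ HM H).
Qed.

(** Curves are mapped to curves, and the differential commutes with [J]. *)
Lemma complex_tangent_push (M N : C2 -> Prop) (F L : C2 -> C2) q q' v :
  (forall v, L (J v) = J (L v)) ->
  (forall g v, has_jet1 g q v -> has_jet1 (fun t => F (g t)) q' (L v)) ->
  locally q (fun a => M a -> N (F a)) ->
  complex_tangent M q v -> complex_tangent N q' (L v).
Proof.
intros HJ HL HMN.
assert (HT : forall v, tangent M q v -> tangent N q' (L v)).
{ intros v'. rewrite !tangent_jet1. intros [g [Hg Hv]]. exists (fun t => F (g t)).
  split; [|apply HL, Hv].
  apply filter_imp with (2 := filter_and _ _ Hg (jet1_near Hv HMN)). intros t [A B]. auto. }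
intros [Hv [w [Hw ->]]]. split; [apply HT, Hv|].
exists (L w). split; [apply HT, Hw|apply HJ].
Qed.

Lemma complex_tangent_scal (M : C2 -> Prop) q (r : R) v :
  complex_tangent M q v -> complex_tangent M q (Cscal2 r v).
Proof.
assert (HT : forall v, tangent M q v -> tangent M q (Cscal2 r v)).
{ intros v'. rewrite !tangent_jet1. intros [g [Hg Hv]]. exists (fun t => g (r * t)).
  pose proof (jet1_dilation r) as Hr.
  split; [|apply jet1_reparam; assumption].
  exact (jet1_near (V := R_NormedModule) Hr Hg). }
intros [Hv [w [Hw ->]]]. split; [apply HT, Hv|].
exists (Cscal2 r w). split; [apply HT, Hw|].
unfold J, Cscal2. simpl. f_equal; Cring.
Qed.

(** * Geometry of a normal form at the origin *)

Lemma jet1_lipschitz (u : R -> C) (v : C) : has_jet1 (V := CR) u (RtoC 0) v ->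
  exists K d, 0 <= K /\ 0 < d /\ forall t, Rabs t < d -> Cmod (u t) <= K * Rabs t.
Proof.
intros Hu. pose proof (jet1_value Hu) as H0.
apply jet1_derive in Hu. rewrite is_derive_epsilon in Hu.
destruct (Hu 1 Rlt_0_1) as [d [Hd H]].
exists (1 + Cmod v), d. pose proof (Cmod_ge_0 v). split; [lra|]. split; [exact Hd|]. intros t Ht.
specialize (H t). rewrite H0, Rminus_0_r in H. specialize (H Ht).
replace (u t) with ((u t - 0 - RtoC t * v) + RtoC t * v)%C by ring.
eapply Rle_trans; [apply Cmod_triangle|]. rewrite Cmod_mult, Cmod_R. lra.
Qed.
Arguments jet1_lipschitz {u v}.

(** Along a curve of class C^1 through the origin [z] and [u] are O(t), so [|z|^2 + |u|] is
    O(t) and its cube is O(t^3). *)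
Lemma remainder_along E (z : R -> C) (u : R -> R) (z1 : C) (u1 : R) :
  weight6_remainder E -> has_jet1 (V := CR) z (RtoC 0) z1 -> has_jet1 (V := R_NormedModule) u 0 u1 ->
  exists K d, 0 < d /\ forall t, 0 <= t < d -> Rabs (E (z t) (u t)) <= K * t ^ 3.
Proof.
intros [K [d [Hd HE]]] Hz Hu.
destruct (jet1_lipschitz Hz) as [K1 [d1 [HK1 [Hd1 H1]]]].
destruct (jet1_lipschitz (jet1_RtoC Hu)) as [K2 [d2 [HK2 [Hd2 H2]]]].
assert (P1 : 0 < d / (K1 + 1)) by (apply Rdiv_lt_0_compat; lra).
assert (P2 : 0 < d / (K2 + 1)) by (apply Rdiv_lt_0_compat; lra).
exists (Rmax K 0 * (K1 ^ 2 + K2) ^ 3).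
exists (Rmin (Rmin (Rmin d1 d2) (Rmin (d / (K1 + 1)) (d / (K2 + 1)))) 1).
split; [repeat apply Rmin_pos; try assumption; lra|].
intros t [Ht Htd]. apply Rmin_Rgt_l in Htd. destruct Htd as [Htd L5].
apply Rmin_Rgt_l in Htd. destruct Htd as [L L'].
apply Rmin_Rgt_l in L, L'. destruct L as [L1 L2], L' as [L3 L4].
assert (Hat : Rabs t = t) by (apply Rabs_pos_eq, Ht).
specialize (H1 t ltac:(lra)). specialize (H2 t ltac:(lra)). rewrite Cmod_R in H2. rewrite Hat in H1, H2.
assert (t * (K1 + 1) < d) by (apply lt_div_succ; lra).
assert (t * (K2 + 1) < d) by (apply lt_div_succ; lra).
eapply Rle_trans; [apply HE; lra|].
pose proof (pow2_ge_0 (Cmod (z t))). pose proof (Rabs_pos (u t)). pose proof (Cmod_ge_0 (z t)).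
apply Rle_trans with (Rmax K 0 * (Cmod (z t) ^ 2 + Rabs (u t)) ^ 3).
{ apply Rmult_le_compat_r; [apply pow_le; lra|apply Rmax_l]. }
rewrite Rmult_assoc, <- Rpow_mult_distr. apply Rmult_le_compat_l; [apply Rmax_r|].
apply pow_incr. split; [lra|].
assert (Cmod (z t) ^ 2 <= (K1 * t) ^ 2) by (apply pow_incr; lra).
assert ((K1 * t) ^ 2 <= K1 ^ 2 * t).
{ replace ((K1 * t) ^ 2) with (K1 ^ 2 * (t * t)) by ring. apply Rmult_le_compat_l; [apply pow2_ge_0|nra]. }
lra.
Qed.

(** The vector [(x, 0)] is the velocity of the curve [t -> (x t, i (|x t|^2 + E(x t, 0)))]
    of [N], which is smooth by the last clause of [normal_form_equation] and whose term [E] is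
    O(t^3). The same holds for [(- i x, 0)], of which [(x, 0)] is the image by [J]. *)
Lemma normal_form_complex_tangent N (x : C) :
  normal_form N -> complex_tangent N zero (x, RtoC 0).
Proof.
intros HN. destruct (normal_form_equation N HN) as [E [d [Hd [RE [EqN [F [HF HFE]]]]]]].
assert (HT : forall x : C, tangent N zero (x, RtoC 0)).
{ clear x. intros x.
  set (z := fun t => (x * RtoC t)%C).
  assert (Jz : has_jet2 (V := CR) z (RtoC 0) x (RtoC 0)).
  { pose proof (jet2_scal x (jet2_RtoC jet2_id)) as H.
    rewrite !Cmult_0_r, Cmult_1_r in H. exact H. }
  assert (Jzz : has_jet2 (fun t => (z t, Cconj (z t)) : C2) zero (x, Cconj x) (RtoC 0, RtoC 0)).
  { apply jet2_C2. split; [exact Jz|].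
    pose proof (jet2_conj Jz) as H. rewrite !Cconj_R in H. exact H. }
  destruct (jet_holomorphic F zero HF) as [D1 [D2 [Q [_ HQ]]]].
  specialize (HQ _ _ _ Jzz).
  assert (HFz : locally 0 (fun t => F (z t, Cconj (z t)) = RtoC (E (z t) 0))).
  { assert (Hl : locally (zero : C2) (fun b : C2 => Cmod (fst b) < d)).
    { apply locally_C2. exists d. split; [exact Hd|]. intros b Hb _. rewrite fst_sub_zero in Hb. exact Hb. }
    pose proof (jet1_near (jet2_is_jet1 Jzz) Hl) as H.
    revert H. apply filter_imp. intros t Ht. apply HFE. exact Ht. }
  assert (JE : exists a b c, has_jet2 (V := CR) (fun t => RtoC (E (z t) 0)) a b c).
  { eexists _, _, _. exact (jet2_ext HFz HQ). }
  destruct JE as [a [b [c JE]]].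
  destruct (remainder_along E z (fun _ => 0) x 0 RE (jet2_is_jet1 Jz)) as [K [dd [Hdd HK]]].
  { exists (fun _ => 0). split; [|auto]. apply filter_forall. intros t. split.
    - exact (is_derive_const (V := R_NormedModule) 0 t).
    - apply continuous_const. }
  destruct (flat_jet2 _ _ _ _ K dd JE Hdd) as [-> [-> ->]].
  { intros t Ht. rewrite Cmod_R. apply HK, Ht. }
  pose proof (jet2_mult Jz (jet2_conj Jz)) as Jm.
  pose proof (jet2_scal Ci (jet2_plus Jm JE)) as Jw.
  apply tangent_jet1.
  exists (fun t => (z t, (Ci * (z t * Cconj (z t) + RtoC (E (z t) 0)))%C)).
  assert (Jc : has_jet1 (fun t => (z t, (Ci * (z t * Cconj (z t) + RtoC (E (z t) 0)))%C) : C2) zero (x, RtoC 0)).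
  { apply jet1_C2. split; [exact (jet2_is_jet1 Jz)|].
    pose proof (jet2_is_jet1 Jw) as H. cbn [fst snd].
    change (snd (zero : C2)) with (RtoC 0).
    replace (Ci * (0 * Cconj 0 + 0))%C with (RtoC 0) in H by ring.
    replace (Ci * (x * Cconj 0 + 0 * Cconj x + 0))%C with (RtoC 0) in H by (rewrite Cconj_R; ring).
    exact H. }
  split; [|exact Jc].
  assert (Hl : locally (zero : C2) (fun b : C2 => Cmod (fst b) < d /\ Cmod (snd b) < d)).
  { apply locally_C2. exists d. split; [exact Hd|]. intros b Hb Hb'.
    rewrite fst_sub_zero in Hb. rewrite snd_sub_zero in Hb'. auto. }
  pose proof (jet1_near Jc Hl) as H. revert H. apply filter_imp.
  intros t [L1 L2]. apply EqN; [exact L1|exact L2|]. cbn [fst snd].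
  replace (z t * Cconj (z t))%C with (RtoC (Re (z t * Cconj (z t))%C)).
  2:{ apply C_eq; rewrite ?re_RtoC, ?im_RtoC; [reflexivity|]. rewrite im_mult, re_conj, im_conj. ring. }
  rewrite <- RtoC_plus, <- (Cplus_0_l (Ci * _)), im_cart, re_cart. reflexivity. }
split; [apply HT|]. exists (- Ci * x, RtoC 0)%C. split; [apply HT|].
unfold J. cbn [fst snd]. f_equal.
- transitivity (- (Ci * Ci) * x)%C; [rewrite Ci2; ring|ring].
- ring.
Qed.

(** The remainder is O(t^3) along the curve, so the equation [v = z zbar] holds for 2-jets. *)
Lemma normal_form_jets N (g : R -> C2) v w :
  normal_form N -> locally 0 (fun t => N (g t)) -> has_jet2 g zero v w ->
  Im (snd v) = 0 /\ Im (snd w) = 2 * Re (fst v * Cconj (fst v))%C.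
Proof.
intros HN HgN Hg. destruct (normal_form_equation N HN) as [E [d [Hd [RE [EqN _]]]]].
pose proof (jet2_is_jet1 Hg) as Hg1.
pose proof Hg as Hg2. apply jet2_C2 in Hg2. destruct Hg2 as [Jz Jw].
change (fst (zero : C2)) with (RtoC 0) in Jz. change (snd (zero : C2)) with (RtoC 0) in Jw.
pose proof (jet2_is_jet1 Jz) as Jz1.
destruct (remainder_along E _ _ _ _ RE Jz1 (jet2_is_jet1 (jet2_Re Jw))) as [K [d1 [Hd1 HK]]].
assert (Hl : locally (zero : C2) (fun b : C2 => Cmod (fst b) < d /\ Cmod (snd b) < d)).
{ apply locally_C2. exists d. split; [exact Hd|]. intros b Hb Hb'.
  rewrite fst_sub_zero in Hb. rewrite snd_sub_zero in Hb'. auto. }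
destruct (filter_and _ _ HgN (jet1_near Hg1 Hl)) as [d2 Hd2].
pose proof (jet2_RtoC (jet2_Im Jw)) as JI.
pose proof (jet2_mult Jz (jet2_conj Jz)) as Jm.
pose proof (jet2_plus JI (jet2_scal (-(1))%C Jm)) as Jr.
pose proof (cond_pos d2) as Pd2.
apply (flat_jet2 _ _ _ _ K (Rmin d1 d2)) in Jr.
- destruct Jr as [_ [R1 R2]]. rewrite Cconj_R in R1, R2.
  apply (f_equal Re) in R1, R2.
  repeat rewrite ?re_plus, ?re_mult, ?im_plus, ?im_mult, ?re_opp, ?im_opp, ?re_RtoC, ?im_RtoC, ?re_conj, ?im_conj in R1.
  repeat rewrite ?re_plus, ?re_mult, ?im_plus, ?im_mult, ?re_opp, ?im_opp, ?re_RtoC, ?im_RtoC, ?re_conj, ?im_conj in R2.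
  rewrite re_mult, re_conj, im_conj. split; lra.
- apply Rmin_pos; assumption.
- intros t [Ht Htd]. apply Rmin_Rgt_l in Htd. destruct Htd as [L1 L2].
  destruct (Hd2 t) as [A [B B']].
  { change (Rabs (t - 0) < d2). rewrite Rminus_0_r, Rabs_pos_eq; lra. }
  apply EqN in A; [|exact B|exact B']. rewrite A.
  replace (_ + _)%C with (RtoC (E (fst (g t)) (Re (snd (g t))))).
  + rewrite Cmod_R. apply HK. lra.
  + apply C_eq; repeat rewrite ?re_plus, ?re_mult, ?im_plus, ?im_mult, ?re_opp, ?im_opp, ?re_RtoC, ?im_RtoC, ?re_conj, ?im_conj; ring.
Qed.

Lemma transversal_jet (M : C2 -> Prop) q g v w :
  transversal_curve M q g -> has_jet2 g q v w -> ~ complex_tangent M q v.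
Proof.
intros [_ [v' [w' [Hg Hv]]]] H.
destruct (jet2_unique H Hg) as [_ [-> _]]. exact Hv.
Qed.

(** Otherwise the velocity would be [(x, 0)], since the imaginary part of its second
    component is 0 as well. *)
Lemma normal_form_transversal N g v w :
  normal_form N -> transversal_curve N zero g -> has_jet2 g zero v w -> Re (snd v) <> 0.
Proof.
intros HN Ht Hg Hv. pose proof (transversal_jet _ _ _ _ _ Ht Hg) as Hn.
destruct (normal_form_jets N g v w HN (proj1 Ht) Hg) as [Hi _].
apply Hn. replace v with ((fst v, RtoC 0) : C2); [apply normal_form_complex_tangent, HN|].
destruct v as [x y]. cbn [fst snd] in *. assert (y = RtoC 0) as -> by (apply C_eq; assumption). reflexivity.
Qed.

Lemma transversal_reparam M q (g : R -> C2) h (h1 h2 : R) :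
  transversal_curve M q g -> has_jet2 (V := R_NormedModule) h 0 h1 h2 -> h1 <> 0 ->
  transversal_curve M q (fun t => g (h t)).
Proof.
intros [HM [v [w [Hg Hv]]]] Hh Hh1. split.
- exact (jet1_near (V := R_NormedModule) (jet2_is_jet1 Hh) HM).
- eexists _, _. split; [exact (jet2_reparam g h q v w h1 h2 Hg Hh)|].
  intros H. apply Hv. apply (complex_tangent_scal _ _ (/ h1)) in H.
  replace v with (Cscal2 (RtoC (/ h1)) (Cscal2 h1 v)); [exact H|].
  unfold Cscal2. destruct v as [x y]. cbn [fst snd].
  rewrite !Cmult_assoc, <- RtoC_mult, Rinv_l by exact Hh1. rewrite !Cmult_1_l. reflexivity.
Qed.

(** * Normalizing maps as germs at the origin *)

(** A normalizing map [phi] as the germ [Phi] at the origin that it induces on the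
    translated hypersurface, with an inverse germ [psi]. *)
Definition normalization (M : C2 -> Prop) (p : C2) (phi : C2 -> C2) (N : C2 -> Prop)
    (Phi psi : C2 -> C2) : Prop :=
  (forall q, phi q = Phi (minus q p)) /\ normal_form N /\
  holomorphic_map_at Phi zero /\ holomorphic_map_at psi zero /\
  Phi zero = zero /\ psi zero = zero /\
  locally (zero : C2) (fun a => psi (Phi a) = a) /\
  locally (zero : C2) (fun b => Phi (psi b) = b) /\
  locally (zero : C2) (fun a => M (plus a p) <-> N (Phi a)).

Lemma plus_minus_C2 (a p : C2) : plus (minus a p) p = a.
Proof.
unfold minus. rewrite <- plus_assoc. etransitivity; [|apply plus_zero_r].
exact (f_equal (plus a) (plus_opp_l (G := C2) p)).
Qed.

Lemma minus_plus_C2 (a p : C2) : minus (plus a p) p = a.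
Proof.
unfold minus. rewrite <- plus_assoc. etransitivity; [|apply plus_zero_r].
exact (f_equal (plus a) (plus_opp_r (G := C2) p)).
Qed.

Lemma normalizing_map_normalization M p phi N :
  normalizing_map M p phi N -> exists Phi psi, normalization M p phi N Phi psi.
Proof.
intros [Phi [[U [V [psi [HU [HV [U0 [H1 [H2 [H3 H4]]]]]]]]] [[Hz HMN] [HN Hphi]]]].
assert (V0 : V zero) by (rewrite <- Hz; apply H1, U0).
exists Phi, psi. split; [exact Hphi|]. split; [exact HN|].
split; [apply H3, U0|]. split; [apply H4, V0|]. split; [exact Hz|].
split; [rewrite <- Hz at 1; apply H1, U0|].
split; [|split].
- generalize (HU zero U0). apply filter_imp. intros a Ha. apply H1, Ha.
- generalize (HV zero V0). apply filter_imp. intros b Hb. apply H2, Hb.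
- revert HMN. apply filter_imp. intros a Ha. rewrite <- Ha. unfold image, translation. split.
  + intros HM. exists (plus a p). split; [exact HM|]. symmetry. apply minus_plus_C2.
  + intros [a' [HM ->]]. rewrite plus_minus_C2. exact HM.
Qed.

Lemma jet2_centre (g : R -> C2) p v w :
  has_jet2 g p v w -> has_jet2 (fun t => minus (g t) p) zero v w.
Proof.
intros H. replace (zero : C2) with (plus p (opp p)) by exact (plus_opp_r (G := C2) p).
apply jet2_translate, H.
Qed.
Arguments jet2_centre {g p v w}.

Lemma holomorphic_map_near (F : C2 -> C2) (P : C2 -> Prop) :
  holomorphic_map_at F zero -> F zero = zero -> locally (zero : C2) P ->
  locally (zero : C2) (fun b => P (F b)).
Proof.
intros [H1 H2] H0 HP.
destruct (taylor6_vanishing _ (holomorphic_taylor6 _ H1)) as [K1 [d1 [HK1 [Hd1 T1]]]].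
{ change (fst (F zero) = RtoC 0). rewrite H0. reflexivity. }
destruct (taylor6_vanishing _ (holomorphic_taylor6 _ H2)) as [K2 [d2 [HK2 [Hd2 T2]]]].
{ change (snd (F zero) = RtoC 0). rewrite H0. reflexivity. }
apply locally_C2 in HP. destruct HP as [d [Hd HP]].
assert (P1 : 0 < d / (K1 + 1)) by (apply Rdiv_lt_0_compat; lra).
assert (P2 : 0 < d / (K2 + 1)) by (apply Rdiv_lt_0_compat; lra).
set (r := Rmin (Rmin d1 d2) (Rmin (d / (K1 + 1)) (d / (K2 + 1)))).
assert (Hr : 0 < r) by (repeat apply Rmin_pos; assumption).
apply locally_C2. exists (r / 2). split; [lra|]. intros b B1 B2.
rewrite fst_sub_zero in B1. rewrite snd_sub_zero in B2.
assert (Hs : size2 b < r) by (unfold size2; lra).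
pose proof (size2_nonneg b) as Hs0.
apply Rmin_Rgt_l in Hs. destruct Hs as [L L'].
apply Rmin_Rgt_l in L, L'. destruct L as [L1 L2], L' as [L3 L4].
specialize (T1 b L1). specialize (T2 b L2). rewrite pow_1 in T1, T2.
assert (size2 b * (K1 + 1) < d) by (apply lt_div_succ; lra).
assert (size2 b * (K2 + 1) < d) by (apply lt_div_succ; lra).
apply HP; [rewrite fst_sub_zero|rewrite snd_sub_zero]; lra.
Qed.

Section Normalization.
Context (M : C2 -> Prop) (p : C2) (phi : C2 -> C2) (N : C2 -> Prop) (Phi psi : C2 -> C2)
  (Hphi : normalization M p phi N Phi psi).

Lemma normalization_jets :
  exists L Q : C2 -> C2, (forall v, L (J v) = J (L v)) /\
  forall g v w, has_jet2 g p v w -> has_jet2 (fun t => phi (g t)) zero (L v) (plus (L w) (Q v)).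
Proof.
destruct Hphi as [E [_ [H [_ [Hz _]]]]].
destruct (jet_map Phi zero H) as [L [Q [HJ [_ HQ]]]]. rewrite Hz in HQ.
exists L, Q. split; [exact HJ|]. intros g v w Hg.
generalize (HQ _ _ _ (jet2_centre Hg)). apply jet2_ext.
apply filter_forall. intros t. symmetry. apply E.
Qed.

Lemma normalization_preserves_jets g d v w :
  has_jet2 g p v w -> has_jet2 d p v w ->
  exists v' w', has_jet2 (fun t => phi (g t)) zero v' w' /\ has_jet2 (fun t => phi (d t)) zero v' w'.
Proof.
intros Hg Hd. destruct normalization_jets as [L [Q [_ H]]].
eexists _, _. split; [exact (H g v w Hg)|exact (H d v w Hd)].
Qed.

(** If the image velocity were complex tangent, the inverse germ would make the original
    one complex tangent. *)
Lemma transversal_push g :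
  transversal_curve M p g -> transversal_curve N zero (fun t => phi (g t)).
Proof.
intros [HM [v [w [Hg Hv]]]].
destruct normalization_jets as [L [Q [HJ HL]]].
pose proof Hphi as [E [HN [HPhi [Hpsi [Hz [Hz' [HI1 [HI2 HMN]]]]]]]].
pose proof (jet2_centre Hg) as Hg0. pose proof (jet2_is_jet1 Hg0) as Hg1.
split.
- apply filter_imp with (2 := filter_and _ _ HM (jet1_near Hg1 HMN)).
  intros t [A B]. rewrite E. apply B. rewrite plus_minus_C2. exact A.
- eexists _, _. split; [exact (HL g v w Hg)|]. intros HT. apply Hv.
  destruct (jet_map psi zero Hpsi) as [L' [Q' [HJ' [HL1 HL2]]]]. rewrite Hz' in HL1, HL2.
  assert (Ev : L' (L v) = v).
  { pose proof (HL2 _ _ _ (HL g v w Hg)) as K.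
    assert (Hnear : locally 0 (fun t => psi (phi (g t)) = minus (g t) p)).
    { pose proof (jet1_near Hg1 HI1) as K'. revert K'. apply filter_imp. intros t A. rewrite E. exact A. }
    apply (jet2_ext Hnear) in K.
    destruct (jet2_unique K Hg0) as [_ [Ev _]]. exact Ev. }
  rewrite <- Ev.
  apply (complex_tangent_push N M (fun b => plus (psi b) p) L' zero p (L v) HJ').
  + intros g' v' Hg'. pose proof (jet1_translate _ _ _ p (HL1 g' v' Hg')) as K.
    rewrite plus_zero_l in K. exact K.
  + assert (Hc : locally (zero : C2) (fun b => M (plus (psi b) p) <-> N (Phi (psi b)))).
    { exact (holomorphic_map_near psi _ Hpsi Hz' HMN). }
    apply filter_imp with (2 := filter_and _ _ Hc HI2). intros b [A B] Hb. apply A. rewrite B. exact Hb.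
  + exact HT.
Qed.
End Normalization.

(** * Complex collinearity of velocity and acceleration *)

(** It vanishes when the two vectors are complex collinear. *)
Definition Cdet (v w : C2) : C := (fst v * snd w - snd v * fst w)%C.

(** A change of parameter multiplies the velocity by [k1] and adds a multiple of it to
    [k1^2] times the acceleration. *)
Lemma Cdet_reparam (k1 k2 : C) v w :
  Cdet (Cscal2 k1 v) (plus (Cscal2 k2 v) (Cscal2 k1 (Cscal2 k1 w))) = (k1 ^ 3 * Cdet v w)%C.
Proof.
destruct v as [v1 v2], w as [w1 w2]. unfold Cdet, Cscal2. cbn [fst snd].
change (k1 * v1 * (k2 * v2 + k1 * (k1 * w2)) - k1 * v2 * (k2 * v1 + k1 * (k1 * w1)) = k1 ^ 3 * (v1 * w2 - v2 * w1))%C.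
ring.
Qed.

Lemma Cdet_zero_iff k x : k <> RtoC 0 -> ((k ^ 3 * x)%C = RtoC 0 <-> x = RtoC 0).
Proof.
intros Hk. split; [|intros ->; ring]. intros H.
destruct (Ceq_dec x 0) as [E|E]; [exact E|].
destruct (Cmult_neq_0 _ _ (Cpow_nz k 3 Hk) E H).
Qed.

Definition quad (a : nat -> nat -> C) (x y : C) : C :=
  (a 1%nat 0%nat * x + a 0%nat 1%nat * y
   + (a 2%nat 0%nat * (x * x) + a 1%nat 1%nat * (x * y) + a 0%nat 2%nat * (y * y)))%C.

Lemma box_quad a : bigO size2 3 (fun b => box a (fst b) (snd b) - (a 0%nat 0%nat + quad a (fst b) (snd b)))%C.
Proof.
set (low := fun (b : C2) j k => if Nat.leb (j + k) 2 then term a (fst b) (snd b) j k else RtoC 0).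
apply (bigO_ext size2 3 (fun b => csum (fun j => csum (fun k => term a (fst b) (snd b) j k - low b j k) 5) 5)%C).
{ intros [x y]. transitivity (box a x y - dsum 5 5 (low (x, y)))%C.
  - transitivity (dsum 5 5 (fun j k => term a x y j k + (-(1)) * low (x, y) j k)%C).
    + apply dsum_ext. intros. cbn [fst snd]. ring.
    + rewrite dsum_plus, dsum_scal. unfold box. ring.
  - cbn [fst snd]. f_equal. f_equal. unfold dsum. repeat rewrite ?csum_S, ?csum_0.
    unfold low, term, quad. cbn [Nat.leb Nat.add fst snd]. ring. }
apply (bigO_csum size2 3 5 (fun j (b : C2) => csum (fun k => term a (fst b) (snd b) j k - low b j k)%C 5)). intros j.
apply (bigO_csum size2 3 5 (fun k (b : C2) => term a (fst b) (snd b) j k - low b j k)%C). intros k.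
unfold low. destruct (Nat.leb (j + k) 2) eqn:E.
- apply (bigO_ext size2 3 (fun _ => RtoC 0)); [intros; ring|apply bigO_zero].
- apply Nat.leb_gt in E.
  apply (bigO_ext size2 3 (fun b : C2 => a j k * (fst b ^ j * snd b ^ k))%C); [intros [x y]; unfold term; cbn [fst snd]; ring|].
  apply bigO_scal. apply (bigO_weaken _ size2_nonneg (j * 1 + k * 1)); [lia|].
  apply (bigO_mult _ (j * 1) (k * 1)); [exact (bigO_pow _ 1 _ j bigO_fst)|exact (bigO_pow _ 1 _ k bigO_snd)].
Qed.

(** The curve [u] and the quadratic Taylor polynomial of [f] along [g] are both of class C^2
    and differ by O(t^3), so they have the same 2-jet. *)
Lemma taylor6_jet2 a f (g : R -> C2) (u : R -> C) v w u0 u1 u2 :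
  taylor6 a f -> f zero = RtoC 0 -> has_jet2 g zero v w ->
  has_jet2 (V := CR) u u0 u1 u2 -> locally 0 (fun t => u t = f (g t)) ->
  u1 = (a 1%nat 0%nat * fst v + a 0%nat 1%nat * snd v)%C /\
  u2 = (a 1%nat 0%nat * fst w + a 0%nat 1%nat * snd w
     + 2 * (a 2%nat 0%nat * (fst v * fst v) + a 1%nat 1%nat * (fst v * snd v) + a 0%nat 2%nat * (snd v * snd v)))%C.
Proof.
intros Ha Hf Hg Hu Huf.
assert (Hz0 : size2 zero = 0) by (unfold size2; change (Cmod (RtoC 0) + Cmod (RtoC 0) = 0); rewrite Cmod_0; ring).
assert (O3 : bigO size2 3 (fun b => f b - (a 0%nat 0%nat + quad a (fst b) (snd b)))%C).
{ apply (bigO_ext size2 3 (fun b => (f b - box a (fst b) (snd b)) + (box a (fst b) (snd b) - (a 0%nat 0%nat + quad a (fst b) (snd b))))%C); [intros; ring|].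
  apply bigO_plus; [apply (bigO_weaken _ size2_nonneg 6); [lia|exact Ha]|apply box_quad]. }
assert (a00 : a 0%nat 0%nat = RtoC 0).
{ pose proof (bigO_at_zero size2 2 _ _ Hz0 O3) as Z. cbv beta in Z. rewrite Hf in Z.
  change (0 - (a 0%nat 0%nat + quad a 0 0) = 0)%C in Z.
  replace (a 0%nat 0%nat) with (- (0 - (a 0%nat 0%nat + quad a 0 0)))%C by (unfold quad; ring). rewrite Z. ring. }
pose proof (jet2_is_jet1 Hg) as Hg1.
pose proof Hg as Hg2. apply jet2_C2 in Hg2. destruct Hg2 as [Jx Jy].
change (fst (zero : C2)) with (RtoC 0) in Jx. change (snd (zero : C2)) with (RtoC 0) in Jy.
destruct (jet1_lipschitz (jet2_is_jet1 Jx)) as [K1 [d1 [HK1 [Hd1 H1]]]].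
destruct (jet1_lipschitz (jet2_is_jet1 Jy)) as [K2 [d2 [HK2 [Hd2 H2]]]].
destruct (bigO_comp Rabs Rabs_pos size2 size2_nonneg 3 _ g (K1 + K2) O3) as [K [d [HK [Hd H]]]]; [lra| |].
{ exists (Rmin d1 d2). split; [apply Rmin_pos; assumption|]. intros t Ht. apply Rmin_Rgt_l in Ht.
  specialize (H1 t (proj1 Ht)). specialize (H2 t (proj2 Ht)). unfold size2. lra. }
pose proof (jet2_scal (a 1%nat 0%nat) Jx) as T1.
pose proof (jet2_scal (a 0%nat 1%nat) Jy) as T2.
pose proof (jet2_scal (a 2%nat 0%nat) (jet2_mult Jx Jx)) as T3.
pose proof (jet2_scal (a 1%nat 1%nat) (jet2_mult Jx Jy)) as T4.
pose proof (jet2_scal (a 0%nat 2%nat) (jet2_mult Jy Jy)) as T5.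
pose proof (jet2_plus (jet2_plus T1 T2)
  (jet2_plus (jet2_plus T3 T4) T5)) as T.
pose proof (jet2_plus Hu (jet2_scal (-(1))%C T)) as Tr.
destruct Huf as [d3 Huf]. pose proof (cond_pos d3) as Hd3.
apply (flat_jet2 _ _ _ _ K (Rmin d d3)) in Tr.
- destruct Tr as [_ [R1 R2]]. clear - R1 R2. destruct v as [x y], w as [x' y']. cbn [fst snd] in *.
  split; apply Csub_eq0; [rewrite <- R1|rewrite <- R2]; ring.
- apply Rmin_pos; assumption.
- intros t [Ht Htd]. apply Rmin_Rgt_l in Htd. destruct Htd as [L1 L2].
  specialize (H t). rewrite (Rabs_pos_eq t Ht) in H. specialize (H L1).
  rewrite (Huf t).
  2:{ change (Rabs (t - 0) < d3). rewrite Rminus_0_r, Rabs_pos_eq; lra. }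
  eapply Rle_trans; [|exact H]. right. f_equal. unfold quad. rewrite a00.
  destruct (g t) as [x y]. cbn [fst snd]. ring.
Qed.

(** Let [H] be the transition. The determinant of the image 2-jet is
    [det H' * Cdet V W + det (H' V, H'' (V, V))], and the second term is 0 because the 2-jet of [H]
    is projective. *)
Lemma normalization_det M p phi N Phi psi phi' N' Phi' psi' g V W V' W' :
  normalization M p phi N Phi psi -> normalization M p phi' N' Phi' psi' ->
  (exists v w, has_jet2 g p v w) ->
  has_jet2 (fun t => phi (g t)) zero V W -> has_jet2 (fun t => phi' (g t)) zero V' W' ->
  Cdet V W = RtoC 0 -> Cdet V' W' = RtoC 0.
Proof.
intros [E [HN [HPhi [Hpsi [Hz [Hz' [HI1 [HI2 HMN]]]]]]]]
  [E' [HN' [[HP1 HP2] [Hpsi' [Hzz [Hzz' [HI1' [HI2' HMN']]]]]]]] [v [w Hg]] HV HV' Hdet.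
set (H := fun b => Phi' (psi b)).
destruct (taylor6_comp _ psi zero HP1 Hz' Hpsi) as [a Ha].
destruct (taylor6_comp _ psi zero HP2 Hz' Hpsi) as [b Hb].
assert (HH0 : H zero = zero) by (unfold H; rewrite Hz'; exact Hzz).
assert (HHN : locally (zero : C2) (fun q => N q -> N' (H q))).
{ pose proof (holomorphic_map_near psi _ Hpsi Hz' HMN) as A.
  pose proof (holomorphic_map_near psi _ Hpsi Hz' HMN') as A'.
  apply filter_imp with (2 := filter_and _ _ (filter_and _ _ A A') HI2).
  intros q [[B B'] C] Hq. apply B', B. rewrite C. exact Hq. }
pose proof (normal_form_map_2jet N N' H a b HN HN' Ha Hb HH0 HHN (fst V) (snd V)) as HF.
pose proof (jet2_centre Hg) as Hg0.
assert (Hnear : locally 0 (fun t => phi' (g t) = H (phi (g t)))).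
{ pose proof (jet1_near (jet2_is_jet1 Hg0) HI1) as K. revert K. apply filter_imp.
  intros t A. unfold H. rewrite E, E', A. reflexivity. }
apply jet2_C2 in HV'. destruct HV' as [J1 J2'].
assert (F1 : fst (H zero) = RtoC 0) by (rewrite HH0; reflexivity).
assert (F2 : snd (H zero) = RtoC 0) by (rewrite HH0; reflexivity).
assert (N1 : locally 0 (fun t => fst (phi' (g t)) = fst (H (phi (g t))))).
{ revert Hnear. apply filter_imp. intros t ->. reflexivity. }
assert (N2 : locally 0 (fun t => snd (phi' (g t)) = snd (H (phi (g t))))).
{ revert Hnear. apply filter_imp. intros t ->. reflexivity. }
destruct (taylor6_jet2 a (fun q => fst (H q)) (fun t => phi (g t)) (fun t => fst (phi' (g t)))
  V W _ _ _ Ha F1 HV J1 N1) as [A1 A2].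
destruct (taylor6_jet2 b (fun q => snd (H q)) (fun t => phi (g t)) (fun t => snd (phi' (g t)))
  V W _ _ _ Hb F2 HV J2' N2) as [B1 B2].
unfold Cdet in *. rewrite A1, A2, B1, B2. clear - HF Hdet.
destruct V as [x y], W as [x' y']. cbn [fst snd] in *.
set (Q := (_ - _)%C) in HF. set (D := (_ - _)%C) in Hdet.
transitivity ((a 1%nat 0%nat * b 0%nat 1%nat - a 0%nat 1%nat * b 1%nat 0%nat) * D + 2 * Q)%C; [unfold Q, D; ring|].
rewrite HF, Hdet. ring.
Qed.

(** * The surface of 2-jets *)

Lemma same_jet2_refl (g : R -> C2) a v w : has_jet2 g a v w -> same_jet2 g g.
Proof.
intros H. exists (fun t => t), 1, 0, a, v, w. split; [exact jet2_id|].
split; [apply R1_neq_R0|]. split; exact H.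
Qed.

Lemma same_jet2_jets (g d : R -> C2) p v w : same_jet2 g d -> has_jet2 d p v w ->
  exists (h : R -> R) (h1 h2 : R), has_jet2 (V := R_NormedModule) h 0 h1 h2 /\ h1 <> 0 /\
    has_jet2 (fun t => g (h t)) p v w.
Proof.
intros [h [h1 [h2 [a [v' [w' [Hh [Hh1 [Hg Hd]]]]]]]]] H.
destruct (jet2_unique H Hd) as [-> [-> ->]].
exists h, h1, h2. auto.
Qed.

Section Sigma.
Context (M : C2 -> Prop) (p : C2) (phi : C2 -> C2) (N : C2 -> Prop) (Phi psi : C2 -> C2)
  (Hphi : normalization M p phi N Phi psi).
Context (j : jet) (g0 : R -> C2) (Hg0 : transversal_curve M p g0)
  (Hj : forall d, j d <-> transversal_curve M p d /\ same_jet2 g0 d).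

(** Representatives of [j] differ by a change of parameter to second order, and so do
    their images. *)
Lemma push_jet_class d :
  push_jet phi N zero j d <-> transversal_curve N zero d /\ same_jet2 (fun t => phi (g0 t)) d.
Proof.
unfold push_jet. split; intros [Hd H]; (split; [exact Hd|]).
- destruct H as [g [Hg Hsame]]. apply Hj in Hg. destruct Hg as [Hgt Hg].
  destruct Hgt as [_ [v [w [Jg _]]]].
  destruct (same_jet2_jets _ _ _ _ _ Hg Jg) as [h [h1 [h2 [Hh [Hh1 Jgh]]]]].
  destruct (normalization_preserves_jets _ _ _ _ _ _ Hphi _ _ _ _ Jgh Jg) as [v' [w' [K1 K2]]].
  destruct Hsame as [k [k1 [k2 [a [x [y [Hk [Hk1 [Hgk Jd]]]]]]]]].
  pose proof (jet2_reparam _ _ _ _ _ _ _ K1 Hk) as R1.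
  pose proof (jet2_reparam _ _ _ _ _ _ _ K2 Hk) as R2.
  destruct (jet2_unique R2 Hgk) as [E1 [E2 E3]].
  destruct (jet2_comp_R _ _ _ _ _ _ Hh Hk) as [c Hc].
  exists (fun t => h (k t)), (k1 * h1), c, a, x, y. split; [exact Hc|].
  split; [apply Rmult_integral_contrapositive_currified; assumption|].
  split; [|exact Jd]. rewrite <- E1, <- E2, <- E3. exact R1.
- exists g0. split; [|exact H]. apply Hj. split; [exact Hg0|].
  destruct Hg0 as [_ [v [w [Jg _]]]]. exact (same_jet2_refl _ _ _ _ Jg).
Qed.

(** In graph coordinates the velocity is [(z1, 1)] and, by [normal_form_jets], the
    acceleration is [(z2, 2 i |z1|^2)]. Collinearity means [z2 = 2 i z1 |z1|^2], whose real and
    imaginary parts are the two equations of the surface. A curve is brought into graph form by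
    the inverse of [t -> Re (snd (phi (g0 t)))]. *)
Lemma Sigma0_iff_Cdet V W : has_jet2 (fun t => phi (g0 t)) zero V W ->
  (Sigma0 N (push_jet phi N zero j) <-> Cdet V W = RtoC 0).
Proof.
intros HVW. pose proof (transversal_push _ _ _ _ _ _ Hphi g0 Hg0) as HT.
pose proof Hphi as [_ [HN _]].
assert (HJ2 : J2 N zero (push_jet phi N zero j)).
{ exists (fun t => phi (g0 t)). split; [exact HT|]. intros d. apply push_jet_class. }
(* Vanishing of the determinant in graph coordinates. *)
assert (Graph : forall (d : R -> C2) (v w : C2), transversal_curve N zero d ->
  locally 0 (fun t => Re (snd (d t)) = t) -> has_jet2 d zero v w ->
  (Cdet v w = RtoC 0 <->
   Re (fst w) = - 2 * Re (fst v) ^ 2 * Im (fst v) - 2 * Im (fst v) ^ 3 /\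
   Im (fst w) = 2 * Re (fst v) * Im (fst v) ^ 2 + 2 * Re (fst v) ^ 3)).
{ intros d v w Hd Hu Jd.
  destruct (normal_form_jets N d v w HN (proj1 Hd) Jd) as [I1 I2].
  assert (Jre : has_jet2 (V := R_NormedModule) (fun t => Re (snd (d t))) 0 1 0).
  { apply (jet2_ext (V := R_NormedModule) (g := fun t => t)); [|exact jet2_id].
    revert Hu. apply filter_imp. intros t ->. reflexivity. }
  pose proof Jd as Jd2. apply jet2_C2 in Jd2. destruct Jd2 as [_ Js].
  destruct (jet2_unique_R (jet2_Re Js) Jre) as [_ [R1 R2]].
  destruct v as [v1 v2], w as [w1 w2]. cbn [fst snd] in *.
  assert (v2 = RtoC 1) as -> by (apply C_eq; rewrite ?re_RtoC, ?im_RtoC; assumption).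
  rewrite re_mult, re_conj, im_conj in I2.
  unfold Cdet. cbn [fst snd].
  assert (D1 : Re (v1 * w2 - RtoC 1 * w1)%C = - Im v1 * Im w2 - Re w1).
  { rewrite re_minus, !re_mult, re_RtoC, im_RtoC, R2. ring. }
  assert (D2 : Im (v1 * w2 - RtoC 1 * w1)%C = Re v1 * Im w2 - Im w1).
  { rewrite im_minus, !im_mult, re_RtoC, im_RtoC, R2. ring. }
  rewrite I2 in D1, D2. split.
  - intros H. rewrite H in D1, D2. rewrite re_RtoC in D1. rewrite im_RtoC in D2.
    split; [clear - D1|clear - D2]; simpl; lra.
  - intros [H1 H2]. apply C_eq; rewrite ?re_RtoC, ?im_RtoC, ?D1, ?D2, ?H1, ?H2; ring. }
assert (Class : forall (h : R -> R) (h1 h2 : R) d v w,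
  has_jet2 (V := R_NormedModule) h 0 h1 h2 -> h1 <> 0 ->
  has_jet2 (fun t => phi (g0 (h t))) zero v w -> has_jet2 d zero v w ->
  (Cdet V W = RtoC 0 <-> Cdet v w = RtoC 0)).
{ intros h h1 h2 d v w Hh Hh1 H1 H2.
  destruct (jet2_unique H1 (jet2_reparam _ _ _ _ _ _ _ HVW Hh)) as [_ [-> ->]].
  rewrite Cdet_reparam. symmetry. apply Cdet_zero_iff. intros E. apply Hh1, RtoC_inj, E. }
split.
- intros [_ [x1 [y1 [x2 [y2 [[d [v [w [Hd [Hu [Jd [Ev Ew]]]]]]] Heq]]]]]].
  apply push_jet_class in Hd. destruct Hd as [Hd Hs].
  destruct (same_jet2_jets _ _ _ _ _ Hs Jd) as [h [h1 [h2 [Hh [Hh1 Jh]]]]].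
  apply (Class h h1 h2 d v w Hh Hh1 Jh Jd).
  apply (Graph d v w Hd Hu Jd). rewrite Ev, Ew. exact Heq.
- intros Hdet. split; [exact HJ2|].
  pose proof (normal_form_transversal N _ V W HN HT HVW) as Hne.
  pose proof HVW as HV2. apply jet2_C2 in HV2. destruct HV2 as [_ Js].
  destruct (inverse_jet2 _ _ _ (jet2_Re Js) Hne) as [h [h1 [h2 [Hh [Hh1 Hu]]]]].
  pose proof (jet2_reparam _ _ _ _ _ _ _ HVW Hh) as Jd.
  pose proof (transversal_reparam _ _ _ _ _ _ HT Hh Hh1) as Hd.
  set (d := fun t => phi (g0 (h t))) in *.
  set (v := Cscal2 h1 V) in *. set (w := plus _ _) in Jd.
  exists (Re (fst v)), (Im (fst v)), (Re (fst w)), (Im (fst w)). split.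
  + exists d, v, w. split; [|split; [exact Hu|split; [exact Jd|split; apply surjective_pairing]]].
    apply push_jet_class. split; [exact Hd|].
    exists h, h1, h2, zero, v, w. auto.
  + apply (Graph d v w Hd Hu Jd). apply (Class h h1 h2 d v w Hh Hh1 Jd Jd). exact Hdet.
Qed.
End Sigma.

Lemma Sigma_subset (M : C2 -> Prop) (p : C2) (phi phi' : C2 -> C2) (N N' : C2 -> Prop) (j : jet) :
  normalizing_map M p phi N -> normalizing_map M p phi' N' ->
  Sigma M p phi N j -> Sigma M p phi' N' j.
Proof.
intros H H' [HJ HS]. split; [exact HJ|].
destruct (normalizing_map_normalization _ _ _ _ H) as [Phi [psi Hn]].
destruct (normalizing_map_normalization _ _ _ _ H') as [Phi' [psi' Hn']].
destruct HJ as [g [Hg Hj]].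
pose proof Hg as [_ [v [w [Jg _]]]].
destruct (normalization_preserves_jets _ _ _ _ _ _ Hn _ _ _ _ Jg Jg) as [V [W [HV _]]].
destruct (normalization_preserves_jets _ _ _ _ _ _ Hn' _ _ _ _ Jg Jg) as [V' [W' [HV' _]]].
apply (Sigma0_iff_Cdet _ _ _ _ _ _ Hn j g Hg Hj V W HV) in HS.
apply (Sigma0_iff_Cdet _ _ _ _ _ _ Hn' j g Hg Hj V' W' HV').
apply (normalization_det _ _ _ _ _ _ _ _ _ _ g V W V' W' Hn Hn'); try assumption.
exists v, w. exact Jg.
Qed.

Theorem mainTheorem4 :
  forall (M : C2 -> Prop) (p : C2),
    real_analytic_hypersurface M ->
    levi_nondegenerate M ->
    M p ->
    forall (phi phi' : C2 -> C2) (N N' : C2 -> Prop),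
      normalizing_map M p phi N ->
      normalizing_map M p phi' N' ->
      forall j : jet, Sigma M p phi N j <-> Sigma M p phi' N' j.
Proof.
intros M p _ _ _ phi phi' N N' H H' j.
split; apply Sigma_subset; assumption.
Qed.
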